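(* Let $d_n=[z^n]D(z)$ be the total weight of excursions of length $n$ ending with a catastrophe. Then: (i) if $\rho_0<\rho$, then $d_n=\frac{\rho_0^{-n}}{\rho_0Q'(\rho_0)}+o(K^n)$ for some $K<1/\rho_0$; (ii) if $\rho_0=\rho$, then $d_n=\frac{\rho^{-n}}{\eta\sqrt{\pi n}}\big(1+O(1/n)\big)$; (iii) if $\rho_0$ does not exist, then $d_n=\frac{D(\rho)^2\eta\,\rho^{-n}}{2\sqrt{\pi n^3}}\big(1+O(1/n)\big)$. The last two cases occur only when $\delta<0$.
   Context: Fix integers $c,d\ge1$ and non-negative real weights $p_{-c},\dots,p_d$ with $p_{-c}\neq0\neq p_d$; jump set $\mathcal J=\{i: p_i\neq0\}$, jump polynomial $P(u)=\sum_{i=-c}^dp_iu^i$. Standing assumption: $P$ is aperiodic (there are no integer $b$, integer $p\ge2$ and Laurent polynomial $H$ with $P(u)=u^bH(u^p)$). A catastrophe is a step from an altitude $h>0$ with $-h\notin\mathcal J$ directly to altitude $0$, of weight $q>0$. Paths start at altitude $0$; each step is a jump $i\in\mathcal J$ (weight $p_i$) or a catastrophe; the weight of a path is the product of its step weights, and ''number'' means total weight. Meanders never go below $0$; excursions are meanders ending at $0$. Let $M(z,u)=\sum m_{n,k}z^nu^k$, with $m_{n,k}$ the total weight of catastrophe-free meanders of length $n$ ending at altitude $k$; $M_k(z)=[u^k]M(z,u)$, $M(z)=M(z,1)$, $E(z)=M_0(z)$. Let $Q(z)=zq\big(M(z)-E(z)-\sum_{j>0,-j\in\mathcal J}M_j(z)\big)$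 and $D(z)=1/(1-Q(z))$ (the generating function of excursions that are empty or end with a catastrophe). Let $\tau>0$ be the minimal positive real solution of $P'(\tau)=0$, $\rho=1/P(\tau)$, $\delta=P'(1)$. Let $\rho_0$ be the smallest positive real zero of $1-Q(z)$ satisfying $\rho_0\le\rho$, if it exists (''$\rho_0$ does not exist'' otherwise). In the cases $\rho_0=\rho$ or $\rho_0$ nonexistent, $\eta$ is defined by the Puiseux expansion $Q(z)=Q(\rho)-\eta\sqrt{1-z/\rho}+O(1-z/\rho)$ as $z\to\rho$. *)

(* Defs.v *)
From Stdlib Require Import Reals ZArith List Lra Lia.
From Coquelicot Require Import Coquelicot.
Open Scope R_scope.

Definition zrange (a b : Z) : list Z :=
  map (fun k => (a + Z.of_nat k)%Z) (seq 0 (Z.to_nat (b - a + 1))).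

Definition zsum (f : Z -> R) (a b : Z) : R :=
  fold_right Rplus 0 (map f (zrange a b)).

Definition jumpP (c d : nat) (p : Z -> R) (u : R) : R :=
  zsum (fun i => p i * powerRZ u i) (- Z.of_nat c) (Z.of_nat d).

(* Aperiodicity: there is no b : Z, period per >= 2 and Laurent polynomial H
   (finitely supported coefficients) with P(u) = u^b H(u^per), i.e.
   coefficientwise p_i = [per | i-b] * H((i-b)/per). *)
Definition aperiodic (p : Z -> R) : Prop :=
  ~ exists (b : Z) (per : nat) (H : Z -> R),
      (2 <= per)%nat /\
      (exists N : Z, forall j : Z, (N < Z.abs j)%Z -> H j = 0) /\
      forall i : Z,
        p i = (if Z.eqb (Z.modulo (i - b) (Z.of_nat per)) 0
               then H (Z.div (i - b) (Z.of_nat per)) else 0).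

(* All words of length n over the letters -c..d (candidate jumps).  Letters i
   with p_i = 0 (not in the jump set) only produce paths of weight 0, so
   summing over all of them gives the same total weight as summing over
   paths with steps in the jump set J. *)
Fixpoint words (c d : nat) (n : nat) : list (list Z) :=
  match n with
  | O => nil :: nil
  | S n' => flat_map (fun i => map (cons i) (words c d n'))
                     (zrange (- Z.of_nat c) (Z.of_nat d))
  end.

Fixpoint stays_nonneg (h : Z) (w : list Z) : bool :=
  match w with
  | nil => true
  | i :: w' => andb (Z.leb 0 (h + i)) (stays_nonneg (h + i) w')
  end.

Definition end_alt (w : list Z) : Z := fold_right Z.add 0%Z w.

Definition path_weight (p : Z -> R) (w : list Z) : R :=
  fold_right (fun i acc => p i * acc) 1 w.

Definition meander_count (c d : nat) (p : Z -> R) (n : nat) (k : Z) : R :=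
  fold_right Rplus 0
    (map (path_weight p)
       (filter (fun w => andb (stays_nonneg 0 w) (Z.eqb (end_alt w) k)) (words c d n))).

Definition meander_total (c d : nat) (p : Z -> R) (n : nat) : R :=
  fold_right Rplus 0
    (map (path_weight p) (filter (fun w => stays_nonneg 0 w) (words c d n))).

(* Coefficients of Q(z) = z q (M(z) - E(z) - sum_{j>0, -j in J} M_j(z)).
   For j > 0, -j in J forces j <= c. *)
Definition Qcoef (c d : nat) (p : Z -> R) (q : R) (n : nat) : R :=
  match n with
  | O => 0
  | S n' =>
      q * (meander_total c d p n' - meander_count c d p n' 0
           - zsum (fun j => if Req_EM_T (p (- j)%Z) 0 then 0
                            else meander_count c d p n' j) 1 (Z.of_nat c))
  end.

Definition Qfun (c d : nat) (p : Z -> R) (q : R) (x : R) : R :=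
  PSeries (Qcoef c d p q) x.

Definition Q_eq_one (c d : nat) (p : Z -> R) (q : R) (x : R) : Prop :=
  is_series (fun n => Qcoef c d p q n * x ^ n) 1.

Definition is_rho0 (c d : nat) (p : Z -> R) (q rho r : R) : Prop :=
  0 < r /\ r <= rho /\ Q_eq_one c d p q r /\
  forall r', 0 < r' < r -> ~ Q_eq_one c d p q r'.

Definition no_rho0 (c d : nat) (p : Z -> R) (q rho : R) : Prop :=
  ~ exists r, 0 < r /\ r <= rho /\ Q_eq_one c d p q r.

(* d_n = [z^n] D(z), D = 1/(1-Q) with Q(0)=0, i.e. D = 1 + Q D. *)
Definition D_coeffs (c d : nat) (p : Z -> R) (q : R) (dn : nat -> R) : Prop :=
  dn O = 1 /\
  forall n, dn (S n) = sum_f_R0 (fun k => Qcoef c d p q (S k) * dn (n - k)%nat) n.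

Definition puiseux_eta (c d : nat) (p : Z -> R) (q rho eta : R) : Prop :=
  ex_series (fun n => Qcoef c d p q n * rho ^ n) /\
  exists C eps, 0 < eps /\
    forall z, rho - eps < z < rho ->
      Rabs (Qfun c d p q z - (Qfun c d p q rho - eta * sqrt (1 - z / rho)))
        <= C * (1 - z / rho).

Definition asymp_rel_O1n (u A : nat -> R) : Prop :=
  exists C : R, exists N : nat, forall n, (N <= n)%nat ->
    Rabs (u n - A n) <= C * Rabs (A n) / INR n.

(* Main.v *)
Require Import Defs.
From Stdlib Require Import Reals ZArith List Lra Lia FunctionalExtensionality Classical_Prop Ranalysis5.
From Coquelicot Require Import Coquelicot.
Open Scope R_scope.

(** Real power series replace contour integrals.  Tilting by [tau] turns the jumps into a centred aperiodic random walk.  Its local probabilities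
    [J n f] (coefficient extractions of [f * pi ^ n]) satisfy an integration by parts identity, which yields
    [(n+1) (b n - b (n+1)) = b n / 2 + O(b n / n)] and, iterating, a full expansion in the coefficients of
    [(1-z)^(i-1/2)]; the error terms are controlled because differencing the law of a sum of [n] aperiodic
    steps gains [n^(-1/2)] in total variation.  By the Wiener-Hopf (Spitzer) factorisation the meander series are
    exponentials of series with such coefficients, so that [Q (rho z) = A + B sqrt (1-z)] where the
    coefficients of [A] and [B] decay as fast as desired.

    Then [D = 1 / (1 - Q)] is a renewal series: the same differencing estimate, applied to the law [Q], shows that
    [(1-z)^4 D] is absolutely summable, and this a priori bound reduces the inversion of [1 - Q] to a local
    problem at [z = 1], solved by a geometric series.  Finally [B(1) < 0], and the divergence of [Q] for
    [delta >= 0], both follow from Wald's identity for the walk stopped at its first negative value. *)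

(** The sign of [delta] decides which tilt is useful. For [delta] < 0 the minimiser [tau] exceeds 1;
    tilting by [tau] turns totals over all altitudes into values at u = 1 / [tau] < 1, where the
    weight 1 / (1 - u / [tau]) is analytic beyond the unit circle. For [delta] >= 0 this fails and
    [rho] may lie outside the disk of convergence of [Q]; one works instead at tilt 1, with radius 1
    / P(1), before which [Q] already reaches 1.

    The obstacle of a purely real argument is that other zeros of 1 - [Q] on the critical circle
    cannot be ruled out by looking at arguments of complex numbers. Positivity and two adjacent
    positive coefficients replace this: they make the powers of [Q] smooth in total variation, which
    leaves 1 as the only possible singularity.

    Orders of decay are counted in powers of 1 / n. Each division by 1 - z costs one; starting with
    6 for [Q] leaves 4 for the inverse, enough for a relative error O(1/n). The number pi enters
    only through the coefficients of (1-z)^(-1/2). *)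

Section PowerSeriesRing.
Context {A : Type} (zero one : A) (add mul sub : A -> A -> A) (opp : A -> A).
Context (AT : ring_theory zero one add mul sub opp eq).
Add Ring A_ring : AT.

(** The ring is a parameter because the construction is used twice: over [R] for [ser], then over
    [ser] for the series [bser] in two variables. The recursion copies [sum_f_R0], so that over [R]
    the generic lemmas transfer by conversion. *)
Fixpoint gsum (f : nat -> A) (n : nat) : A :=
  match n with O => f O | S i => add (gsum f i) (f (S i)) end.

Lemma gsum_ext f g n : (forall k, (k <= n)%nat -> f k = g k) -> gsum f n = gsum g n.
Proof.
  induction n as [|n IH]; intros H; simpl; [now apply H|].
  rewrite IH, H by auto; auto.
Qed.

Lemma gsum_add f g n : gsum (fun k => add (f k) (g k)) n = add (gsum f n) (gsum g n).
Proof. induction n as [|n IH]; simpl; [|rewrite IH]; ring. Qed.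

Lemma gsum_mul_l c f n : gsum (fun k => mul c (f k)) n = mul c (gsum f n).
Proof. induction n as [|n IH]; simpl; [|rewrite IH]; ring. Qed.

Lemma gsum_zero f n : (forall k, (k <= n)%nat -> f k = zero) -> gsum f n = zero.
Proof.
  induction n as [|n IH]; intros H; simpl; [now apply H|].
  rewrite IH, H by auto; ring.
Qed.

Lemma gsum_S_l f n : gsum f (S n) = add (f O) (gsum (fun k => f (S k)) n).
Proof. induction n as [|n IH]; simpl in *; [|rewrite IH]; ring. Qed.

Lemma gsum_rev f n : gsum f n = gsum (fun k => f (n - k)%nat) n.
Proof.
  revert f; induction n as [|n IH]; intros f; [reflexivity|].
  rewrite gsum_S_l, IH.
  cbn [gsum]. rewrite Nat.sub_diag.
  rewrite (gsum_ext (fun k => f (S n - k)%nat) (fun k => f (S (n - k))) n).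
  - ring.
  - intros k Hk; f_equal; lia.
Qed.

(** Both sides enumerate the pairs with i + j <= n, by antidiagonals and by rows. This gives
    associativity of the product and the norm bound of a product. *)
Lemma gsum_triangle (F : nat -> nat -> A) n :
  gsum (fun m => gsum (fun i => F i (m - i)%nat) m) n =
  gsum (fun i => gsum (fun j => F i j) (n - i)%nat) n.
Proof.
  induction n as [|n IH]; [reflexivity|].
  cbn [gsum]. rewrite IH, Nat.sub_diag. cbn [gsum].
  rewrite (gsum_ext (fun i => gsum (fun j => F i j) (S n - i)%nat)
     (fun i => add (gsum (fun j => F i j) (n - i)%nat) (F i (S n - i)%nat))).
  - rewrite gsum_add. ring.
  - intros k Hk. replace (S n - k)%nat with (S (n - k)) by lia. reflexivity.
Qed.

Lemma gsum_swap (F : nat -> nat -> A) n m :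
  gsum (fun i => gsum (fun j => F i j) m) n = gsum (fun j => gsum (fun i => F i j) n) m.
Proof.
  induction n as [|n IH]; [reflexivity|].
  cbn [gsum]. rewrite IH, gsum_add. reflexivity.
Qed.

Lemma gsum_single f n i :
  (i <= n)%nat -> (forall k, (k <= n)%nat -> k <> i -> f k = zero) -> gsum f n = f i.
Proof.
  induction n as [|n IH]; intros Hi H; simpl.
  - now replace i with O by lia.
  - destruct (Nat.eq_dec i (S n)) as [->|Hne].
    + rewrite gsum_zero; [ring|]. intros k Hk; apply H; lia.
    + rewrite IH, (H (S n)); [ring|lia|lia|lia|]. intros k Hk; apply H; lia.
Qed.

Definition gadd (a b : nat -> A) : nat -> A := fun n => add (a n) (b n).
Definition gsub (a b : nat -> A) : nat -> A := fun n => sub (a n) (b n).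
Definition gopp (a : nat -> A) : nat -> A := fun n => opp (a n).
Definition gmul (a b : nat -> A) : nat -> A :=
  fun n => gsum (fun k => mul (a k) (b (n - k)%nat)) n.
Definition gconst (c : A) : nat -> A := fun n => match n with O => c | _ => zero end.

Lemma gmul_comm a b : gmul a b = gmul b a.
Proof.
  extensionality n. unfold gmul. rewrite gsum_rev.
  apply gsum_ext; intros k Hk. replace (n - (n - k))%nat with k by lia. ring.
Qed.

Lemma gmul_assoc a b c : gmul a (gmul b c) = gmul (gmul a b) c.
Proof.
  extensionality n. unfold gmul.
  transitivity (gsum (fun i => gsum (fun j => mul (mul (a i) (b j)) (c (n - i - j)%nat)) (n - i)%nat) n).
  - apply gsum_ext; intros i Hi. rewrite <- gsum_mul_l. apply gsum_ext; intros j Hj. ring.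
  - rewrite <- (gsum_triangle (fun i j => mul (mul (a i) (b j)) (c (n - i - j)%nat))).
    apply gsum_ext; intros m Hm.
    transitivity (mul (c (n - m)%nat) (gsum (fun k => mul (a k) (b (m - k)%nat)) m)); [|ring].
    rewrite <- gsum_mul_l. apply gsum_ext; intros k Hk.
    replace (n - k - (m - k))%nat with (n - m)%nat by lia. ring.
Qed.

Lemma gconst_mul c b n : gmul (gconst c) b n = mul c (b n).
Proof.
  unfold gmul. rewrite (gsum_single _ n 0); [now rewrite Nat.sub_0_r| lia |].
  intros [|k] _ Hk; [now destruct Hk|]. simpl; ring.
Qed.

Lemma gps_ring : ring_theory (gconst zero) (gconst one) gadd gmul gsub gopp eq.
Proof.
  split; intros; try (extensionality n; unfold gadd, gopp, gsub).
  - destruct n; simpl; ring.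
  - ring.
  - ring.
  - rewrite gconst_mul; ring.
  - now rewrite gmul_comm.
  - now rewrite gmul_assoc.
  - unfold gmul. rewrite <- gsum_add. apply gsum_ext; intros k Hk. ring.
  - ring.
  - destruct n; simpl; ring.
Qed.

End PowerSeriesRing.

(** * Real power series: ring structure, Euler derivation, rescaling *)

Definition ser := nat -> R.

Definition sadd : ser -> ser -> ser := gadd Rplus.
Definition ssub : ser -> ser -> ser := gsub Rminus.
Definition sopp : ser -> ser := gopp Ropp.
Definition smul : ser -> ser -> ser := gmul Rplus Rmult.
Definition cst : R -> ser := gconst 0.

Lemma R_ring_theory : ring_theory 0 1 Rplus Rmult Rminus Ropp eq.
Proof. split; intros; ring. Qed.

Lemma ser_ring : ring_theory (cst 0) (cst 1) sadd smul ssub sopp (@eq ser).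
Proof. exact (gps_ring _ _ _ _ _ _ R_ring_theory). Qed.
Add Ring ser_ring_inst : ser_ring.

Declare Scope ser_scope.
Delimit Scope ser_scope with ser.
Bind Scope ser_scope with ser.
Infix "+" := sadd : ser_scope.
Infix "*" := smul : ser_scope.
Infix "-" := ssub : ser_scope.
Notation "- x" := (sopp x) : ser_scope.

Fixpoint spow (a : ser) (n : nat) : ser :=
  match n with O => cst 1 | S k => smul a (spow a k) end.
Infix "^" := spow : ser_scope.

Definition var : ser := fun n => match n with 1%nat => 1 | _ => 0 end.

Lemma smulE (a b : ser) n : (a * b)%ser n = sum_f_R0 (fun k => a k * b (n - k)%nat) n.
Proof. reflexivity. Qed.

Lemma sum_single f n i :
  (i <= n)%nat -> (forall k, (k <= n)%nat -> k <> i -> f k = 0) -> sum_f_R0 f n = f i.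
Proof. exact (gsum_single _ _ _ _ _ _ R_ring_theory f n i). Qed.

Lemma sum_triangle (F : nat -> nat -> R) n :
  sum_f_R0 (fun m => sum_f_R0 (fun i => F i (m - i)%nat) m) n =
  sum_f_R0 (fun i => sum_f_R0 (fun j => F i j) (n - i)%nat) n.
Proof. exact (gsum_triangle _ _ _ _ _ _ R_ring_theory F n). Qed.

Lemma sum_swap (F : nat -> nat -> R) n m :
  sum_f_R0 (fun i => sum_f_R0 (fun j => F i j) m) n =
  sum_f_R0 (fun j => sum_f_R0 (fun i => F i j) n) m.
Proof. exact (gsum_swap _ _ _ _ _ _ R_ring_theory F n m). Qed.

Lemma saddE (a b : ser) n : (a + b)%ser n = a n + b n.
Proof. reflexivity. Qed.

Lemma ssubE (a b : ser) n : (a - b)%ser n = a n - b n.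
Proof. reflexivity. Qed.

Lemma soppE (a : ser) n : (- a)%ser n = - a n.
Proof. reflexivity. Qed.

Lemma cst_mul c (b : ser) n : (cst c * b)%ser n = c * b n.
Proof. exact (gconst_mul _ _ _ _ _ _ R_ring_theory c b n). Qed.

Lemma cst_add c c' : cst (c + c') = (cst c + cst c')%ser.
Proof. extensionality n. rewrite saddE. destruct n; simpl; ring. Qed.

Lemma cst_mul_cst c c' : cst (c * c') = (cst c * cst c')%ser.
Proof. extensionality n. rewrite cst_mul. destruct n; simpl; ring. Qed.

Lemma cst_opp c : cst (- c) = (- cst c)%ser.
Proof. extensionality n. rewrite soppE. destruct n; simpl; ring. Qed.

Lemma cst_sub c c' : cst (c - c') = (cst c - cst c')%ser.
Proof. extensionality n. rewrite ssubE. destruct n; simpl; ring. Qed.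

Lemma smul_0 (a b : ser) : (a * b)%ser O = a O * b O.
Proof. reflexivity. Qed.

Lemma var_mul_0 (b : ser) : (var * b)%ser O = 0.
Proof. rewrite smul_0. unfold var. ring. Qed.

Lemma var_mul_S (b : ser) n : (var * b)%ser (S n) = b n.
Proof.
  rewrite smulE.
  rewrite (sum_single _ (S n) 1); [| lia |].
  - unfold var. replace (S n - 1)%nat with n by lia. ring.
  - intros [|[|k]] _ Hk; unfold var; try ring. now destruct Hk.
Qed.

Lemma var_spow_mul (b : ser) m n :
  (var ^ m * b)%ser n = if (m <=? n)%nat then b (n - m)%nat else 0.
Proof.
  revert n; induction m as [|m IH]; intros n.
  - simpl spow. rewrite cst_mul, Nat.sub_0_r. simpl. ring.
  - replace (var ^ S m * b)%ser with (var * (var ^ m * b))%ser by (simpl; ring).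
    destruct n as [|n]; [now rewrite var_mul_0|].
    rewrite var_mul_S, IH. reflexivity.
Qed.

Definition omu : ser := (cst 1 - var)%ser.
Definition geom : ser := fun _ => 1.

Lemma omu_mul_0 (b : ser) : (omu * b)%ser O = b O.
Proof. rewrite smul_0. unfold omu. rewrite ssubE. unfold var. simpl. ring. Qed.

Lemma omu_mul_S (b : ser) n : (omu * b)%ser (S n) = b (S n) - b n.
Proof.
  replace (omu * b)%ser with (b - var * b)%ser by (unfold omu; ring).
  now rewrite ssubE, var_mul_S.
Qed.

Lemma geom_mul (b : ser) n : (geom * b)%ser n = sum_f_R0 b n.
Proof.
  replace (geom * b)%ser with (b * geom)%ser by ring. rewrite smulE.
  apply sum_eq. intros; unfold geom; ring.
Qed.

Lemma omu_geom : (omu * geom)%ser = cst 1.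
Proof.
  extensionality n. destruct n as [|n].
  - rewrite omu_mul_0. reflexivity.
  - rewrite omu_mul_S. unfold geom. simpl. ring.
Qed.

Lemma spow_add (a : ser) m n : (a ^ (m + n) = a ^ m * a ^ n)%ser.
Proof. induction m as [|m IH]; simpl; [|rewrite IH]; ring. Qed.

Lemma spow_1 (a : ser) : (a ^ 1 = a)%ser.
Proof. simpl. ring. Qed.

Lemma spow_mul (a : ser) m n : (a ^ (m * n) = (a ^ m) ^ n)%ser.
Proof.
  rewrite Nat.mul_comm. induction n as [|n IH]; simpl; [reflexivity|]. now rewrite spow_add, IH.
Qed.

Lemma smul_spow (a b : ser) n : ((a * b) ^ n = a ^ n * b ^ n)%ser.
Proof. induction n as [|n IH]; simpl; [|rewrite IH]; ring. Qed.

Lemma spow_0th (a : ser) n : (a ^ n)%ser O = a O ^ n.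
Proof. induction n as [|n IH]; simpl spow; [reflexivity|]. rewrite smul_0, IH. reflexivity. Qed.

(** The Euler operator u d/du replaces the derivative: it is a derivation that keeps indices in
    place, and a bound on [theta a] is a bound on n times the coefficients of [a]. *)
Definition theta (a : ser) : ser := fun n => INR n * a n.

Lemma theta_add a b : theta (a + b) = (theta a + theta b)%ser.
Proof. extensionality n. unfold theta. rewrite !saddE. ring. Qed.

Lemma theta_sub a b : theta (a - b) = (theta a - theta b)%ser.
Proof. extensionality n. unfold theta. rewrite !ssubE. ring. Qed.

Lemma theta_cst c : theta (cst c) = cst 0.
Proof. extensionality n. unfold theta. destruct n; simpl; ring. Qed.

Lemma theta_mul a b : theta (a * b) = (theta a * b + a * theta b)%ser.
Proof.
  extensionality n. unfold theta. rewrite saddE, !smulE, scal_sum, <- sum_plus.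
  apply sum_eq; intros k Hk. rewrite (minus_INR _ _ Hk). ring.
Qed.

Lemma theta_cst_mul c a : theta (cst c * a) = (cst c * theta a)%ser.
Proof. extensionality n. unfold theta. rewrite !cst_mul. ring. Qed.

Lemma theta_var : theta var = var.
Proof. extensionality n. unfold theta. destruct n as [|[|n]]; simpl; ring. Qed.

Lemma theta_spow a n : theta (a ^ S n) = (cst (INR (S n)) * theta a * a ^ n)%ser.
Proof.
  induction n as [|n IH].
  - rewrite spow_1. simpl spow. simpl INR. ring.
  - change (a ^ S (S n))%ser with (a * a ^ S n)%ser. rewrite theta_mul, IH, (S_INR (S n)), cst_add.
    simpl spow. ring.
Qed.

Definition scale (r : R) (a : ser) : ser := fun n => a n * r ^ n.

Lemma scale_add r a b : scale r (a + b) = (scale r a + scale r b)%ser.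
Proof. extensionality n. unfold scale. rewrite !saddE. ring. Qed.

Lemma scale_sub r a b : scale r (a - b) = (scale r a - scale r b)%ser.
Proof. extensionality n. unfold scale. rewrite !ssubE. ring. Qed.

Lemma scale_cst r c : scale r (cst c) = cst c.
Proof. extensionality n. unfold scale. destruct n; simpl; ring. Qed.

Lemma scale_mul r a b : scale r (a * b) = (scale r a * scale r b)%ser.
Proof.
  extensionality n. unfold scale. rewrite !smulE, Rmult_comm, scal_sum.
  apply sum_eq; intros k Hk.
  replace (r ^ n) with (r ^ (n - k) * r ^ k) by (rewrite <- pow_add; f_equal; lia). ring.
Qed.

Lemma scale_scale r r' a : scale r (scale r' a) = scale (r * r') a.
Proof. extensionality n. unfold scale. rewrite Rpow_mult_distr. ring. Qed.

Lemma scale_1 a : scale 1 a = a.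
Proof. extensionality n. unfold scale. rewrite pow1. ring. Qed.

Lemma smul_ext_le (a a' b b' : ser) n :
  (forall k, (k <= n)%nat -> a k = a' k) -> (forall k, (k <= n)%nat -> b k = b' k) ->
  (a * b)%ser n = (a' * b')%ser n.
Proof.
  intros Ha Hb. rewrite !smulE. apply sum_eq; intros k Hk. rewrite Ha, Hb by lia. reflexivity.
Qed.

Lemma smul_cancel (a x y : ser) : a O <> 0 -> (a * x = a * y)%ser -> x = y.
Proof.
  intros Ha H. extensionality n. induction n as [n IH] using lt_wf_ind.
  assert (E : (a * x)%ser n = (a * y)%ser n) by now rewrite H.
  rewrite !smulE in E. destruct n as [|n].
  - simpl in E. now apply Rmult_eq_reg_l in E.
  - rewrite !(decomp_sum _ (S n)) in E by lia. cbn [pred] in E. rewrite !Nat.sub_0_r in E.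
    rewrite (sum_eq _ (fun i => a (S i) * y (S n - S i)%nat)) in E.
    + apply Rplus_eq_reg_r in E. now apply Rmult_eq_reg_l in E.
    + intros i Hi. rewrite (IH (S n - S i)%nat) by lia. reflexivity.
Qed.

Lemma omu_cancel (x y : ser) : (omu * x = omu * y)%ser -> x = y.
Proof. apply smul_cancel. unfold omu. rewrite ssubE. unfold var. simpl. lra. Qed.

Lemma omu_spow_0 n : (omu ^ n)%ser O = 1.
Proof. rewrite spow_0th. unfold omu. rewrite ssubE. unfold var. simpl. rewrite Rminus_0_r. apply pow1. Qed.

(** * Absolutely summable coefficients *)

(** The norm of the Wiener algebra, phrased as a bound on all partial sums: no convergence has to be
    known beforehand, and bounds on truncations pass to the limit coefficient by coefficient. *)
Definition l1 (a : ser) (N : R) := forall n, sum_f_R0 (fun k => Rabs (a k)) n <= N.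

Definition sabs (a : ser) : ser := fun n => Rabs (a n).

Lemma sabs_mul_le (a b : ser) n : Rabs ((a * b)%ser n) <= (sabs a * sabs b)%ser n.
Proof.
  rewrite !smulE. eapply Rle_trans; [apply Rsum_abs|].
  apply Req_le. apply sum_eq; intros. apply Rabs_mult.
Qed.

Lemma l1_pos a N : l1 a N -> 0 <= N.
Proof. intros H. specialize (H O). simpl in H. pose proof (Rabs_pos (a O)). lra. Qed.

Lemma l1_le a N M : l1 a N -> N <= M -> l1 a M.
Proof. intros H HN n. now apply Rle_trans with N. Qed.

Lemma l1_dom (a b : ser) N : (forall n, Rabs (a n) <= Rabs (b n)) -> l1 b N -> l1 a N.
Proof. intros H Hb n. eapply Rle_trans; [|apply (Hb n)]. apply sum_Rle; intros; apply H. Qed.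

Lemma l1_add a b N M : l1 a N -> l1 b M -> l1 (a + b) (N + M).
Proof.
  intros Ha Hb n. apply Rle_trans with (sum_f_R0 (fun k => Rabs (a k) + Rabs (b k)) n).
  - apply sum_Rle; intros. rewrite saddE. apply Rabs_triang.
  - rewrite sum_plus. apply Rplus_le_compat; auto.
Qed.

Lemma l1_opp a N : l1 a N -> l1 (- a) N.
Proof. intros H. eapply l1_dom; [|apply H]. intros n. rewrite soppE, Rabs_Ropp. lra. Qed.

Lemma l1_sub a b N M : l1 a N -> l1 b M -> l1 (a - b) (N + M).
Proof.
  intros Ha Hb. replace (a - b)%ser with (a + - b)%ser by ring.
  apply l1_add; auto. now apply l1_opp.
Qed.

Lemma sum_pos_mono (f : nat -> R) n m :
  (forall k, 0 <= f k) -> (n <= m)%nat -> sum_f_R0 f n <= sum_f_R0 f m.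
Proof.
  intros Hf H. induction H as [|m H IH]; [lra|]. simpl. specialize (Hf (S m)). lra.
Qed.

Lemma sum_mul_l c f n : sum_f_R0 (fun k => c * f k) n = c * sum_f_R0 f n.
Proof. rewrite scal_sum. apply sum_eq; intros; ring. Qed.

Lemma sum_mul_r c f n : sum_f_R0 (fun k => f k * c) n = sum_f_R0 f n * c.
Proof. rewrite Rmult_comm, scal_sum. reflexivity. Qed.

Lemma smul_sum_le (a b : ser) N M n :
  (forall k, 0 <= a k) -> (forall k, 0 <= b k) ->
  sum_f_R0 a n <= N -> sum_f_R0 b n <= M ->
  sum_f_R0 (a * b)%ser n <= N * M.
Proof.
  intros Ha Hb HN HM.
  assert (E : sum_f_R0 (a * b)%ser n =
     sum_f_R0 (fun i => sum_f_R0 (fun j => a i * b j) (n - i)%nat) n).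
  { exact (sum_triangle (fun i j => a i * b j) n). }
  rewrite E. apply Rle_trans with (sum_f_R0 (fun i => a i * M) n).
  - apply sum_Rle; intros i Hi. rewrite sum_mul_l.
    apply Rmult_le_compat_l; auto. eapply Rle_trans; [|apply HM].
    apply sum_pos_mono; [auto|lia].
  - rewrite sum_mul_r. apply Rmult_le_compat_r; auto.
    eapply Rle_trans; [|apply HM]. apply cond_pos_sum; auto.
Qed.

Lemma l1_mul a b N M : l1 a N -> l1 b M -> l1 (a * b) (N * M).
Proof.
  intros Ha Hb n. apply Rle_trans with (sum_f_R0 (sabs a * sabs b)%ser n).
  - apply sum_Rle; intros; apply sabs_mul_le.
  - apply smul_sum_le; try (intros; apply Rabs_pos); [apply Ha|apply Hb].
Qed.

Lemma l1_cst c : l1 (cst c) (Rabs c).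
Proof.
  intros n. induction n as [|n IH]; simpl; [lra|]. rewrite Rabs_R0. lra.
Qed.

Lemma l1_var : l1 var 1.
Proof.
  intros n. destruct n as [|n]; simpl; [rewrite Rabs_R0; lra|].
  induction n as [|n IH]; simpl in *; [rewrite Rabs_R0, Rabs_R1; lra|].
  rewrite Rabs_R0 in *. lra.
Qed.

Lemma l1_omu : l1 omu 2.
Proof.
  replace 2 with (Rabs 1 + 1) by (rewrite Rabs_R1; ring). apply l1_sub; [apply l1_cst|apply l1_var].
Qed.

Lemma l1_spow a N n : l1 a N -> l1 (a ^ n) (N ^ n).
Proof.
  intros H. induction n as [|n IH]; simpl.
  - rewrite <- Rabs_R1 at 2. apply l1_cst.
  - now apply l1_mul.
Qed.

Lemma l1_ex_series_abs a N : l1 a N -> ex_series (fun n => Rabs (a n)).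
Proof.
  intros H. apply ex_series_Reals_1.
  destruct (growing_cv (sum_f_R0 (fun n => Rabs (a n)))) as [l Hl].
  - intros n. simpl. pose proof (Rabs_pos (a (S n))). lra.
  - exists N. intros x [n ->]. apply H.
  - exists l. intros eps He. destruct (Hl eps He) as [M HM]. exists M. exact HM.
Qed.

Lemma l1_ex_series a N : l1 a N -> ex_series a.
Proof. intros H. apply ex_series_Rabs. now apply l1_ex_series_abs with N. Qed.

Lemma sum_n_sum_f (a : nat -> R) n : sum_n a n = sum_f_R0 a n.
Proof. apply sum_n_Reals. Qed.

Lemma series_partial_le (a : nat -> R) l n :
  (forall k, 0 <= a k) -> is_series a l -> sum_f_R0 a n <= l.
Proof.
  intros Ha H. rewrite <- sum_n_sum_f.
  apply (is_lim_seq_incr_compare (sum_n a)); [exact H|].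
  intros k. rewrite sum_Sn. unfold plus; simpl. specialize (Ha (S k)). lra.
Qed.

(** Value at 1. [Series] is total and returns a meaningless number on divergent series, hence the
    summability conditions in the rules below. *)
Definition ev (a : ser) : R := Series a.

Lemma ev_is_series a N : l1 a N -> is_series a (ev a).
Proof. intros H. apply Series_correct. now apply l1_ex_series with N. Qed.

Lemma ev_add a b N M : l1 a N -> l1 b M -> ev (a + b) = ev a + ev b.
Proof. intros Ha Hb. apply Series_plus; eapply l1_ex_series; eauto. Qed.

Lemma ev_sub a b N M : l1 a N -> l1 b M -> ev (a - b) = ev a - ev b.
Proof. intros Ha Hb. apply Series_minus; eapply l1_ex_series; eauto. Qed.

Lemma ev_mul a b N M : l1 a N -> l1 b M -> ev (a * b) = ev a * ev b.
Proof.
  intros Ha Hb. apply is_series_unique.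
  apply (is_series_mult a b).
  - eapply ev_is_series; eauto.
  - eapply ev_is_series; eauto.
  - eapply l1_ex_series_abs; eauto.
  - eapply l1_ex_series_abs; eauto.
Qed.

Lemma ev_finite (a : ser) m : (forall n, (m < n)%nat -> a n = 0) -> ev a = sum_f_R0 a m.
Proof.
  intros H. apply is_series_unique.
  change (is_lim_seq (sum_n a) (sum_f_R0 a m)).
  apply is_lim_seq_ext_loc with (fun _ : nat => sum_f_R0 a m); [|apply is_lim_seq_const].
  exists m. intros n Hn. rewrite sum_n_sum_f. induction Hn as [|n Hn IH]; [reflexivity|].
  simpl. rewrite (H (S n)) by lia. lra.
Qed.

Lemma ev_cst c : ev (cst c) = c.
Proof. rewrite (ev_finite _ 0); [reflexivity|]. intros [|n] Hn; [lia|reflexivity]. Qed.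

Lemma ev_var : ev var = 1.
Proof.
  rewrite (ev_finite _ 1); [simpl; ring|]. intros [|[|n]] Hn; [lia|lia|reflexivity].
Qed.

Lemma ev_omu : ev omu = 0.
Proof.
  unfold omu. rewrite (ev_sub _ _ _ _ (l1_cst 1) l1_var), ev_cst, ev_var. ring.
Qed.

Lemma ev_bound a N : l1 a N -> Rabs (ev a) <= N.
Proof.
  intros H. eapply Rle_trans; [apply Series_Rabs; now apply l1_ex_series_abs with N|].
  assert (H' : is_lim_seq (sum_n (fun n => Rabs (a n))) (Series (fun n => Rabs (a n)))).
  { apply Series_correct. now apply l1_ex_series_abs with N. }
  apply (is_lim_seq_le _ _ _ N) with (2 := H') (3 := is_lim_seq_const N).
  intros n. rewrite sum_n_sum_f. apply H.
Qed.

Lemma ev_spow a N n : l1 a N -> ev (a ^ n) = ev a ^ n.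
Proof.
  intros H. induction n as [|n IH]; simpl; [apply ev_cst|].
  rewrite (ev_mul _ _ _ _ H (l1_spow _ _ n H)), IH. reflexivity.
Qed.

(** * Differencing estimates for convolution powers *)

Definition opu : ser := (cst 1 + var)%ser.

Lemma opu_mul_0 (b : ser) : (opu * b)%ser O = b O.
Proof. rewrite smul_0. unfold opu. rewrite saddE. unfold var. simpl. ring. Qed.

Lemma opu_mul_S (b : ser) n : (opu * b)%ser (S n) = b (S n) + b n.
Proof.
  replace (opu * b)%ser with (b + var * b)%ser by (unfold opu; ring).
  now rewrite saddE, var_mul_S.
Qed.

Lemma opu_spow_pos n i : 0 <= (opu ^ n)%ser i.
Proof.
  revert i; induction n as [|n IH]; intros i; simpl spow.
  - destruct i; simpl; lra.
  - destruct i as [|i]; [rewrite opu_mul_0; apply IH|].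
    rewrite opu_mul_S. pose proof (IH i); pose proof (IH (S i)); lra.
Qed.

Lemma sum_opu_mul (f : nat -> R) (b : ser) m :
  sum_f_R0 (fun i => f i * (opu * b)%ser i) m =
  sum_f_R0 (fun i => f i * b i) m + match m with O => 0 | S m' => sum_f_R0 (fun i => f (S i) * b i) m' end.
Proof.
  induction m as [|m IH].
  - simpl. rewrite opu_mul_0. ring.
  - cbn [sum_f_R0]. rewrite IH, opu_mul_S. destruct m; simpl; ring.
Qed.

Lemma opu_spow_mass n m : sum_f_R0 (opu ^ n)%ser m <= 2 ^ n.
Proof.
  revert m; induction n as [|n IH]; intros m.
  - simpl. induction m as [|m IHm]; simpl; lra.
  - rewrite (sum_eq _ (fun i => 1 * (opu * opu ^ n)%ser i)) by (intros; simpl; ring).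
    rewrite sum_opu_mul.
    rewrite (sum_eq (fun i => 1 * (opu ^ n)%ser i) (opu ^ n)%ser) by (intros; ring).
    pose proof (IH m). simpl. destruct m as [|m].
    + pose proof (pow_le 2 n). lra.
    + rewrite (sum_eq (fun i => 1 * (opu ^ n)%ser i) (opu ^ n)%ser) by (intros; ring).
      pose proof (IH m). lra.
Qed.

(** Under the binomial law, n - 2 i is a sum of n independent signs, of variance n. The induction is
    Pascal's rule together with (x + 1)^2 + (x - 1)^2 = 2 x^2 + 2. *)
Lemma opu_spow_variance n m :
  sum_f_R0 (fun i => (INR n - 2 * INR i) ^ 2 * (opu ^ n)%ser i) m <= INR n * 2 ^ n.
Proof.
  revert m; induction n as [|n IH]; intros m.
  - rewrite (sum_eq _ (fun _ => 0)); [rewrite sum_cte; simpl; lra|].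
    intros [|i] _; simpl; ring.
  - change (opu ^ S n)%ser with (opu * opu ^ n)%ser. rewrite sum_opu_mul.
    apply Rle_trans with
      (sum_f_R0 (fun i => (INR (S n) - 2 * INR i) ^ 2 * (opu ^ n)%ser i) m +
       sum_f_R0 (fun i => (INR (S n) - 2 * INR (S i)) ^ 2 * (opu ^ n)%ser i) m).
    + apply Rplus_le_compat_l.
      assert (P : forall k, 0 <= (INR (S n) - 2 * INR (S k)) ^ 2 * (opu ^ n)%ser k).
      { intros k. apply Rmult_le_pos; [apply pow2_ge_0|apply opu_spow_pos]. }
      destruct m as [|m]; [apply P|]. apply sum_pos_mono; auto.
    + rewrite <- sum_plus.
      rewrite (sum_eq _ (fun i => 2 * ((INR n - 2 * INR i) ^ 2 * (opu ^ n)%ser i) + 2 * (opu ^ n)%ser i))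
        by (intros; rewrite !S_INR; ring).
      rewrite sum_plus, !sum_mul_l, S_INR.
      pose proof (IH m). pose proof (opu_spow_mass n m). change (2 ^ S n) with (2 * 2 ^ n). lra.
Qed.

(* The coefficients of n (1-u) (1+u)^(n-1) are (n - 2i) C(n,i); their absolute sum is
   bounded through the variance of the binomial law. *)
Lemma l1_omu_opu n : l1 (omu * opu ^ n) (2 * 2 ^ n / sqrt (INR n + 1)).
Proof.
  intros m. set (N := INR (S n)).
  assert (HN : 0 < N) by (apply lt_0_INR; lia).
  assert (HsN : 0 < sqrt N) by now apply sqrt_lt_R0.
  assert (E : forall i, N * (omu * opu ^ n)%ser i = (N - 2 * INR i) * (opu ^ S n)%ser i).
  { intros i. rewrite <- cst_mul. fold N.
    replace (cst N * (omu * opu ^ n))%ser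
      with (cst N * opu ^ S n - cst 2 * theta (opu ^ S n))%ser.
    - rewrite ssubE, !cst_mul. unfold theta. ring.
    - rewrite theta_spow. fold N.
      assert (Ho : theta opu = var) by (unfold opu; rewrite theta_add, theta_cst, theta_var; ring).
      rewrite Ho. change (opu ^ S n)%ser with (opu * opu ^ n)%ser. generalize (opu ^ n)%ser.
      intros x. unfold omu, opu. replace 2 with (1 + 1) by ring. rewrite cst_add. ring. }
  apply Rmult_le_reg_l with N; [assumption|]. rewrite <- sum_mul_l.
  replace (N * (2 * 2 ^ n / sqrt (INR n + 1))) with (sqrt N * 2 ^ S n).
  2:{ rewrite <- S_INR. fold N. simpl.
      replace (N * (2 * 2 ^ n / sqrt N)) with (sqrt N * sqrt N * (2 * 2 ^ n / sqrt N))
        by (now rewrite sqrt_sqrt by lra).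
      field. lra. }
  (* The mean inequality x <= x^2 / (2 sqrt N) + sqrt N / 2 replaces Cauchy-Schwarz; with these
     weights variance and mass each contribute half of the bound. *)
  apply Rle_trans with (sum_f_R0 (fun i => / (2 * sqrt N) * ((INR (S n) - 2 * INR i) ^ 2 * (opu ^ S n)%ser i)
      + sqrt N / 2 * (opu ^ S n)%ser i) m).
  - apply sum_Rle; intros i _. pose proof (opu_spow_pos (S n) i) as Hp.
    replace (N * Rabs ((omu * opu ^ n)%ser i)) with (Rabs (N * (omu * opu ^ n)%ser i))
      by (rewrite Rabs_mult, (Rabs_pos_eq N); lra).
    rewrite E, Rabs_mult, (Rabs_pos_eq _ Hp). fold N. rewrite <- Rmult_assoc, <- Rmult_plus_distr_r. apply Rmult_le_compat_r; [assumption|].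
    set (x := Rabs (N - 2 * INR i)). rewrite <- (pow2_abs (N - 2 * INR i)). fold x.
    assert (0 <= (x - sqrt N) ^ 2 / (2 * sqrt N)).
    { apply Rmult_le_pos; [apply pow2_ge_0|]. left; apply Rinv_0_lt_compat; lra. }
    replace (/ (2 * sqrt N) * x ^ 2 + sqrt N / 2) with (x + (x - sqrt N) ^ 2 / (2 * sqrt N));
      [lra|field; lra].
  - rewrite sum_plus, !sum_mul_l.
    pose proof (opu_spow_variance (S n) m) as HV. pose proof (opu_spow_mass (S n) m) as HM.
    fold N in HV.
    apply Rle_trans with (/ (2 * sqrt N) * (N * 2 ^ S n) + sqrt N / 2 * 2 ^ S n).
    + apply Rplus_le_compat; apply Rmult_le_compat_l; auto.
      * left; apply Rinv_0_lt_compat; lra.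
      * lra.
    + right. replace (N * 2 ^ S n) with (sqrt N * sqrt N * 2 ^ S n) by (now rewrite sqrt_sqrt by lra).
      field. lra.
Qed.

(** Since x -> 2 / sqrt x is convex, the mixture cannot be bounded by the value at x + lam; giving
    up half of the shift leaves enough room. The condition x >= 1 enters as x + 1 <= 2 x. *)
Lemma inv_sqrt_mixture lam x :
  0 <= lam <= 1 -> 1 <= x ->
  lam * (2 / sqrt (x + 1)) + (1 - lam) * (2 / sqrt x) <= 2 / sqrt (x + lam / 2).
Proof.
  intros Hl Hx.
  assert (Ha2 := sqrt_sqrt x ltac:(lra)).
  assert (Hb2 := sqrt_sqrt (x + lam / 2) ltac:(lra)).
  assert (Hc2 := sqrt_sqrt (x + 1) ltac:(lra)).
  assert (Ha := sqrt_lt_R0 x ltac:(lra)).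
  assert (Hb := sqrt_lt_R0 (x + lam / 2) ltac:(lra)).
  assert (Hc := sqrt_lt_R0 (x + 1) ltac:(lra)).
  assert (Hab : sqrt x <= sqrt (x + lam / 2)) by (apply sqrt_le_1_alt; lra).
  assert (Hac : sqrt x <= sqrt (x + 1)) by (apply sqrt_le_1_alt; lra).
  set (a := sqrt x) in *. set (b := sqrt (x + lam / 2)) in *. set (c := sqrt (x + 1)) in *.
  assert (K1 : c * (a + c) <= 2 * (b * (a + b))) by nra.
  assert (K2 : (b - a) * c <= lam * (c - a) * b).
  { apply Rmult_le_reg_l with ((a + b) * (a + c)); [nra|].
    replace ((a + b) * (a + c) * ((b - a) * c)) with ((b * b - a * a) * (c * (a + c))) by ring.
    replace ((a + b) * (a + c) * (lam * (c - a) * b)) with (lam * (c * c - a * a) * (b * (a + b))) by ring.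
    rewrite Ha2, Hb2, Hc2. nra. }
  apply Rmult_le_reg_l with (a * b * c); [repeat apply Rmult_lt_0_compat; lra|].
  replace (a * b * c * (lam * (2 / c) + (1 - lam) * (2 / a)))
    with (2 * (lam * a * b + (1 - lam) * b * c)) by (field; lra).
  replace (a * b * c * (2 / b)) with (2 * (a * c)) by (field; lra).
  nra.
Qed.

(** Up to a factor 2, this norm is the total variation distance between the law of a sum of k steps
    and its shift by one. The constant stands under the root so that squaring gives C / (k + 1). *)
Definition smoothing (q : ser) (C : R) :=
  forall k, l1 (omu * q ^ k) (sqrt (C / (INR k + 1))).

Lemma l1_shift A : l1 (var ^ A) 1.
Proof. rewrite <- (pow1 A). apply l1_spow, l1_var. Qed.

(* Writing q = lam b + nu with b a shifted fair coin, the norms N(k,j) of (1-u) b^j q^k satisfy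
   N(k+1,j) <= lam N(k,j+1) + (1-lam) N(k,j), and 2 / sqrt (1 + j + lam k / 2) is a supersolution. *)
Lemma coin_mixture_smoothing (nu : ser) (lam : R) (A : nat) :
  0 < lam <= 1 -> l1 nu (1 - lam) ->
  smoothing (cst lam * (cst (/ 2) * var ^ A * opu) + nu) (8 / lam).
Proof.
  intros Hl Hnu. set (b := (cst (/ 2) * var ^ A * opu)%ser). set (q := (cst lam * b + nu)%ser).
  assert (H : forall k j, l1 (omu * b ^ j * q ^ k) (2 / sqrt (INR j + 1 + lam / 2 * INR k))).
  { induction k as [|k IH]; intros j.
    - replace (omu * b ^ j * q ^ 0)%ser with (cst ((/ 2) ^ j) * var ^ (A * j) * (omu * opu ^ j))%ser.
      + eapply l1_le; [apply l1_mul; [apply l1_mul; [apply l1_cst|apply l1_shift]|apply l1_omu_opu]|].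
        rewrite Rabs_pos_eq by (apply pow_le; lra). simpl INR. rewrite Rmult_0_r, Rplus_0_r.
        right. rewrite pow_inv. field. split; [|apply pow_nonzero; lra].
        apply Rgt_not_eq, sqrt_lt_R0. pose proof (pos_INR j); lra.
      + unfold b. rewrite !smul_spow, spow_mul. simpl spow.
        replace (cst ((/ 2) ^ j)) with (cst (/ 2) ^ j)%ser; [ring|].
        clear. induction j as [|j IH]; simpl; [reflexivity|]. now rewrite IH, cst_mul_cst.
    - replace (omu * b ^ j * q ^ S k)%ser
        with (cst lam * (omu * b ^ S j * q ^ k) + nu * (omu * b ^ j * q ^ k))%ser
        by (simpl spow; unfold q at 3; ring).
      eapply l1_le; [apply l1_add; [apply l1_mul; [apply l1_cst|apply IH]|apply l1_mul; [apply Hnu|apply IH]]|].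
      rewrite Rabs_pos_eq by lra. rewrite !S_INR.
      replace (INR j + 1 + 1 + lam / 2 * INR k) with (INR j + 1 + lam / 2 * INR k + 1) by ring.
      replace (INR j + 1 + lam / 2 * (INR k + 1)) with (INR j + 1 + lam / 2 * INR k + lam / 2) by ring.
      apply inv_sqrt_mixture; [lra|]. pose proof (pos_INR j). pose proof (pos_INR k). nra. }
  intros k. replace (omu * q ^ k)%ser with (omu * b ^ 0 * q ^ k)%ser by (simpl; ring).
  eapply l1_le; [apply H|]. pose proof (pos_INR k). simpl INR. rewrite Rplus_0_l.
  assert (0 < 1 + lam / 2 * INR k) by nra.
  replace (2 / sqrt (1 + lam / 2 * INR k)) with (sqrt (4 / (1 + lam / 2 * INR k))).
  - apply sqrt_le_1_alt. apply Rle_div_l; [lra|].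
    apply Rmult_le_reg_l with (lam * (INR k + 1)); [nra|].
    replace (lam * (INR k + 1) * (8 / lam / (INR k + 1) * (1 + lam / 2 * INR k)))
      with (8 * (1 + lam / 2 * INR k)) by (field; lra).
    nra.
  - rewrite sqrt_div by lra. f_equal. replace 4 with (2 * 2) by ring. apply sqrt_square. lra.
Qed.

Lemma coin_coefs A n :
  (cst (/ 2) * var ^ A * opu)%ser n = if ((n =? A) || (n =? S A))%nat%bool then / 2 else 0.
Proof.
  replace (cst (/ 2) * var ^ A * opu)%ser with (cst (/2) * (var ^ A * opu))%ser by ring.
  rewrite cst_mul, var_spow_mul.
  destruct (Nat.leb_spec A n).
  - unfold opu. rewrite saddE.
    destruct (Nat.eqb_spec n A); [subst; rewrite Nat.sub_diag; unfold var; simpl; lra|].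
    destruct (Nat.eqb_spec n (S A)); [subst; replace (S A - A)%nat with 1%nat by lia; unfold var; simpl; lra|].
    destruct (n - A)%nat as [|[|k]] eqn:E; [lia|lia|]. unfold var; simpl; lra.
  - destruct (Nat.eqb_spec n A); [lia|]. destruct (Nat.eqb_spec n (S A)); [lia|]. simpl; lra.
Qed.

(** Two neighbouring atoms contain a fair coin on A and A + 1. Its weight [lam] is twice the smaller
    atom, because each side of the coin has mass 1/2; [nu] is what remains. *)
Lemma adjacent_smoothing (q : ser) (A : nat) :
  (forall n, 0 <= q n) -> l1 q 1 -> 0 < q A -> 0 < q (S A) ->
  exists C, smoothing q C.
Proof.
  intros Hq H1 HA HB. set (lam := 2 * Rmin (q A) (q (S A))).
  assert (Hm : 0 < Rmin (q A) (q (S A))) by now apply Rmin_glb_lt.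
  pose proof (Rmin_l (q A) (q (S A))). pose proof (Rmin_r (q A) (q (S A))).
  set (b := (cst (/ 2) * var ^ A * opu)%ser).
  set (nu := (q - cst lam * b)%ser).
  assert (Hnu : forall n, 0 <= nu n).
  { intros n. unfold nu. rewrite ssubE, cst_mul. unfold b. rewrite coin_coefs. specialize (Hq n).
    destruct (Nat.eqb_spec n A); [subst; simpl; unfold lam; lra|].
    destruct (Nat.eqb_spec n (S A)); [subst; simpl; unfold lam; lra|]. simpl. lra. }
  assert (Hbs : forall n, (S A <= n)%nat -> sum_f_R0 b n = 1).
  { intros n Hn. induction Hn as [|n Hn IH].
    - cbn [sum_f_R0]. unfold b at 2. rewrite coin_coefs, Nat.eqb_refl.
      replace (S A =? A)%nat with false by (symmetry; apply Nat.eqb_neq; lia). simpl.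
      rewrite (sum_single b A A); [|lia|].
      2:{ intros k Hk Hne. unfold b. rewrite coin_coefs.
          destruct (Nat.eqb_spec k A); [lia|]. destruct (Nat.eqb_spec k (S A)); [lia|reflexivity]. }
      unfold b. rewrite coin_coefs, Nat.eqb_refl. simpl. lra.
    - cbn [sum_f_R0]. rewrite IH. unfold b. rewrite coin_coefs.
      destruct (Nat.eqb_spec (S n) A); [lia|]. destruct (Nat.eqb_spec (S n) (S A)); [lia|]. simpl; lra. }
  assert (Hl1 : l1 nu (1 - lam)).
  (* The coin has its full mass only when both atoms are in the range, hence the extension up to
     [S A]. *)
  { intros n. apply Rle_trans with (sum_f_R0 nu (Nat.max n (S A))).
    - rewrite (sum_eq _ nu) by (intros; now apply Rabs_pos_eq). apply sum_pos_mono; [auto|lia].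
    - unfold nu. rewrite (sum_eq _ (fun k => q k - lam * b k)) by (intros; now rewrite ssubE, cst_mul).
      rewrite minus_sum, sum_mul_l, Hbs by lia.
      specialize (H1 (Nat.max n (S A))). rewrite (sum_eq _ q) in H1 by (intros; now apply Rabs_pos_eq). lra. }
  assert (Hlam : 0 < lam <= 1).
  { split; [unfold lam; lra|]. pose proof (l1_pos _ _ Hl1). lra. }
  exists (8 / lam).
  replace q with (cst lam * (cst (/ 2) * var ^ A * opu) + nu)%ser by (unfold nu, b; ring).
  now apply coin_mixture_smoothing.
Qed.

Lemma l1_spow_1 q n : l1 q 1 -> l1 (q ^ n) 1.
Proof. intros H. rewrite <- (pow1 n). now apply l1_spow. Qed.

Lemma div_le_const r n : (r <> 0)%nat -> / (INR (n / r) + 1) <= INR r / (INR n + 1).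
Proof.
  intros Hr. assert (0 < INR r) by (apply lt_0_INR; lia).
  pose proof (pos_INR n). pose proof (pos_INR (n / r)).
  apply Rle_div_r; [lra|]. rewrite Rmult_comm. apply Rle_div_l; [lra|].
  rewrite <- !S_INR, <- mult_INR. apply le_INR.
  pose proof (Nat.div_mod n r Hr). pose proof (Nat.mod_upper_bound n r Hr). nia.
Qed.

(** An aperiodic law may have no two adjacent atoms although one of its powers does. The power
    passes its smoothing on, since the n mod r leftover factors have norm at most 1. *)
Lemma smoothing_root q r C : (r <> 0)%nat -> 0 <= C -> l1 q 1 -> smoothing (q ^ r) C ->
  smoothing q (C * INR r).
Proof.
  intros Hr HC H1 H n.
  replace (omu * q ^ n)%ser with (omu * (q ^ r) ^ (n / r) * q ^ (n mod r))%ser.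
  - eapply l1_le; [apply l1_mul; [apply H|apply l1_spow_1, H1]|].
    rewrite Rmult_1_r. apply sqrt_le_1_alt. unfold Rdiv. rewrite Rmult_assoc.
    apply Rmult_le_compat_l; [assumption|]. now apply div_le_const.
  - rewrite (Nat.div_mod n r Hr) at 3. rewrite spow_add, spow_mul. ring.
Qed.

(** The 2 K factors 1 - u are distributed over 2 K blocks of n / (2 K) steps, one per block, and
    each block gains a square root. *)
Lemma smoothing_spow q C K : 0 <= C -> l1 q 1 -> smoothing q C ->
  exists C', forall n, l1 (omu ^ (2 * K) * q ^ n) (C' * (/ (INR n + 1)) ^ K).
Proof.
  intros HC H1 H. destruct (Nat.eq_dec K 0) as [->|HK].
  - exists 1. intros n. replace (omu ^ (2 * 0) * q ^ n)%ser with (q ^ n)%ser by (simpl; ring).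
    eapply l1_le; [apply l1_spow_1, H1|]. simpl; lra.
  - set (r := (2 * K)%nat). exists ((C * INR r) ^ K). intros n.
    replace (omu ^ r * q ^ n)%ser with ((omu * q ^ (n / r)) ^ r * q ^ (n mod r))%ser.
    + eapply l1_le; [apply l1_mul; [apply l1_spow, H|apply l1_spow_1, H1]|].
      rewrite Rmult_1_r. unfold r at 2. rewrite pow_mult. 
      pose proof (pos_INR (n / r)).
      assert (0 <= C / (INR (n / r) + 1)) by (apply Rdiv_le_0_compat; lra).
      rewrite pow2_sqrt by assumption.
      rewrite <- Rpow_mult_distr. apply pow_incr. split; [assumption|].
      unfold Rdiv. rewrite Rmult_assoc. apply Rmult_le_compat_l; [assumption|]. apply div_le_const. unfold r; lia.
    + assert (E : (q ^ n)%ser = (q ^ (n / r * r + n mod r))%ser).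
      { f_equal. pose proof (Nat.div_mod n r ltac:(unfold r; lia)). lia. }
      rewrite E, spow_add, spow_mul, smul_spow. ring.
Qed.

(** * Coefficients of polynomial decay, and division by 1 - z *)

Definition wt (n : nat) : R := / (INR n + 1).

Lemma wt_pos n : 0 < wt n.
Proof. apply Rinv_0_lt_compat. pose proof (pos_INR n); lra. Qed.

Lemma wt_le_1 n : wt n <= 1.
Proof.
  unfold wt. rewrite <- Rinv_1. apply Rinv_le_contravar; [lra|]. pose proof (pos_INR n); lra.
Qed.

Lemma wt_mul n : wt n * (INR n + 1) = 1.
Proof. unfold wt. field. pose proof (pos_INR n); lra. Qed.

Lemma wt_mono n m : (n <= m)%nat -> wt m <= wt n.
Proof.
  intros H. apply Rinv_le_contravar; [pose proof (pos_INR n); lra|]. apply le_INR in H; lra.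
Qed.

Lemma wt_half n m : (n <= 2 * m + 1)%nat -> wt m <= 2 * wt n.
Proof.
  intros H. unfold wt. pose proof (pos_INR n). pose proof (pos_INR m).
  apply le_INR in H. rewrite plus_INR, mult_INR in H. simpl in H.
  apply Rmult_le_reg_l with ((INR n + 1) * (INR m + 1)); [nra|].
  replace ((INR n + 1) * (INR m + 1) * / (INR m + 1)) with (INR n + 1) by (field; lra).
  replace ((INR n + 1) * (INR m + 1) * (2 * / (INR n + 1))) with (2 * (INR m + 1)) by (field; lra).
  lra.
Qed.

Lemma wt_pow_pos n K : 0 < wt n ^ K.
Proof. apply pow_lt, wt_pos. Qed.

Lemma wt_pow_half n m K : (n <= 2 * m + 1)%nat -> wt m ^ K <= 2 ^ K * wt n ^ K.
Proof.
  intros H. rewrite <- Rpow_mult_distr. apply pow_incr. split; [left; apply wt_pos|now apply wt_half].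
Qed.

Lemma wt_pow_mono n K K' : (K <= K')%nat -> wt n ^ K' <= wt n ^ K.
Proof.
  intros H. replace K' with (K + (K' - K))%nat by lia. rewrite pow_add.
  rewrite <- (Rmult_1_r (wt n ^ K)) at 2. apply Rmult_le_compat_l; [left; apply wt_pow_pos|].
  rewrite <- (pow1 (K' - K)). apply pow_incr. split; [left; apply wt_pos|apply wt_le_1].
Qed.

Lemma wt_sq_tail n m :
  sum_f_R0 (fun k => wt (S n + k) ^ 2) m <= wt n - wt (S n + m).
Proof.
  assert (H : forall k, wt (S k) ^ 2 <= wt k - wt (S k)).
  { intros k. unfold wt. rewrite S_INR. pose proof (pos_INR k).
    replace (/ (INR k + 1) - / (INR k + 1 + 1)) with (/ ((INR k + 1) * (INR k + 1 + 1))) by (field; lra).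
    rewrite pow_inv. apply Rinv_le_contravar; [nra|]. simpl. nra. }
  induction m as [|m IH].
  - cbn [sum_f_R0]. rewrite Nat.add_0_r. apply H.
  - cbn [sum_f_R0]. replace (S n + S m)%nat with (S (S n + m)) by lia.
    specialize (H (S n + m)%nat). lra.
Qed.

Lemma wt_sq_sum m : sum_f_R0 (fun k => wt k ^ 2) m <= 2.
Proof.
  assert (H0 : wt 0 = 1) by (unfold wt; simpl; field).
  destruct m as [|m]; [simpl; rewrite H0; lra|].
  rewrite decomp_sum by lia. cbn [pred]. rewrite H0.
  pose proof (wt_sq_tail 0 m) as H. simpl Nat.add in H. rewrite H0 in H.
  pose proof (wt_pos (S m)). lra.
Qed.

(** [Vn] displays the constant because the exponential of a series needs bounds on all its powers at
    once; [V] hides it elsewhere. *)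
Definition Vn (K : nat) (a : ser) (c : R) := forall n, Rabs (a n) <= c * wt n ^ K.
Definition V (K : nat) (a : ser) := exists c, Vn K a c.

Lemma Vn_nonneg K a c : Vn K a c -> 0 <= c.
Proof.
  intros H. specialize (H O). unfold wt in H. simpl INR in H.
  replace (/ (0 + 1)) with 1 in H by field. rewrite pow1 in H. pose proof (Rabs_pos (a O)). lra.
Qed.

Lemma Vn_add K a b c c' : Vn K a c -> Vn K b c' -> Vn K (a + b) (c + c').
Proof.
  intros Ha Hb n. rewrite saddE. eapply Rle_trans; [apply Rabs_triang|].
  specialize (Ha n); specialize (Hb n). lra.
Qed.

Lemma V_add K a b : V K a -> V K b -> V K (a + b).
Proof. intros [c Ha] [c' Hb]. exists (c + c'). now apply Vn_add. Qed.

Lemma V_opp K a : V K a -> V K (- a).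
Proof. intros [c Ha]. exists c. intros n. rewrite soppE, Rabs_Ropp. apply Ha. Qed.

Lemma V_sub K a b : V K a -> V K b -> V K (a - b).
Proof.
  intros Ha Hb. replace (a - b)%ser with (a + - b)%ser by ring. apply V_add; auto. now apply V_opp.
Qed.

Lemma V_mono K K' a : (K <= K')%nat -> V K' a -> V K a.
Proof.
  intros H [c Ha]. exists c. intros n. eapply Rle_trans; [apply Ha|].
  apply Rmult_le_compat_l; [now apply Vn_nonneg with K' a|]. now apply wt_pow_mono.
Qed.

Lemma V_finite K (a : ser) m : (forall n, (m < n)%nat -> a n = 0) -> V K a.
Proof.
  intros H. exists (sum_f_R0 (fun k => Rabs (a k) * (INR k + 1) ^ K) m). intros n.
  assert (P : forall k, 0 <= Rabs (a k) * (INR k + 1) ^ K).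
  { intros k. apply Rmult_le_pos; [apply Rabs_pos|apply pow_le; pose proof (pos_INR k); lra]. }
  destruct (Nat.le_gt_cases n m) as [Hn|Hn].
  - apply Rle_trans with (Rabs (a n) * (INR n + 1) ^ K * wt n ^ K).
    + rewrite Rmult_assoc, <- Rpow_mult_distr, (Rmult_comm _ (wt n)), wt_mul, pow1. lra.
    + apply Rmult_le_compat_r; [left; apply wt_pow_pos|].
      eapply Rle_trans; [|apply (sum_pos_mono _ n m P Hn)].
      destruct n as [|n]; simpl; [lra|].
      pose proof (cond_pos_sum _ n P). lra.
  - rewrite (H n Hn), Rabs_R0. apply Rmult_le_pos; [|left; apply wt_pow_pos].
    apply cond_pos_sum; auto.
Qed.

Lemma V_cst K c : V K (cst c).
Proof. apply (V_finite K _ 0). intros [|n] Hn; [lia|reflexivity]. Qed.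

Lemma V_var K : V K var.
Proof. apply (V_finite K _ 1). intros [|[|n]] Hn; [lia|lia|reflexivity]. Qed.

Lemma V_omu K : V K omu.
Proof. apply V_sub; [apply V_cst|apply V_var]. Qed.

Lemma pow_add_le x y K : 0 <= x -> 0 <= y -> (x + y) ^ K <= 2 ^ K * (x ^ K + y ^ K).
Proof.
  intros Hx Hy. pose proof (pow_le x K Hx). pose proof (pow_le y K Hy). pose proof (pow_lt 2 K ltac:(lra)).
  destruct (Rle_lt_dec x y).
  - apply Rle_trans with ((2 * y) ^ K); [apply pow_incr; lra|]. rewrite Rpow_mult_distr. nra.
  - apply Rle_trans with ((2 * x) ^ K); [apply pow_incr; lra|]. rewrite Rpow_mult_distr. nra.
Qed.

(** The product of 1 / (k + 1) and 1 / (n - k + 1) is their sum divided by n + 2. So a factor of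
    order n^(-K) comes out, and the remaining sum over k converges because the exponent is at least
    2. *)
Lemma wt_conv K n : (2 <= K)%nat ->
  sum_f_R0 (fun k => wt k ^ K * wt (n - k) ^ K) n <= 4 * 2 ^ K * wt n ^ K.
Proof.
  intros HK.
  apply Rle_trans with (sum_f_R0 (fun k => 2 ^ K * wt n ^ K * (wt k ^ 2 + wt (n - k) ^ 2)) n).
  - apply sum_Rle; intros k Hk. rewrite <- Rpow_mult_distr.
    apply Rle_trans with ((wt n * (wt k + wt (n - k))) ^ K).
    + apply pow_incr. pose proof (wt_pos k). pose proof (wt_pos (n - k)). split; [nra|].
      unfold wt. rewrite minus_INR by assumption. pose proof (pos_INR k).
      assert (0 <= INR n - INR k) by (rewrite <- minus_INR by assumption; apply pos_INR).
      replace (/ (INR n + 1) * (/ (INR k + 1) + / (INR n - INR k + 1)))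
        with ((INR n + 2) / (INR n + 1) * (/ (INR k + 1) * / (INR n - INR k + 1))) by (field; lra).
      assert (0 < / (INR k + 1) * / (INR n - INR k + 1)).
      { apply Rmult_lt_0_compat; apply Rinv_0_lt_compat; lra. }
      rewrite <- (Rmult_1_l (/ (INR k + 1) * / (INR n - INR k + 1))) at 1.
      apply Rmult_le_compat_r; [lra|]. apply Rle_div_r; lra.
    + rewrite Rpow_mult_distr.
      replace (2 ^ K * wt n ^ K * (wt k ^ 2 + wt (n - k) ^ 2))
        with (wt n ^ K * (2 ^ K * (wt k ^ 2 + wt (n - k) ^ 2))) by ring.
      apply Rmult_le_compat_l; [left; apply wt_pow_pos|].
      eapply Rle_trans; [apply pow_add_le; left; apply wt_pos|].
      apply Rmult_le_compat_l; [apply pow_le; lra|].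
      apply Rplus_le_compat; now apply wt_pow_mono.
  - rewrite sum_mul_l, sum_plus.
    assert (E : sum_f_R0 (fun k => wt (n - k) ^ 2) n = sum_f_R0 (fun k => wt k ^ 2) n).
    { symmetry. exact (gsum_rev _ _ _ _ _ _ R_ring_theory (fun k => wt k ^ 2) n). }
    rewrite E. pose proof (wt_sq_sum n).
    replace (4 * 2 ^ K * wt n ^ K) with (2 ^ K * wt n ^ K * 4) by ring.
    apply Rmult_le_compat_l; [|lra]. apply Rmult_le_pos; [apply pow_le; lra|left; apply wt_pow_pos].
Qed.

Lemma Vn_mul K a b c c' : (2 <= K)%nat -> Vn K a c -> Vn K b c' -> Vn K (a * b) (4 * 2 ^ K * c * c').
Proof.
  intros HK Ha Hb n. pose proof (Vn_nonneg _ _ _ Ha). pose proof (Vn_nonneg _ _ _ Hb).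
  eapply Rle_trans; [apply sabs_mul_le|]. rewrite smulE.
  apply Rle_trans with (sum_f_R0 (fun k => c * c' * (wt k ^ K * wt (n - k) ^ K)) n).
  - apply sum_Rle; intros k Hk. unfold sabs.
    replace (c * c' * (wt k ^ K * wt (n - k) ^ K)) with (c * wt k ^ K * (c' * wt (n - k) ^ K)) by ring.
    apply Rmult_le_compat; try apply Rabs_pos; auto.
  - rewrite sum_mul_l. pose proof (wt_conv K n HK).
    replace (4 * 2 ^ K * c * c' * wt n ^ K) with (c * c' * (4 * 2 ^ K * wt n ^ K)) by ring.
    apply Rmult_le_compat_l; [nra|assumption].
Qed.

Lemma V_mul K a b : (2 <= K)%nat -> V K a -> V K b -> V K (a * b).
Proof. intros HK [c Ha] [c' Hb]. eexists. apply Vn_mul; eauto. Qed.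

Lemma V_theta K a : V (S K) a -> V K (theta a).
Proof.
  intros [c Ha]. exists c. intros n. unfold theta. rewrite Rabs_mult, (Rabs_pos_eq _ (pos_INR n)).
  specialize (Ha n). simpl pow in Ha. pose proof (pos_INR n). pose proof (wt_mul n).
  pose proof (wt_pos n). pose proof (wt_pow_pos n K).
  apply Rle_trans with ((INR n + 1) * (c * (wt n * wt n ^ K))).
  - apply Rmult_le_compat; try lra. apply Rabs_pos.
  - right. transitivity (c * (wt n * (INR n + 1)) * wt n ^ K); [ring|]. rewrite H0. ring.
Qed.

Lemma Vn_l1 K a c : (2 <= K)%nat -> Vn K a c -> l1 a (2 * c).
Proof.
  intros HK Ha n. pose proof (Vn_nonneg _ _ _ Ha).
  apply Rle_trans with (sum_f_R0 (fun k => c * wt k ^ 2) n).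
  - apply sum_Rle; intros k Hk. eapply Rle_trans; [apply Ha|].
    apply Rmult_le_compat_l; [assumption|]. now apply wt_pow_mono.
  - rewrite sum_mul_l. pose proof (wt_sq_sum n). rewrite (Rmult_comm 2). apply Rmult_le_compat_l; assumption.
Qed.

Definition summable (a : ser) := exists N, l1 a N.

Lemma V_summable K a : (2 <= K)%nat -> V K a -> summable a.
Proof. intros HK [c Ha]. eexists. eapply Vn_l1; eauto. Qed.

Lemma summable_add a b : summable a -> summable b -> summable (a + b).
Proof. intros [N Ha] [M Hb]. eexists. now apply l1_add; eauto. Qed.
Lemma summable_sub a b : summable a -> summable b -> summable (a - b).
Proof. intros [N Ha] [M Hb]. eexists. now apply l1_sub; eauto. Qed.
Lemma summable_mul a b : summable a -> summable b -> summable (a * b).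
Proof. intros [N Ha] [M Hb]. eexists. now apply l1_mul; eauto. Qed.
Lemma summable_cst c : summable (cst c).
Proof. eexists. apply l1_cst. Qed.
Lemma summable_var : summable var.
Proof. eexists. apply l1_var. Qed.
Lemma summable_omu : summable omu.
Proof. eexists. apply l1_omu. Qed.
Lemma summable_spow a n : summable a -> summable (a ^ n).
Proof. intros [N H]. eexists. now apply l1_spow; eauto. Qed.
Lemma sev_add a b : summable a -> summable b -> ev (a + b) = ev a + ev b.
Proof. intros [N Ha] [M Hb]. eapply ev_add; eauto. Qed.
Lemma sev_sub a b : summable a -> summable b -> ev (a - b) = ev a - ev b.
Proof. intros [N Ha] [M Hb]. eapply ev_sub; eauto. Qed.
Lemma sev_mul a b : summable a -> summable b -> ev (a * b) = ev a * ev b.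
Proof. intros [N Ha] [M Hb]. eapply ev_mul; eauto. Qed.
Lemma sev_spow a n : summable a -> ev (a ^ n) = ev a ^ n.
Proof. intros [N Ha]. eapply ev_spow; eauto. Qed.
Lemma sev_cst_mul c a : summable a -> ev (cst c * a) = c * ev a.
Proof. intros H. rewrite sev_mul, ev_cst; auto using summable_cst. Qed.

(** The remainders of the series at 1, or the quotient of a(1) - a by 1 - z. This division replaces
    Taylor expansion at the singularity and costs one order of decay. *)
Definition tails (a : ser) : ser := (geom * (cst (ev a) - a))%ser.

Lemma omu_tails a : (a = cst (ev a) - omu * tails a)%ser.
Proof.
  unfold tails. replace (omu * (geom * (cst (ev a) - a)))%ser with ((omu * geom) * (cst (ev a) - a))%ser by ring.
  rewrite omu_geom. ring.
Qed.

Lemma tailsE a n : tails a n = ev a - sum_f_R0 a n.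
Proof.
  unfold tails. rewrite geom_mul.
  rewrite (sum_eq _ (fun k => cst (ev a) k - a k)) by (intros; apply ssubE).
  rewrite minus_sum. f_equal. rewrite (sum_single _ n 0); [reflexivity|lia|].
  intros [|k] _ Hk; [now destruct Hk|reflexivity].
Qed.

Lemma tails_bound (a : ser) (n : nat) N B :
  l1 a N -> (forall m, sum_f_R0 (fun k => Rabs (a (S n + k)%nat)) m <= B) -> Rabs (tails a n) <= B.
Proof.
  intros Ha HB. rewrite tailsE.
  apply (is_lim_seq_le (fun m => Rabs (sum_f_R0 a (S n + m) - sum_f_R0 a n)) (fun _ => B) (Rabs (ev a - sum_f_R0 a n)) B).
  - intros m. rewrite (tech2 a n (S n + m)) by lia.
    replace (sum_f_R0 a n + sum_f_R0 (fun i => a (S n + i)%nat) (S n + m - S n) - sum_f_R0 a n)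
      with (sum_f_R0 (fun i => a (S n + i)%nat) (S n + m - S n)) by ring.
    eapply Rle_trans; [apply Rsum_abs|apply HB].
  - apply (is_lim_seq_abs _ (ev a - sum_f_R0 a n)).
    apply is_lim_seq_minus'; [|apply is_lim_seq_const].
    assert (H : is_lim_seq (sum_n a) (ev a)) by (eapply ev_is_series; eauto).
    apply (is_lim_seq_incr_n _ (S n)) in H.
    eapply is_lim_seq_ext; [|exact H]. intros m. cbv beta. rewrite sum_n_sum_f.
    now replace (m + S n)%nat with (S n + m)%nat by lia.
  - apply is_lim_seq_const.
Qed.

Lemma V_tails K a : (1 <= K)%nat -> V (S K) a -> V K (tails a).
Proof.
  intros HK [c Ha]. pose proof (Vn_nonneg _ _ _ Ha) as Hc. exists c. intros n.
  eapply tails_bound; [eapply Vn_l1; [|exact Ha]; lia|]. intros m.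
  (* Of the K + 1 factors, K - 1 are bounded by [wt n]; the other two are kept because sums of
     [wt k ^ 2] telescope to order [wt n]. *)
  apply Rle_trans with (sum_f_R0 (fun k => c * wt n ^ (K - 1) * wt (S n + k) ^ 2) m).
  - apply sum_Rle; intros k _. eapply Rle_trans; [apply Ha|].
    rewrite Rmult_assoc. apply Rmult_le_compat_l; [assumption|].
    replace (S K) with (K - 1 + 2)%nat by lia. rewrite pow_add.
    apply Rmult_le_compat_r; [left; apply wt_pow_pos|].
    apply pow_incr. split; [left; apply wt_pos|]. apply wt_mono; lia.
  - rewrite sum_mul_l. pose proof (wt_sq_tail n m). pose proof (wt_pos (S n + m)).
    replace (c * wt n ^ K) with (c * wt n ^ (K - 1) * wt n).
    + apply Rmult_le_compat_l; [|lra]. apply Rmult_le_pos; [assumption|left; apply wt_pow_pos].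
    + rewrite Rmult_assoc. f_equal. rewrite Rmult_comm. replace K with (S (K - 1)) at 2 by lia. reflexivity.
Qed.

Ltac nonneg := repeat match goal with |- 0 <= _ * _ => apply Rmult_le_pos end; lra.

(** * The binomial series of exponents -1/2 and 1/2 *)

(** The central binomial coefficient binom(2n, n) / 4^n, which is the coefficient of z^n in
    (1-z)^(-1/2). *)
Fixpoint h (n : nat) : R :=
  match n with O => 1 | S k => h k * ((2 * INR k + 1) / (2 * INR k + 2)) end.

Lemma h_S n : h (S n) = h n * ((2 * INR n + 1) / (2 * INR n + 2)).
Proof. reflexivity. Qed.

Lemma h_pos n : 0 < h n.
Proof.
  induction n as [|n IH]; [simpl; lra|]. rewrite h_S. pose proof (pos_INR n).
  apply Rmult_lt_0_compat; [assumption|]. apply Rdiv_lt_0_compat; lra.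
Qed.

Lemma h_diff n : h n - h (S n) = h n * wt n / 2.
Proof. rewrite h_S. unfold wt. pose proof (pos_INR n). field. lra. Qed.

Lemma h_decr n m : (n <= m)%nat -> h m <= h n.
Proof.
  intros H. induction H as [|m H IH]; [lra|].
  pose proof (h_diff m). pose proof (h_pos m). pose proof (wt_pos m). nra.
Qed.

Lemma h_half_S n : h n <= 2 * h (S n).
Proof. pose proof (h_diff n). pose proof (h_pos n). pose proof (wt_le_1 n). nra. Qed.

Lemma h_sq_S n : h (S n) ^ 2 = h n ^ 2 * ((2 * INR n + 1) ^ 2 / (2 * INR n + 2) ^ 2).
Proof. rewrite h_S. pose proof (pos_INR n). field. lra. Qed.

(** With [h_sq_lower], a rough form of h n ~ 1 / sqrt(pi n) by induction on squares. It suffices for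
    error terms; the exact constant is left to Wallis' formula. *)
Lemma h_sq_upper n : h n ^ 2 <= / (2 * INR n + 1).
Proof.
  induction n as [|n IH]; [simpl; lra|].
  rewrite h_sq_S, S_INR. pose proof (pos_INR n).
  apply Rle_trans with (/ (2 * INR n + 1) * ((2 * INR n + 1) ^ 2 / (2 * INR n + 2) ^ 2)).
  - apply Rmult_le_compat_r; [|assumption]. apply Rdiv_le_0_compat; [apply pow2_ge_0|apply pow_lt; lra].
  - replace (/ (2 * INR n + 1) * ((2 * INR n + 1) ^ 2 / (2 * INR n + 2) ^ 2))
      with ((2 * INR n + 1) / (2 * INR n + 2) ^ 2) by (field; lra).
    apply Rle_div_l; [apply pow_lt; lra|].
    replace (/ (2 * (INR n + 1) + 1) * (2 * INR n + 2) ^ 2)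
      with ((2 * INR n + 2) ^ 2 / (2 * INR n + 3)) by (field; lra).
    apply Rle_div_r; [lra|]. nra.
Qed.

Lemma h_sq_lower n : / 4 <= h (S n) ^ 2 * (INR n + 1).
Proof.
  induction n as [|n IH]; [rewrite h_S; simpl; lra|].
  rewrite h_sq_S. rewrite !S_INR. pose proof (pos_INR n).
  replace (h (S n) ^ 2 * ((2 * (INR n + 1) + 1) ^ 2 / (2 * (INR n + 1) + 2) ^ 2) * (INR n + 1 + 1))
    with (h (S n) ^ 2 * (INR n + 1) * ((2 * INR n + 3) ^ 2 / (4 * (INR n + 1) * (INR n + 2)))) by (field; lra).
  apply Rle_trans with (/ 4 * 1); [lra|]. apply Rmult_le_compat; try lra.
  apply Rle_div_r; nra.
Qed.

Lemma h_sq_le_wt n : h n ^ 2 <= wt n.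
Proof.
  eapply Rle_trans; [apply h_sq_upper|]. apply Rinv_le_contravar; pose proof (pos_INR n); lra.
Qed.

Lemma wt_le_h_sq n : wt n <= 4 * h n ^ 2.
Proof.
  destruct n as [|n]; [unfold wt; simpl; lra|].
  pose proof (h_sq_lower n). pose proof (wt_mono n (S n) ltac:(lia)).
  pose proof (wt_mul n). pose proof (wt_pos n).
  assert (wt n * / 4 <= wt n * (h (S n) ^ 2 * (INR n + 1))) by (apply Rmult_le_compat_l; lra).
  replace (wt n * (h (S n) ^ 2 * (INR n + 1))) with (h (S n) ^ 2 * (wt n * (INR n + 1))) in H3 by ring.
  rewrite H1 in H3. lra.
Qed.

Lemma h_half n m : (n <= 2 * m)%nat -> h m <= 2 * h n.
Proof.
  intros H. pose proof (h_pos n). pose proof (h_pos m).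
  apply Rsqr_incr_0_var; [|lra]. rewrite !Rsqr_pow2.
  rewrite Rpow_mult_distr. eapply Rle_trans; [apply h_sq_upper|].
  apply Rle_trans with (wt n); [|pose proof (wt_le_h_sq n); lra].
  apply Rinv_le_contravar; [pose proof (pos_INR n); lra|].
  apply le_INR in H. rewrite mult_INR in H. simpl in H. lra.
Qed.

Lemma wt_le_2h n : wt n <= 2 * h n.
Proof.
  pose proof (h_pos n). pose proof (wt_pos n). pose proof (wt_le_1 n).
  apply Rsqr_incr_0_var; [|lra]. rewrite !Rsqr_pow2. pose proof (wt_le_h_sq n). nra.
Qed.

Lemma h_wt_sum n : sum_f_R0 (fun k => h k * wt k) n <= 2.
Proof.
  assert (H : sum_f_R0 (fun k => h k * wt k) n = 2 * (1 - h (S n))).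
  { induction n as [|n IH].
    - cbn [sum_f_R0]. pose proof (h_diff 0). change (h 0) with 1 in *. lra.
    - cbn [sum_f_R0]. rewrite IH. pose proof (h_diff (S n)). lra. }
  rewrite H. pose proof (h_pos (S n)). lra.
Qed.

Definition hs : ser := h.

Lemma omu_theta_h : (cst 2 * (omu * theta hs) = var * hs)%ser.
Proof.
  extensionality n. rewrite cst_mul. destruct n as [|n].
  - rewrite omu_mul_0, var_mul_0. unfold theta. simpl. ring.
  - rewrite omu_mul_S, var_mul_S. unfold theta, hs. rewrite h_S, S_INR. pose proof (pos_INR n).
    field. lra.
Qed.

(** The differential equation of [hs] gives (1-z) theta G = z G for the square, which forces equal
    consecutive coefficients. No convolution of binomials has to be computed. *)
Lemma h_mul_h : (hs * hs)%ser = geom.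
Proof.
  set (G := (hs * hs)%ser).
  assert (E : (omu * theta G = var * G)%ser).
  { unfold G. rewrite theta_mul.
    replace (omu * (theta hs * hs + hs * theta hs))%ser with ((cst (1 + 1) * (omu * theta hs)) * hs)%ser
      by (rewrite cst_add; ring).
    replace (1 + 1) with 2 by ring. rewrite omu_theta_h. ring. }
  extensionality n. unfold geom. induction n as [|n IH].
  - unfold G. rewrite smul_0. unfold hs. simpl. ring.
  - assert (E' : (omu * theta G)%ser (S n) = (var * G)%ser (S n)) by now rewrite E.
    rewrite omu_mul_S, var_mul_S in E'. unfold theta in E'. rewrite IH, S_INR in E'.
    pose proof (pos_INR n). apply Rmult_eq_reg_l with (INR n + 1); lra.
Qed.

(** The square root of 1 - z. In this form it is inverse to [hs] and its coefficients are
    differences of [h]. *)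
Definition sq : ser := (omu * hs)%ser.

Lemma sq_mul_sq : (sq * sq = omu)%ser.
Proof.
  unfold sq. replace (omu * hs * (omu * hs))%ser with (omu * (omu * (hs * hs)))%ser by ring.
  rewrite h_mul_h, omu_geom. ring.
Qed.

Lemma sq_mul_h : (sq * hs = cst 1)%ser.
Proof.
  unfold sq. replace (omu * hs * hs)%ser with (omu * (hs * hs))%ser by ring.
  rewrite h_mul_h. apply omu_geom.
Qed.

Lemma sq_0 : sq O = 1.
Proof. unfold sq. rewrite omu_mul_0. reflexivity. Qed.

Lemma sq_S n : sq (S n) = - (h n * wt n / 2).
Proof. unfold sq. rewrite omu_mul_S. unfold hs. pose proof (h_diff n). lra. Qed.

Lemma sq_l1 : l1 sq 2.
Proof.
  intros n. destruct n as [|n]; [simpl; rewrite sq_0, Rabs_R1; lra|].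
  rewrite decomp_sum by lia. cbn [pred]. rewrite sq_0, Rabs_R1.
  rewrite (sum_eq _ (fun k => / 2 * (h k * wt k))).
  - rewrite sum_mul_l. pose proof (h_wt_sum n). lra.
  - intros k _. rewrite sq_S, Rabs_Ropp, Rabs_pos_eq; [field|].
    pose proof (h_pos k). pose proof (wt_pos k). nra.
Qed.

Lemma sq_summable : summable sq.
Proof. exists 2. apply sq_l1. Qed.

Lemma ev_sq : ev sq = 0.
Proof.
  pose proof (sev_mul sq sq sq_summable sq_summable) as H. rewrite sq_mul_sq, ev_omu in H.
  symmetry in H. now destruct (Rmult_integral _ _ H).
Qed.

Lemma theta_omu : theta omu = (- var)%ser.
Proof. unfold omu. rewrite theta_sub, theta_cst, theta_var. ring. Qed.

(* e i is the expansion of (1-z)^(i-1/2) *)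
Definition e (i : nat) : ser := (omu ^ i * hs)%ser.

Lemma e_S_S i n : e (S i) (S n) = e i (S n) - e i n.
Proof.
  unfold e. replace (omu ^ S i * hs)%ser with (omu * (omu ^ i * hs))%ser by (simpl; ring).
  apply omu_mul_S.
Qed.

Lemma e_at_0 i : e i O = 1.
Proof. unfold e. rewrite smul_0, omu_spow_0. unfold hs. simpl. ring. Qed.

Lemma omu_theta_e i : (omu * theta (e i) = cst (/ 2 - INR i) * (var * e i))%ser.
Proof.
  induction i as [|i IH].
  - unfold e. replace (omu ^ 0 * hs)%ser with hs by (simpl; ring).
    rewrite <- omu_theta_h. simpl INR. rewrite Rminus_0_r.
    replace (cst (/ 2) * (cst 2 * (omu * theta hs)))%ser with ((cst (/ 2) * cst 2) * (omu * theta hs))%ser by ring.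
    rewrite <- cst_mul_cst. replace (/ 2 * 2) with 1 by field. ring.
  - assert (E : e (S i) = (omu * e i)%ser) by (unfold e; simpl; ring).
    rewrite E, theta_mul, theta_omu.
    replace (omu * (- var * e i + omu * theta (e i)))%ser with (omu * (omu * theta (e i)) - omu * var * e i)%ser by ring.
    rewrite IH, S_INR. replace (/ 2 - (INR i + 1)) with (/ 2 - INR i - 1) by ring.
    rewrite (cst_sub (/ 2 - INR i)). ring.
Qed.

(** The series [e i] is an eigenvector of b -> (n+1) (b n - b (n+1)) with eigenvalue 1/2 + i. The
    recursion for local probabilities has this operator on the left and b / 2 on the right, so this
    basis solves it term by term. *)
Lemma e_rec i n : (INR n + 1) * (e i n - e i (S n)) = (/ 2 + INR i) * e i n.
Proof.
  assert (E : (omu * theta (e i))%ser (S n) = (cst (/ 2 - INR i) * (var * e i))%ser (S n)) by now rewrite omu_theta_e.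
  rewrite omu_mul_S, cst_mul, var_mul_S in E. unfold theta in E. rewrite S_INR in E. lra.
Qed.

Lemma e_S_wt i n : e (S i) (S n) = - (/ 2 + INR i) * (e i n * wt n).
Proof.
  rewrite e_S_S. apply Rmult_eq_reg_l with (INR n + 1); [|pose proof (pos_INR n); lra].
  pose proof (e_rec i n) as H. pose proof (wt_mul n) as Hw.
  replace ((INR n + 1) * (- (/ 2 + INR i) * (e i n * wt n))) with (- (/ 2 + INR i) * e i n * (wt n * (INR n + 1))) by ring.
  rewrite Hw. lra.
Qed.

(** The order n^(-i-1/2) of [e i]. Leading terms below are multiples of [hs] = [e 0] or [sq] =
    [e 1], and the next order is exactly a relative O(1/n). *)
Definition Ob (i : nat) (x : ser) := exists C, forall n, Rabs (x n) <= C * (h n * wt n ^ i).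

Lemma h_wt_pos n i : 0 < h n * wt n ^ i.
Proof. apply Rmult_lt_0_compat; [apply h_pos|apply wt_pow_pos]. Qed.

Lemma Ob_e i : Ob i (e i).
Proof.
  induction i as [|i [C HC]].
  - exists 1. intros n. unfold e. replace (omu ^ 0 * hs)%ser with hs by (simpl; ring).
    simpl. unfold hs. pose proof (h_pos n). rewrite Rabs_pos_eq; lra.
  - exists (1 + (/ 2 + INR i) * C * (2 * 2 ^ S i)). intros n. pose proof (pos_INR i).
    assert (HC0 : 0 <= C).
    { specialize (HC O). rewrite e_at_0, Rabs_R1 in HC. pose proof (h_wt_pos 0 i). nra. }
    assert (P2 : 0 <= (/ 2 + INR i) * C * (2 * 2 ^ S i)).
    { pose proof (pow_lt 2 (S i) ltac:(lra)). apply Rmult_le_pos; [apply Rmult_le_pos|]; lra. }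
    destruct n as [|n].
    + rewrite e_at_0, Rabs_R1. change (h 0) with 1. unfold wt. simpl INR.
      replace (/ (0 + 1)) with 1 by field. rewrite pow1. lra.
    + rewrite e_S_wt, Rabs_mult, Rabs_Ropp, Rabs_pos_eq by lra.
      rewrite Rabs_mult, (Rabs_pos_eq (wt n)) by (left; apply wt_pos).
      pose proof (h_wt_pos (S n) (S i)) as P1.
      apply Rle_trans with ((/ 2 + INR i) * C * (h n * wt n ^ S i)).
      * rewrite Rmult_assoc. apply Rmult_le_compat_l; [lra|].
        replace (C * (h n * wt n ^ S i)) with (C * (h n * wt n ^ i) * wt n) by (simpl; ring).
        apply Rmult_le_compat_r; [left; apply wt_pos|apply HC].
      * apply Rle_trans with ((/ 2 + INR i) * C * (2 * 2 ^ S i) * (h (S n) * wt (S n) ^ S i)); [|nra].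
        replace ((/ 2 + INR i) * C * (2 * 2 ^ S i) * (h (S n) * wt (S n) ^ S i))
          with ((/ 2 + INR i) * C * (2 * h (S n) * (2 ^ S i * wt (S n) ^ S i))) by ring.
        apply Rmult_le_compat_l; [apply Rmult_le_pos; lra|].
        apply Rmult_le_compat; [left; apply h_pos|left; apply wt_pow_pos|apply h_half_S|].
        apply wt_pow_half. lia.
Qed.

Lemma Ob_add i x y : Ob i x -> Ob i y -> Ob i (x + y).
Proof.
  intros [C Hx] [D Hy]. exists (C + D). intros n. rewrite saddE.
  eapply Rle_trans; [apply Rabs_triang|]. specialize (Hx n); specialize (Hy n). lra.
Qed.

Lemma Ob_opp i x : Ob i x -> Ob i (- x).
Proof. intros [C Hx]. exists C. intros n. rewrite soppE, Rabs_Ropp. apply Hx. Qed.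

Lemma Ob_V i x : V (S i) x -> Ob i x.
Proof.
  intros [c Hx]. pose proof (Vn_nonneg _ _ _ Hx). exists (2 * c). intros n. eapply Rle_trans; [apply Hx|].
  simpl. pose proof (wt_le_2h n). pose proof (wt_pow_pos n i).
  replace (2 * c * (h n * wt n ^ i)) with (c * (2 * h n * wt n ^ i)) by ring.
  apply Rmult_le_compat_l; [assumption|]. apply Rmult_le_compat_r; lra.
Qed.

(** The convolution is cut at k = n / 2. For larger k the factor [x] has its full decay and [y] is
    summable. For smaller k the factor [y] has order i + 1, of which half an order is given up to
    produce h n; the sum of h k wt k that remains converges, which requires i >= 1. *)
Lemma Ob_mul_V i x y : (1 <= i)%nat -> Ob i x -> V (S i) y -> Ob i (x * y).
Proof.
  intros Hi [C Hx] [c Hy]. pose proof (Vn_nonneg _ _ _ Hy) as Hc.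
  assert (HC : 0 <= C).
  { specialize (Hx O). pose proof (Rabs_pos (x O)). pose proof (h_wt_pos 0 i). nra. }
  exists (C * c * (2 * 2 ^ i) * 2 + C * c * (2 * 2 ^ S i) * 2). intros n.
  eapply Rle_trans; [apply sabs_mul_le|]. rewrite smulE.
  pose proof (pow_lt 2 i ltac:(lra)) as P2. pose proof (h_pos n) as Phn. pose proof (wt_pow_pos n i) as Pwn.
  apply Rle_trans with (sum_f_R0 (fun k => C * c * (2 * 2 ^ i) * (h n * wt n ^ i) * wt (n - k) ^ 2
      + C * c * (2 * 2 ^ S i) * (h n * wt n ^ i) * (h k * wt k)) n).
  - apply sum_Rle; intros k Hk. unfold sabs.
    apply Rle_trans with (C * (h k * wt k ^ i) * (c * wt (n - k) ^ S i)).
    { apply Rmult_le_compat; try apply Rabs_pos; [apply Hx|apply Hy]. }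
    pose proof (h_pos k) as Phk. pose proof (wt_pow_pos k i) as Pwk. pose proof (wt_pow_pos (n - k) (S i)) as Pwnk.
    pose proof (wt_pow_pos (n - k) 2) as Pw2. pose proof (wt_pos k) as Pk.
    assert (HCc : 0 <= C * c) by nra.
    destruct (Nat.le_gt_cases n (2 * k)) as [Hnk|Hnk].
    + apply Rle_trans with (C * c * (2 * 2 ^ i) * (h n * wt n ^ i) * wt (n - k) ^ 2).
      * replace (C * (h k * wt k ^ i) * (c * wt (n - k) ^ S i)) with (C * c * (h k * wt k ^ i * wt (n - k) ^ S i)) by ring.
        replace (C * c * (2 * 2 ^ i) * (h n * wt n ^ i) * wt (n - k) ^ 2)
          with (C * c * (2 * h n * (2 ^ i * wt n ^ i) * wt (n - k) ^ 2)) by ring.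
        apply Rmult_le_compat_l; [assumption|].
        apply Rmult_le_compat; [nra|lra| |apply wt_pow_mono; lia].
        apply Rmult_le_compat; try lra; [now apply h_half|]. apply wt_pow_half; lia.
      * assert (0 <= C * c * (2 * 2 ^ S i) * (h n * wt n ^ i) * (h k * wt k)); [|lra].
        simpl. nonneg.
    + apply Rle_trans with (C * c * (2 * 2 ^ S i) * (h n * wt n ^ i) * (h k * wt k)).
      * replace (C * (h k * wt k ^ i) * (c * wt (n - k) ^ S i)) with (C * c * (h k * wt k ^ i * wt (n - k) ^ S i)) by ring.
        replace (C * c * (2 * 2 ^ S i) * (h n * wt n ^ i) * (h k * wt k))
          with (C * c * (h k * wt k * (2 ^ S i * (2 * h n * wt n ^ i)))) by ring.
        apply Rmult_le_compat_l; [assumption|].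
        apply Rmult_le_compat; [nra|lra| |].
        -- apply Rmult_le_compat_l; [lra|]. rewrite <- (pow_1 (wt k)) at 2. now apply wt_pow_mono.
        -- eapply Rle_trans; [apply (wt_pow_half n); lia|].
           apply Rmult_le_compat_l; [apply pow_le; lra|]. simpl.
           apply Rmult_le_compat_r; [lra|apply wt_le_2h].
      * assert (0 <= C * c * (2 * 2 ^ i) * (h n * wt n ^ i) * wt (n - k) ^ 2); [|lra].
        nonneg.
  - rewrite sum_plus, !sum_mul_l.
    assert (E : sum_f_R0 (fun k => wt (n - k) ^ 2) n = sum_f_R0 (fun k => wt k ^ 2) n).
    { symmetry. exact (gsum_rev _ _ _ _ _ _ R_ring_theory (fun k => wt k ^ 2) n). }
    rewrite E. pose proof (wt_sq_sum n) as S1. pose proof (h_wt_sum n) as S2.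
    rewrite (Rmult_plus_distr_r (C * c * (2 * 2 ^ i) * 2)). 
    replace (C * c * (2 * 2 ^ i) * 2 * (h n * wt n ^ i)) with (C * c * (2 * 2 ^ i) * (h n * wt n ^ i) * 2) by ring.
    replace (C * c * (2 * 2 ^ S i) * 2 * (h n * wt n ^ i)) with (C * c * (2 * 2 ^ S i) * (h n * wt n ^ i) * 2) by ring.
    apply Rplus_le_compat; apply Rmult_le_compat_l; try assumption;
      simpl; nonneg.
Qed.

Lemma Ob_sq : Ob 1 sq.
Proof.
  replace sq with (e 1) by (unfold e, sq; simpl; ring). apply Ob_e.
Qed.

(** * The algebra V + V sqrt(1-z) *)

(** A regular part and a part carrying the root. The pair is not unique, but the values of [a] and
    [b] at 1 are ([ev_W], [W_zero_ev]), and they determine the leading asymptotics. *)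
Definition W (K : nat) (x : ser) := exists a b, V K a /\ V K b /\ x = (a + b * sq)%ser.

Lemma W_V K a : V K a -> W K a.
Proof. intros H. exists a, (cst 0). split; [assumption|]. split; [apply V_cst|ring]. Qed.

Lemma W_sq K : W K sq.
Proof. exists (cst 0), (cst 1). repeat split; try apply V_cst. ring. Qed.

Lemma W_add K x y : W K x -> W K y -> W K (x + y).
Proof.
  intros (a & b & Ha & Hb & ->) (a' & b' & Ha' & Hb' & ->). exists (a + a')%ser, (b + b')%ser.
  repeat split; try now apply V_add. ring.
Qed.

Lemma W_mul K x y : (2 <= K)%nat -> W K x -> W K y -> W K (x * y).
Proof.
  intros HK (a & b & Ha & Hb & ->) (a' & b' & Ha' & Hb' & ->).
  exists (a * a' + b * b' * omu)%ser, (a * b' + b * a')%ser.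
  repeat split.
  - apply V_add; repeat apply V_mul; auto using V_omu.
  - apply V_add; now apply V_mul.
  - rewrite <- sq_mul_sq. ring.
Qed.

Lemma W_cst K c : W K (cst c).
Proof. apply W_V, V_cst. Qed.

Lemma W_sub K x y : (2 <= K)%nat -> W K x -> W K y -> W K (x - y).
Proof.
  intros HK Hx Hy. replace (x - y)%ser with (x + cst (-1) * y)%ser.
  - apply W_add; [assumption|]. apply W_mul; auto using W_cst.
  - replace (-1) with (- (1)) by ring. rewrite cst_opp. ring.
Qed.

Lemma W_spow K x n : (2 <= K)%nat -> W K x -> W K (x ^ n).
Proof. intros HK Hx. induction n as [|n IH]; simpl; [apply W_cst|now apply W_mul]. Qed.

Lemma W_summable K x : (2 <= K)%nat -> W K x -> summable x.
Proof.
  intros HK (a & b & Ha & Hb & ->). apply summable_add; [eapply V_summable; eauto|].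
  apply summable_mul; [eapply V_summable; eauto|apply sq_summable].
Qed.

Lemma ev_W K a b : (2 <= K)%nat -> V K a -> V K b -> ev (a + b * sq) = ev a.
Proof.
  intros HK Ha Hb. assert (summable a) by (eapply V_summable; eauto). assert (summable b) by (eapply V_summable; eauto).
  rewrite sev_add, sev_mul, ev_sq; auto using summable_mul, sq_summable. ring.
Qed.

(** Replacing b by b(1) leaves a multiple of 1 - z, and (1-z) sqrt(1-z) = [e 2] is one order smaller
    than sqrt(1-z). *)
Lemma V_mul_sq b : V 4 b -> Ob 2 (b * sq - cst (ev b) * sq).
Proof.
  intros Hb. replace (b * sq - cst (ev b) * sq)%ser with (- (e 2 * tails b))%ser.
  - apply Ob_opp, Ob_mul_V; [lia|apply Ob_e|]. apply V_tails; [lia|assumption].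
  - rewrite (omu_tails b) at 2. unfold e, sq. simpl. ring.
Qed.

Lemma W_coefs a b : V 4 a -> V 4 b -> Ob 2 (a + b * sq - cst (ev b) * sq).
Proof.
  intros Ha Hb. replace (a + b * sq - cst (ev b) * sq)%ser with (a + (b * sq - cst (ev b) * sq))%ser by ring.
  apply Ob_add; [|now apply V_mul_sq]. apply Ob_V. now apply (V_mono _ 4); [lia|].
Qed.

(** The case of an inverse root: [hs] cancels the root next to b, so that this term is regular, and
    replacing a by a(1) costs only [sq] times [tails a]. *)
Lemma h_mul_W_coefs a b : V 4 a -> V 4 b -> Ob 1 (hs * (a + b * sq) - cst (ev a) * hs).
Proof.
  intros Ha Hb.
  replace (hs * (a + b * sq) - cst (ev a) * hs)%ser with (b + - (sq * tails a))%ser.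
  - apply Ob_add; [apply Ob_V; now apply (V_mono _ 4); [lia|]|].
    apply Ob_opp, Ob_mul_V; [lia|apply Ob_sq|]. apply (V_mono _ 3); [lia|].
    apply V_tails; [lia|assumption].
  - replace (hs * (a + b * sq))%ser with (hs * a + b * (sq * hs))%ser by ring. rewrite sq_mul_h.
    rewrite (omu_tails a) at 2. unfold sq. ring.
Qed.

(** The coefficients of b(1) sqrt(1-z) have exact order n^(-3/2) unless b(1) = 0, whereas all other
    contributions are one order smaller. This makes the singular coefficient unique. *)
Lemma W_zero_ev a b : V 4 a -> V 4 b -> (a + b * sq)%ser = cst 0 -> ev b = 0.
Proof.
  intros Ha Hb H. destruct (W_coefs a b Ha Hb) as [C HC]. rewrite H in HC.
  assert (HC' : forall n, Rabs (ev b) <= 2 * Rabs C * wt n).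
  { intros n. specialize (HC (S n)). rewrite ssubE, cst_mul, sq_S in HC.
    change (cst 0 (S n)) with 0 in HC.
    replace (0 - ev b * - (h n * wt n / 2)) with (ev b * (h n * wt n / 2)) in HC by ring.
    pose proof (h_pos n) as P1. pose proof (wt_pos n) as P2. pose proof (wt_mono n (S n) ltac:(lia)) as P3.
    pose proof (h_decr n (S n) ltac:(lia)) as P4. pose proof (h_pos (S n)). pose proof (wt_pos (S n)).
    rewrite Rabs_mult, (Rabs_pos_eq (h n * wt n / 2)) in HC by nra.
    apply Rmult_le_reg_r with (h n * wt n / 2); [nra|]. eapply Rle_trans; [apply HC|].
    apply Rle_trans with (Rabs C * (h n * wt n ^ 2)).
    - apply Rle_trans with (Rabs C * (h (S n) * wt (S n) ^ 2)).
      + apply Rmult_le_compat_r; [|apply RRle_abs]. left; apply h_wt_pos.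
      + apply Rmult_le_compat_l; [apply Rabs_pos|]. apply Rmult_le_compat; try lra; [apply pow2_ge_0|].
        apply pow_incr; lra.
    - right. simpl. field. }
  destruct (Req_dec (ev b) 0) as [|Hne]; [assumption|exfalso].
  assert (0 < Rabs (ev b)) by now apply Rabs_pos_lt.
  pose proof (Rabs_pos C).
  destruct (INR_unbounded (2 * Rabs C / Rabs (ev b))) as [n Hn].
  specialize (HC' n). unfold wt in HC'. pose proof (pos_INR n).
  apply Rmult_le_compat_r with (r := INR n + 1) in HC'; [|lra].
  rewrite Rmult_assoc, Rinv_l in HC' by lra.
  apply Rlt_div_l in Hn; [|assumption]. nra.
Qed.

(** * Exponentials of series in [W] *)

Lemma ode_unique (Y E F : ser) :
  Y O = 0 -> E O = F O -> theta E = (Y * E)%ser -> theta F = (Y * F)%ser -> E = F.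
Proof.
  intros HY H0 HE HF. extensionality n. induction n as [n IH] using lt_wf_ind.
  destruct n as [|n]; [assumption|].
  assert (E1 : theta E (S n) = theta F (S n)).
  { rewrite HE, HF, !smulE. apply sum_eq; intros [|k] Hk; [rewrite HY; ring|].
    rewrite IH by lia. reflexivity. }
  unfold theta in E1. apply Rmult_eq_reg_l in E1; [assumption|]. apply not_0_INR; lia.
Qed.

Lemma spow_low (a : ser) k n : a O = 0 -> (n < k)%nat -> (a ^ k)%ser n = 0.
Proof.
  intros Ha. revert n; induction k as [|k IH]; intros n Hn; [lia|].
  simpl spow. rewrite smulE. apply sum_eq_R0. intros [|i] Hi; [rewrite Ha; ring|].
  rewrite IH by lia. ring.
Qed.

Fixpoint exp_partial (L : ser) (N : nat) : ser :=
  match N with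
  | O => cst 1
  | S N' => (exp_partial L N' + cst (/ INR (fact N)) * L ^ N)%ser
  end.

Lemma exp_partialE L N n :
  exp_partial L N n = sum_f_R0 (fun k => (L ^ k)%ser n / INR (fact k)) N.
Proof.
  induction N as [|N IH]; [simpl; field|].
  cbn [exp_partial sum_f_R0]. rewrite saddE, IH, cst_mul. unfold Rdiv. ring.
Qed.

Lemma theta_exp_partial L N : theta (exp_partial L (S N)) = (theta L * exp_partial L N)%ser.
Proof.
  induction N as [|N IH].
  - cbn [exp_partial]. rewrite theta_add, theta_cst_mul, theta_cst, theta_spow.
    simpl fact. simpl spow. simpl INR. rewrite Rinv_1. ring.
  - cbn [exp_partial] in *. rewrite theta_add, IH, theta_cst_mul, theta_spow.
    replace (cst (/ INR (fact (S (S N)))) * (cst (INR (S (S N))) * theta L * L ^ S N))%ser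
      with ((cst (/ INR (fact (S (S N)))) * cst (INR (S (S N)))) * (theta L * L ^ S N))%ser by ring.
    rewrite <- cst_mul_cst.
    replace (/ INR (fact (S (S N))) * INR (S (S N))) with (/ INR (fact (S N))); [ring|].
    rewrite (fact_simpl (S N)), mult_INR. field. split; [apply INR_fact_neq_0|apply not_0_INR; lia].
Qed.

(** When [L] has no constant term, L^k vanishes below degree k, so coefficient n is settled from
    truncation n on. The diagonal thus gives the exponential without any limit. *)
Definition sexp (L : ser) : ser := fun n => exp_partial L n n.

Lemma exp_partial_stable L n N : L O = 0 -> (n <= N)%nat -> exp_partial L N n = sexp L n.
Proof.
  intros HL H. induction H as [|N H IH]; [reflexivity|].
  cbn [exp_partial]. rewrite saddE, cst_mul, IH, spow_low by (assumption || lia). ring.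
Qed.

Lemma theta_sexp L : L O = 0 -> theta (sexp L) = (theta L * sexp L)%ser.
Proof.
  intros HL. extensionality n.
  transitivity (theta (exp_partial L (S n)) n).
  - unfold theta. rewrite exp_partial_stable by (assumption || lia). reflexivity.
  - rewrite theta_exp_partial. apply smul_ext_le; [reflexivity|].
    intros k Hk. now apply exp_partial_stable.
Qed.

Lemma is_lim_seq_sum (u : nat -> nat -> R) (l : nat -> R) n :
  (forall j, (j <= n)%nat -> is_lim_seq (u j) (l j)) ->
  is_lim_seq (fun N => sum_f_R0 (fun j => u j N) n) (sum_f_R0 l n).
Proof.
  induction n as [|n IH]; intros H; cbn [sum_f_R0]; [now apply H|].
  apply is_lim_seq_plus'; [apply IH; intros; apply H; lia|now apply H].
Qed.

(** Explicit coordinates of the powers of a + b sqrt(1-z). The existential in [W] would give an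
    unrelated constant for each power; the exponential needs a single base. *)
Fixpoint sq_powers (a b : ser) (k : nat) : ser * ser :=
  match k with
  | O => (cst 1, cst 0)
  | S k' => let (x, y) := sq_powers a b k' in (a * x + b * omu * y, a * y + b * x)%ser
  end.

Lemma sq_powersE a b k :
  ((a + b * sq) ^ k = fst (sq_powers a b k) + snd (sq_powers a b k) * sq)%ser.
Proof.
  induction k as [|k IH]; simpl; [ring|]. rewrite IH. destruct (sq_powers a b k) as [x y]. simpl.
  rewrite <- sq_mul_sq. ring.
Qed.

Lemma sq_powers_bound K a b : (2 <= K)%nat -> V K a -> V K b ->
  exists B, 0 <= B /\ forall k, Vn K (fst (sq_powers a b k)) (B ^ k) /\ Vn K (snd (sq_powers a b k)) (B ^ k).
Proof.
  intros HK [ca Ha] [cb Hb]. destruct (V_mul K b omu HK (ex_intro _ cb Hb) (V_omu K)) as [co Ho].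
  pose proof (Vn_nonneg _ _ _ Ha). pose proof (Vn_nonneg _ _ _ Hb). pose proof (Vn_nonneg _ _ _ Ho).
  set (kap := 4 * 2 ^ K). assert (0 < kap) by (pose proof (pow_lt 2 K); unfold kap; lra).
  (* One term for each multiplication in the recursion, by [a], by [b * omu] and by [b]; [kap] is
     the constant of [Vn_mul]. *)
  exists (kap * ca + kap * co + kap * cb).
  assert (HB : 0 <= kap * ca + kap * co + kap * cb) by nra.
  split; [assumption|]. set (B := kap * ca + kap * co + kap * cb) in *.
  assert (Hmono : forall x c c', Vn K x c -> c <= c' -> Vn K x c').
  { intros x c c' Hx Hc n. eapply Rle_trans; [apply Hx|].
    apply Rmult_le_compat_r; [left; apply wt_pow_pos|assumption]. }
  induction k as [|k [IHx IHy]]; simpl.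
  - split; intros n; (apply Rle_trans with (1 * wt n ^ K); [|lra]); rewrite Rmult_1_l.
    + destruct n as [|n]; simpl cst.
      * unfold wt. simpl. replace (/ (0 + 1)) with 1 by field. rewrite pow1, Rabs_R1. lra.
      * rewrite Rabs_R0. left; apply wt_pow_pos.
    + destruct n; simpl; rewrite Rabs_R0; left; apply wt_pow_pos.
  - destruct (sq_powers a b k) as [x y]. simpl in *.
    pose proof (Vn_nonneg _ _ _ IHx).
    assert (P1 : 0 <= kap * cb * B ^ k) by nonneg. assert (P2 : 0 <= kap * co * B ^ k) by nonneg.
    assert (EB : B * B ^ k = kap * ca * B ^ k + kap * co * B ^ k + kap * cb * B ^ k) by (unfold B at 1; ring).
    split; (eapply Hmono; [apply Vn_add; apply Vn_mul; eauto|]); fold kap; lra.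
Qed.

Lemma ex_series_exp B : ex_series (fun k => B ^ k / INR (fact k)).
Proof.
  exists (exp B). apply is_series_ext with (fun k => scal (pow_n B k) (/ INR (fact k))).
  - intros n. rewrite pow_n_pow. reflexivity.
  - apply is_exp_Reals.
Qed.

Lemma ex_series_le_abs (a b : nat -> R) :
  (forall n, Rabs (a n) <= b n) -> ex_series b -> ex_series a.
Proof. exact (@ex_series_le R_AbsRing R_CompleteNormedModule a b). Qed.

Lemma V_exp_sum K (x : nat -> ser) B : 0 <= B -> (forall k, Vn K (x k) (B ^ k)) ->
  (forall n, ex_series (fun k => x k n / INR (fact k))) /\
  V K (fun n => Series (fun k => x k n / INR (fact k))).
Proof.
  intros HB Hx.
  assert (Hle : forall n k, Rabs (x k n / INR (fact k)) <= B ^ k / INR (fact k) * wt n ^ K).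
  { intros n k. unfold Rdiv. rewrite Rabs_mult, (Rabs_pos_eq (/ _)) by (left; apply Rinv_0_lt_compat, INR_fact_lt_0).
    replace (B ^ k * / INR (fact k) * wt n ^ K) with (B ^ k * wt n ^ K * / INR (fact k)) by ring.
    apply Rmult_le_compat_r; [left; apply Rinv_0_lt_compat, INR_fact_lt_0|apply Hx]. }
  assert (Hex : forall n, ex_series (fun k => B ^ k / INR (fact k) * wt n ^ K)).
  { intros n. apply (ex_series_scal_r (wt n ^ K)). apply ex_series_exp. }
  assert (Habs : forall n, ex_series (fun k => Rabs (x k n / INR (fact k)))).
  { intros n. apply (ex_series_le_abs _ (fun k => B ^ k / INR (fact k) * wt n ^ K)); [|apply Hex].
    intros k. rewrite Rabs_Rabsolu. apply Hle. }
  split; [intros n; now apply ex_series_Rabs|].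
  exists (Series (fun k => B ^ k / INR (fact k))). intros n.
  eapply Rle_trans; [now apply Series_Rabs|].
  rewrite <- Series_scal_r. apply Series_le; [|apply Hex].
  intros k. split; [apply Rabs_pos|apply Hle].
Qed.

(** The two coordinates of the powers are summed separately with weights 1 / k!. To identify the
    result, the limit of the truncated exponentials is computed twice: they are eventually constant,
    and they converge to the combination of the two sums. *)
Lemma W_sexp K L : (2 <= K)%nat -> L O = 0 -> W K L -> W K (sexp L).
Proof.
  intros HK HL (a & b & Ha & Hb & E).
  destruct (sq_powers_bound K a b HK Ha Hb) as (B & HB & HxB).
  destruct (V_exp_sum K (fun k => fst (sq_powers a b k)) B HB (fun k => proj1 (HxB k))) as [Hx1 Hx2].
  destruct (V_exp_sum K (fun k => snd (sq_powers a b k)) B HB (fun k => proj2 (HxB k))) as [Hy1 Hy2].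
  eexists. eexists. split; [exact Hx2|]. split; [exact Hy2|].
  extensionality n.
  set (X := fun n => Series (fun k => fst (sq_powers a b k) n / INR (fact k))).
  set (Y := fun n => Series (fun k => snd (sq_powers a b k) n / INR (fact k))).
  assert (L1 : is_lim_seq (fun N => exp_partial L N n) (sexp L n)).
  { apply is_lim_seq_ext_loc with (fun _ : nat => sexp L n); [|apply is_lim_seq_const].
    exists n. intros N HN. now rewrite exp_partial_stable. }
  assert (L2 : is_lim_seq (fun N => exp_partial L N n) (X n + sum_f_R0 (fun j => Y j * sq (n - j)%nat) n)).
  { apply is_lim_seq_ext with (fun N => sum_f_R0 (fun k => fst (sq_powers a b k) n / INR (fact k)) N +
      sum_f_R0 (fun j => sum_f_R0 (fun k => snd (sq_powers a b k) j / INR (fact k)) N * sq (n - j)%nat) n).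
    - intros N. rewrite exp_partialE.
      rewrite (sum_eq (fun j => sum_f_R0 (fun k => snd (sq_powers a b k) j / INR (fact k)) N * sq (n - j)%nat)
         (fun j => sum_f_R0 (fun k => snd (sq_powers a b k) j / INR (fact k) * sq (n - j)%nat) N))
        by (intros; now rewrite sum_mul_r).
      rewrite sum_swap, <- sum_plus. apply sum_eq. intros k _.
      rewrite E, sq_powersE, saddE, smulE. unfold Rdiv. rewrite Rmult_plus_distr_r, <- sum_mul_r.
      f_equal. apply sum_eq; intros; ring.
    - apply is_lim_seq_plus'.
      + apply is_lim_seq_ext with (2 := Series_correct _ (Hx1 n)). intros; apply sum_n_sum_f.
      + apply is_lim_seq_sum. intros j _. apply is_lim_seq_mult'; [|apply is_lim_seq_const].
        apply is_lim_seq_ext with (2 := Series_correct _ (Hy1 j)). intros; apply sum_n_sum_f. }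
  apply is_lim_seq_unique in L1. apply is_lim_seq_unique in L2. rewrite L1 in L2.
  injection L2 as L2. rewrite L2. reflexivity.
Qed.

Lemma W_ode K (L E : ser) : (2 <= K)%nat -> L O = 0 -> W K L ->
  E O = 1 -> theta E = (theta L * E)%ser -> W K E.
Proof.
  intros HK HL HW HE0 HE. replace E with (sexp L); [now apply W_sexp|].
  apply (ode_unique (theta L)); auto using theta_sexp.
  unfold theta. simpl. ring.
Qed.

(** * Exponentially decaying coefficients *)

(** Radius of convergence greater than 1. This class is closed under [theta] and under division by 1
    - u at a zero, with no count of orders. *)
Definition expd (f : ser) := exists r, 1 < r /\ summable (scale r f).

Lemma l1_geometric x : 0 <= x < 1 -> l1 (fun n => x ^ n) (/ (1 - x)).
Proof.
  intros Hx n. rewrite (sum_eq _ (fun k => x ^ k)) by (intros; apply Rabs_pos_eq, pow_le; lra).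
  rewrite tech3 by lra. unfold Rdiv. rewrite <- (Rmult_1_l (/ (1 - x))) at 2.
  apply Rmult_le_compat_r; [left; apply Rinv_0_lt_compat; lra|].
  pose proof (pow_le x (S n) ltac:(lra)). lra.
Qed.

Lemma summable_dom (a b : ser) : (forall n, Rabs (a n) <= Rabs (b n)) -> summable b -> summable a.
Proof. intros H [N Hb]. exists N. now apply l1_dom with b. Qed.

Lemma scale_smaller_summable r r' f : 0 <= r' <= r -> summable (scale r f) -> summable (scale r' f).
Proof.
  intros Hr. apply summable_dom. intros n. unfold scale. rewrite !Rabs_mult.
  apply Rmult_le_compat_l; [apply Rabs_pos|].
  rewrite !Rabs_pos_eq by (apply pow_le; lra). apply pow_incr; lra.
Qed.

Lemma expd_summable f : expd f -> summable f.
Proof.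
  intros (r & Hr & H). rewrite <- (scale_1 f). apply scale_smaller_summable with r; [lra|assumption].
Qed.

Lemma expd_add f g : expd f -> expd g -> expd (f + g).
Proof.
  intros (r & Hr & Hf) (r' & Hr' & Hg). exists (Rmin r r').
  pose proof (Rmin_l r r'). pose proof (Rmin_r r r'). assert (1 < Rmin r r') by now apply Rmin_glb_lt.
  split; [assumption|]. rewrite scale_add. apply summable_add.
  - apply scale_smaller_summable with r; [lra|assumption].
  - apply scale_smaller_summable with r'; [lra|assumption].
Qed.

Lemma expd_mul f g : expd f -> expd g -> expd (f * g).
Proof.
  intros (r & Hr & Hf) (r' & Hr' & Hg). exists (Rmin r r').
  pose proof (Rmin_l r r'). pose proof (Rmin_r r r'). assert (1 < Rmin r r') by now apply Rmin_glb_lt.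
  split; [assumption|]. rewrite scale_mul. apply summable_mul.
  - apply scale_smaller_summable with r; [lra|assumption].
  - apply scale_smaller_summable with r'; [lra|assumption].
Qed.

Lemma summable_finite (f : ser) m : (forall n, (m < n)%nat -> f n = 0) -> summable f.
Proof. intros H. apply (V_summable 2); [lia|]. now apply V_finite with m. Qed.

Lemma expd_finite (f : ser) m : (forall n, (m < n)%nat -> f n = 0) -> expd f.
Proof.
  intros H. exists 2. split; [lra|]. apply summable_finite with m.
  intros n Hn. unfold scale. rewrite H by assumption. ring.
Qed.

Lemma expd_cst c : expd (cst c).
Proof. apply (expd_finite _ 0). intros [|n] Hn; [lia|reflexivity]. Qed.

Lemma expd_var : expd var.
Proof. apply (expd_finite _ 1). intros [|[|n]] Hn; [lia|lia|reflexivity]. Qed.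

Lemma expd_sub f g : expd f -> expd g -> expd (f - g).
Proof.
  intros Hf Hg. replace (f - g)%ser with (f + cst (-1) * g)%ser.
  - apply expd_add; [assumption|]. apply expd_mul; auto using expd_cst.
  - replace (-1) with (- (1)) by ring. rewrite cst_opp. ring.
Qed.

Lemma expd_omu : expd omu.
Proof. apply expd_sub; [apply expd_cst|apply expd_var]. Qed.

Lemma expd_spow f n : expd f -> expd (f ^ n).
Proof. intros Hf. induction n as [|n IH]; simpl; [apply expd_cst|now apply expd_mul]. Qed.

Lemma pow_linear_bound x n : 0 <= x < 1 -> INR n * x ^ n <= / (1 - x).
Proof.
  intros Hx. eapply Rle_trans; [|apply (l1_geometric x Hx n)].
  rewrite (sum_eq _ (fun k => x ^ k)) by (intros; apply Rabs_pos_eq, pow_le; lra).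
  apply Rle_trans with (sum_f_R0 (fun _ => x ^ n) n).
  - rewrite sum_cte, S_INR. pose proof (pow_le x n ltac:(lra)). lra.
  - apply sum_Rle; intros k Hk. replace n with (k + (n - k))%nat at 1 by lia. rewrite pow_add.
    rewrite <- (Rmult_1_r (x ^ k)) at 2. apply Rmult_le_compat_l; [apply pow_le; lra|].
    rewrite <- (pow1 (n - k)). apply pow_incr; lra.
Qed.

Lemma expd_theta f : expd f -> expd (theta f).
Proof.
  intros (r & Hr & Hf). exists ((1 + r) / 2). split; [lra|].
  set (x := (1 + r) / 2 / r). assert (Hx : 0 <= x < 1).
  { unfold x. split; [apply Rdiv_le_0_compat; lra|]. apply Rlt_div_l; lra. }
  apply summable_dom with (cst (/ (1 - x)) * scale r f)%ser.
  - intros n. rewrite cst_mul. unfold scale, theta.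
    replace (INR n * f n * ((1 + r) / 2) ^ n) with (INR n * x ^ n * (f n * r ^ n)).
    + rewrite !Rabs_mult. apply Rmult_le_compat_r; [apply Rmult_le_pos; apply Rabs_pos|].
      rewrite (Rabs_pos_eq (/ _)) by (left; apply Rinv_0_lt_compat; lra).
      rewrite <- Rabs_mult, Rabs_pos_eq by (apply Rmult_le_pos; [apply pos_INR|apply pow_le; lra]).
      now apply pow_linear_bound.
    + replace ((1 + r) / 2) with (x * r) by (unfold x; field; lra). rewrite Rpow_mult_distr. ring.
  - apply summable_mul; [apply summable_cst|assumption].
Qed.

Lemma summable_of_bound (g : ser) N x r : 0 <= N -> 0 <= x -> 0 < r -> x * r < 1 ->
  (forall n, Rabs (g n) <= N * x ^ n) -> summable (scale r g).
Proof.
  intros HN Hx Hr Hxr Hg.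
  apply summable_dom with (smul (cst N) (fun n => (x * r) ^ n)).
  - intros n. rewrite cst_mul. unfold scale. rewrite Rabs_mult, (Rabs_pos_eq (r ^ n)) by (apply pow_le; lra).
    rewrite Rpow_mult_distr, (Rabs_pos_eq (N * _)).
    + replace (N * (x ^ n * r ^ n)) with (N * x ^ n * r ^ n) by ring.
      apply Rmult_le_compat_r; [apply pow_le; lra|apply Hg].
    + apply Rmult_le_pos; [assumption|]. apply Rmult_le_pos; apply pow_le; lra.
  - apply summable_mul; [apply summable_cst|]. eexists. apply l1_geometric. nra.
Qed.

Lemma expd_tails_bound f r N : 1 < r -> l1 (scale r f) N -> forall n, Rabs (tails f n) <= N * (/ r) ^ n.
Proof.
  intros Hr HN n.
  assert (Hs : summable f) by (rewrite <- (scale_1 f); apply scale_smaller_summable with r; [lra|eexists; eauto]).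
  destruct Hs as [N1 H1]. eapply tails_bound; [apply H1|]. intros m.
  apply Rle_trans with (sum_f_R0 (fun k => Rabs (scale r f (S n + k)%nat)) m * (/ r) ^ n).
  - rewrite <- sum_mul_r. apply sum_Rle; intros k _. unfold scale. rewrite Rabs_mult, Rmult_assoc.
    rewrite <- (Rmult_1_r (Rabs (f (S n + k)%nat))) at 1. apply Rmult_le_compat_l; [apply Rabs_pos|].
    rewrite Rabs_pos_eq by (apply pow_le; lra).
    replace (S n + k)%nat with (n + S k)%nat by lia. rewrite pow_add.
    replace (r ^ n * r ^ S k * (/ r) ^ n) with (r ^ S k * (r * / r) ^ n) by (rewrite Rpow_mult_distr; ring).
    rewrite Rinv_r, pow1, Rmult_1_r by lra. apply pow_R1_Rle; lra.
  - apply Rmult_le_compat_r; [apply pow_le; left; apply Rinv_0_lt_compat; lra|].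
    eapply Rle_trans; [|apply (HN (S n + m)%nat)].
    rewrite (tech2 _ n (S n + m)) by lia. replace (S n + m - S n)%nat with m by lia.
    pose proof (cond_pos_sum (fun k => Rabs (scale r f k)) n (fun k => Rabs_pos _)). lra.
Qed.

Lemma expd_tails f : expd f -> expd (tails f).
Proof.
  intros (r & Hr & N & HN). exists ((1 + r) / 2). split; [lra|].
  apply summable_of_bound with N (/ r).
  - now apply l1_pos in HN.
  - left; apply Rinv_0_lt_compat; lra.
  - lra.
  - apply Rmult_lt_reg_l with r; [lra|]. field_simplify; lra.
  - now apply expd_tails_bound.
Qed.

Lemma expd_factor f : expd f -> ev f = 0 -> exists g, expd g /\ f = (omu * g)%ser.
Proof.
  intros Hf H0. exists (cst (-1) * tails f)%ser. split.
  - apply expd_mul; [apply expd_cst|now apply expd_tails].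
  - rewrite (omu_tails f) at 1. rewrite H0. replace (-1) with (- (1)) by ring. rewrite cst_opp. ring.
Qed.

Lemma ev_theta_omu g : expd g -> ev (theta (omu * g)) = - ev g.
Proof.
  intros Hg. rewrite theta_mul, theta_omu.
  replace (- var * g + omu * theta g)%ser with (omu * theta g - var * g)%ser by ring.
  pose proof (expd_summable _ Hg). pose proof (expd_summable _ (expd_theta _ Hg)).
  rewrite sev_sub, !sev_mul, ev_omu, ev_var; auto using summable_mul, summable_omu, summable_var. ring.
Qed.

Fixpoint geom_sum (a : ser) (M : nat) : ser :=
  match M with O => cst 0 | S M' => (geom_sum a M' + a ^ M')%ser end.

Lemma geom_sumE a M : ((cst 1 - a) * geom_sum a M = cst 1 - a ^ M)%ser.
Proof.
  induction M as [|M IH]; cbn [geom_sum]; [simpl; ring|].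
  replace ((cst 1 - a) * (geom_sum a M + a ^ M))%ser
    with ((cst 1 - a) * geom_sum a M + (cst 1 - a) * a ^ M)%ser by ring.
  rewrite IH. simpl. ring.
Qed.

(** * Asymptotic expansions in the basis [e i] *)

(** [AE1] forbids the term [e 0]. Its members are the right-hand sides that [AE_solve] accepts, and
    the sums that [W_basis] places in [W], because [e (S i)] is (1-z)^i times [sq]. *)
Definition AE (K : nat) (x : ser) :=
  exists c C, forall n, Rabs (x n - sum_f_R0 (fun i => c i * e i n) K) <= C * wt n ^ K.
Definition AE1 (K : nat) (x : ser) :=
  exists c C, c O = 0 /\ forall n, Rabs (x n - sum_f_R0 (fun i => c i * e i n) K) <= C * wt n ^ K.

Lemma AE1_AE K x : AE1 K x -> AE K x.
Proof. intros (c & C & _ & H). now exists c, C. Qed.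

Lemma AE1_err K (x : ser) C : (forall n, Rabs (x n) <= C * wt n ^ K) -> AE1 K x.
Proof.
  intros H. exists (fun _ => 0), C. split; [reflexivity|]. intros n.
  rewrite sum_eq_R0 by (intros; ring). rewrite Rminus_0_r. apply H.
Qed.

Lemma sum_basis_lin a b c d n K :
  sum_f_R0 (fun i => (a * c i + b * d i) * e i n) K =
  a * sum_f_R0 (fun i => c i * e i n) K + b * sum_f_R0 (fun i => d i * e i n) K.
Proof. rewrite <- !sum_mul_l, <- sum_plus. apply sum_eq; intros; ring. Qed.

Lemma lin_err a b x y X Y C D w :
  0 <= w -> Rabs (x - X) <= C * w -> Rabs (y - Y) <= D * w ->
  Rabs (a * x + b * y - (a * X + b * Y)) <= (Rabs a * C + Rabs b * D) * w.
Proof.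
  intros Hw Hx Hy.
  replace (a * x + b * y - (a * X + b * Y)) with (a * (x - X) + b * (y - Y)) by ring.
  eapply Rle_trans; [apply Rabs_triang|]. rewrite !Rabs_mult, Rmult_plus_distr_r, !Rmult_assoc.
  apply Rplus_le_compat; apply Rmult_le_compat_l; auto using Rabs_pos.
Qed.

Lemma AE_lin K a b x y : AE K x -> AE K y -> AE K (fun n => a * x n + b * y n).
Proof.
  intros (c & C & Hx) (d & D & Hy). exists (fun i => a * c i + b * d i), (Rabs a * C + Rabs b * D).
  intros n. rewrite sum_basis_lin. apply lin_err; auto. left; apply wt_pow_pos.
Qed.

Lemma AE1_lin K a b x y : AE1 K x -> AE1 K y -> AE1 K (fun n => a * x n + b * y n).
Proof.
  intros (c & C & c0 & Hx) (d & D & d0 & Hy). exists (fun i => a * c i + b * d i), (Rabs a * C + Rabs b * D).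
  split; [rewrite c0, d0; ring|].
  intros n. rewrite sum_basis_lin. apply lin_err; auto. left; apply wt_pow_pos.
Qed.

Lemma AE1_ext K (x y : ser) : (forall n, x n = y n) -> AE1 K x -> AE1 K y.
Proof. intros H (c & C & c0 & Hx). exists c, C. split; [assumption|]. intros n. rewrite <- H. apply Hx. Qed.

Lemma AE1_e K i : (1 <= i <= K)%nat -> AE1 K (e i).
Proof.
  intros Hi. exists (fun j => if Nat.eq_dec j i then 1 else 0), 0. split.
  - destruct (Nat.eq_dec 0 i); [lia|reflexivity].
  - intros n. rewrite (sum_single _ K i); [|lia|].
    + destruct (Nat.eq_dec i i); [|congruence]. rewrite Rmult_0_l, Rmult_1_l, Rminus_diag, Rabs_R0. lra.
    + intros k _ Hk. destruct (Nat.eq_dec k i); [congruence|]. ring.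
Qed.

Lemma e_bound i : exists C, forall n, Rabs (e i n) <= C * wt n ^ i.
Proof.
  destruct (Ob_e i) as [C HC].
  assert (HC0 : 0 <= C).
  { specialize (HC O). pose proof (Rabs_pos (e i O)). pose proof (h_wt_pos 0 i). nra. }
  exists C. intros n. eapply Rle_trans; [apply HC|]. apply Rmult_le_compat_l; [assumption|].
  pose proof (h_decr 0 n ltac:(lia)) as Hh. change (h 0) with 1 in Hh. pose proof (wt_pow_pos n i). nra.
Qed.

(** Dividing by n + 1 moves up the basis: [e i n * wt n] is a combination of [e (S i) n] and
    [e (S i) n * wt n]. Iteration ends at i = K, where the product is an error term. *)
Lemma AE1_e_wt K i : AE1 K (fun n => e i n * wt n).
Proof.
  remember (K - i)%nat as m eqn:Em. revert i Em; induction m as [|m IH]; intros i Em.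
  - destruct (e_bound i) as [C HC]. apply AE1_err with (C := C). intros n.
    assert (HC0 : 0 <= C).
    { specialize (HC n). pose proof (Rabs_pos (e i n)). pose proof (wt_pow_pos n i). nra. }
    rewrite Rabs_mult, (Rabs_pos_eq (wt n)) by (left; apply wt_pos).
    apply Rle_trans with (C * wt n ^ i * wt n).
    + apply Rmult_le_compat_r; [left; apply wt_pos|apply HC].
    + rewrite Rmult_assoc. apply Rmult_le_compat_l; [assumption|].
      replace (wt n ^ i * wt n) with (wt n ^ S i) by (simpl; ring). apply wt_pow_mono; lia.
  - apply AE1_ext with (fun n => - / (/ 2 + INR i) * e (S i) n + (/ 2 + INR (S i)) / (/ 2 + INR i) * (e (S i) n * wt n)).
    + intros n. pose proof (pos_INR i). pose proof (e_S_wt i n). pose proof (e_S_wt (S i) n).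
      pose proof (e_S_S (S i) n).
      apply Rmult_eq_reg_l with (- (/ 2 + INR i)); [|lra].
      transitivity (e (S i) n - (/ 2 + INR (S i)) * (e (S i) n * wt n)); [field; lra|].
      lra.
    + apply AE1_lin; [apply AE1_e; lia|]. apply IH. lia.
Qed.

Lemma AE_div K x : AE K x -> AE1 (S K) (fun n => x n * wt n).
Proof.
  intros (c & C & Hx).
  apply AE1_ext with (fun n => 1 * ((x n - sum_f_R0 (fun i => c i * e i n) K) * wt n)
      + 1 * (sum_f_R0 (fun i => c i * e i n) K * wt n)); [intros; ring|].
  apply AE1_lin.
  - apply AE1_err with (C := C). intros n. rewrite Rabs_mult, (Rabs_pos_eq (wt n)) by (left; apply wt_pos).
    replace (C * wt n ^ S K) with (C * wt n ^ K * wt n) by (simpl; ring).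
    apply Rmult_le_compat_r; [left; apply wt_pos|apply Hx].
  - generalize (S K) as M. clear. intros M. induction K as [|K IH].
    + apply AE1_ext with (fun n => c O * (e 0 n * wt n) + 0 * (e 0 n * wt n)); [intros; simpl; ring|].
      apply AE1_lin; apply AE1_e_wt.
    + apply AE1_ext with (fun n => 1 * (sum_f_R0 (fun i => c i * e i n) K * wt n) + c (S K) * (e (S K) n * wt n));
        [intros; simpl; ring|].
      apply AE1_lin; [apply IH|apply AE1_e_wt].
Qed.

(** The sequence y + z decreases and y - z increases, so both trap a common number. *)
Lemma telescoping_limit (y z : nat -> R) :
  (forall n, 0 <= z n) -> (forall n, Rabs (y (S n) - y n) <= z n - z (S n)) ->
  exists Y, forall n, Rabs (y n - Y) <= z n.
Proof.
  intros Hz H.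
  assert (H' : forall n, - (z n - z (S n)) <= y (S n) - y n <= z n - z (S n)).
  { intros n. now apply Rabs_le_between. }
  assert (Hup : forall n m, (n <= m)%nat -> y m + z m <= y n + z n /\ y n - z n <= y m - z m).
  { intros n m Hnm. induction Hnm as [|m Hnm IH]; [lra|]. specialize (H' m). lra. }
  destruct (ex_finite_lim_seq_decr (fun n => y n + z n) (y O - z O)) as [Y HY].
  - intros n. specialize (H' n). lra.
  - intros n. destruct (Hup O n ltac:(lia)). specialize (Hz n). lra.
  - exists Y. intros n. apply Rabs_le_between.
    assert (Y <= y n + z n).
    { apply (is_lim_seq_le_loc (fun m => y m + z m) (fun _ => y n + z n) Y (y n + z n)); [|assumption|apply is_lim_seq_const].
      exists n. intros m Hm. now apply Hup. }
    assert (y n - z n <= Y).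
    { apply (is_lim_seq_le_loc (fun _ => y n - z n) (fun m => y m + z m) (y n - z n) Y); [|apply is_lim_seq_const|assumption].
      exists n. intros m Hm. destruct (Hup n m Hm). specialize (Hz m). lra. }
    lra.
Qed.

Lemma wt_S n : wt (S n) = wt n / (1 + wt n).
Proof. unfold wt. rewrite S_INR. pose proof (pos_INR n). field. lra. Qed.

(** [h] solves the homogeneous recursion, so b / h has increments of order n^(-K-1) / h; they are
    summed by comparison with an explicit decreasing sequence. *)
Lemma solve_error (b r : nat -> R) C K : (1 <= K)%nat -> 0 <= C ->
  (forall n, (INR n + 1) * (b n - b (S n)) = / 2 * b n + r n) ->
  (forall n, Rabs (r n) <= C * wt n ^ K) ->
  exists Y C', forall n, Rabs (b n - Y * h n) <= C' * wt n ^ K.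
Proof.
  intros HK HC Hb Hr.
  (* The 6 comes from x^K (1 - x/2) - (x / (1+x))^K >= x^(K+1) / 6 for 0 < x <= 1/2, and the shift
     to [S n] ensures x <= 1/2. Index 0 is absorbed in the final constant. *)
  set (y := fun n => b (S n) / h (S n)). set (z := fun n => 6 * C * wt (S n) ^ K / h (S n)).
  assert (Hh : forall n, h (S n) = h n * (1 - wt n / 2)) by (intros n; pose proof (h_diff n); lra).
  assert (Hbn : forall n, b (S n) = b n * (1 - wt n / 2) - r n * wt n).
  { intros n. specialize (Hb n). apply Rmult_eq_reg_l with (INR n + 1); [|pose proof (pos_INR n); lra].
    replace ((INR n + 1) * (b n * (1 - wt n / 2) - r n * wt n))
      with ((INR n + 1) * b n - (wt n * (INR n + 1)) * (b n / 2 + r n)) by (unfold Rdiv; ring).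
    rewrite wt_mul. lra. }
  destruct (telescoping_limit y z) as [Y HY].
  - intros n. unfold z. apply Rdiv_le_0_compat; [|apply h_pos].
    pose proof (wt_pow_pos (S n) K). nonneg.
  - intros n. unfold y, z. set (x := wt (S n)).
    assert (Hx : 0 < x <= / 2).
    { split; [apply wt_pos|]. unfold x, wt. rewrite S_INR. apply Rinv_le_contravar; pose proof (pos_INR n); lra. }
    pose proof (h_pos (S n)) as P1. pose proof (h_pos (S (S n))) as P2.
    rewrite (Hbn (S n)). fold x.
    replace (h (S n)) with (h (S (S n)) / (1 - x / 2)) by (rewrite (Hh (S n)); fold x; field; lra).
    replace ((b (S n) * (1 - x / 2) - r (S n) * x) / h (S (S n)) - b (S n) / (h (S (S n)) / (1 - x / 2)))
      with (- (r (S n) * x / h (S (S n)))) by (field; lra).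
    rewrite Rabs_Ropp. unfold Rdiv at 1. rewrite !Rabs_mult.
    rewrite (Rabs_pos_eq x) by lra.
    rewrite (Rabs_pos_eq (/ h (S (S n)))) by (left; now apply Rinv_0_lt_compat).
    replace (6 * C * x ^ K / (h (S (S n)) / (1 - x / 2)) - 6 * C * wt (S (S n)) ^ K / h (S (S n)))
      with (6 * C * (x ^ K * (1 - x / 2) - wt (S (S n)) ^ K) * / h (S (S n))) by (field; lra).
    apply Rmult_le_compat_r; [left; apply Rinv_0_lt_compat; lra|].
    apply Rle_trans with (C * x ^ K * x).
    + apply Rmult_le_compat_r; [lra|]. apply Hr.
    + replace (6 * C * (x ^ K * (1 - x / 2) - wt (S (S n)) ^ K))
        with (C * (6 * (x ^ K * (1 - x / 2) - wt (S (S n)) ^ K))) by ring.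
      rewrite Rmult_assoc. apply Rmult_le_compat_l; [assumption|].
      rewrite (wt_S (S n)). fold x. destruct K as [|K]; [lia|].
      assert (Hp : (x / (1 + x)) ^ K <= x ^ K).
      { apply pow_incr. split; [apply Rdiv_le_0_compat; lra|]. apply Rle_div_l; nra. }
      simpl pow. pose proof (pow_lt x K ltac:(lra)) as Pk.
      assert (Hd : x / (1 + x) <= x - x * x / 2 - x * x / 6).
      { apply Rle_div_l; [lra|].
        assert (0 <= x * x * (/ 3 - 2 / 3 * x)) by (apply Rmult_le_pos; nra). nra. }
      assert (x / (1 + x) * (x / (1 + x)) ^ K <= (x - x * x / 2 - x * x / 6) * x ^ K).
      { apply Rmult_le_compat; try assumption; [apply Rdiv_le_0_compat; lra|].
        apply pow_le, Rdiv_le_0_compat; lra. }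
      nra.
  - exists Y, (6 * C + Rabs (b O - Y)). intros [|n].
    + change (h 0) with 1. unfold wt. simpl INR. replace (/ (0 + 1)) with 1 by field.
      rewrite pow1, !Rmult_1_r. lra.
    + specialize (HY n). unfold y, z in HY. pose proof (h_pos (S n)). pose proof (wt_pow_pos (S n) K).
      pose proof (Rabs_pos (b O - Y)).
      apply Rle_trans with (6 * C * wt (S n) ^ K); [|nra].
      replace (b (S n) - Y * h (S n)) with ((b (S n) / h (S n) - Y) * h (S n)) by (field; lra).
      rewrite Rabs_mult, (Rabs_pos_eq (h (S n))) by lra.
      replace (6 * C * wt (S n) ^ K) with (6 * C * wt (S n) ^ K / h (S n) * h (S n)) by (field; lra).
      apply Rmult_le_compat_r; lra.
Qed.

(** By [e_rec], subtracting 1/2 leaves the factor i on [e i], so a particular solution divides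
    coefficient i by i. There is no obstruction at i = 0 because [AE1] excludes it; the homogeneous
    solution [h] then supplies the term [e 0]. *)
Lemma AE_solve (b r : nat -> R) K : (1 <= K)%nat ->
  (forall n, (INR n + 1) * (b n - b (S n)) = / 2 * b n + r n) -> AE1 K r -> AE K b.
Proof.
  intros HK Hb (c & C & c0 & Hr).
  set (g := fun i => match i with O => 0 | S _ => c i / INR i end).
  set (part := fun n => sum_f_R0 (fun i => g i * e i n) K).
  assert (HC : 0 <= C).
  { specialize (Hr O). pose proof (wt_pow_pos 0 K). eapply Rmult_le_reg_r; [eassumption|].
    rewrite Rmult_0_l. eapply Rle_trans; [|exact Hr]. apply Rabs_pos. }
  assert (Hp : forall n, (INR n + 1) * (part n - part (S n)) = / 2 * part n + sum_f_R0 (fun i => c i * e i n) K).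
  { intros n. unfold part. rewrite <- minus_sum, <- !sum_mul_l, <- sum_plus. apply sum_eq. intros i _.
    transitivity (g i * ((INR n + 1) * (e i n - e i (S n)))); [ring|]. rewrite e_rec.
    unfold g. destruct i as [|i]; [rewrite c0; ring|]. field. apply not_0_INR; lia. }
  destruct (solve_error (fun n => b n - part n) (fun n => r n - sum_f_R0 (fun i => c i * e i n) K) C K HK HC) as (Y & C' & HY).
  - intros n. specialize (Hb n). specialize (Hp n). lra.
  - exact Hr.
  - exists (fun i => g i + match i with O => Y | S _ => 0 end), C'. intros n.
    rewrite (sum_eq _ (fun i => g i * e i n + match i with O => Y * h n | S _ => 0 end)).
    + rewrite sum_plus. fold (part n).
      rewrite (sum_single (fun i => match i with O => Y * h n | S _ => 0 end) K 0); [|lia|].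
      * replace (b n - (part n + Y * h n)) with (b n - part n - Y * h n) by ring. apply HY.
      * intros [|k] _ Hk; [congruence|reflexivity].
    + intros [|i] _; [|ring]. unfold e. replace (omu ^ 0 * hs)%ser with hs by (simpl; ring).
      unfold hs. ring.
Qed.

(** * Local expansions for powers of a centred law *)

(* [pi] is the law of a step shifted by [d], so that coefficient [d n] of [pi ^ n]
   is a return probability. *)
Record step_law (pi : ser) (d : nat) (C : R) : Prop := {
  sl_pos : forall n, 0 <= pi n;
  sl_l1 : l1 pi 1;
  sl_fin : expd pi;
  sl_mass : ev pi = 1;
  sl_mean : ev (theta pi) = INR d;
  sl_d : (1 <= d)%nat;
  sl_0 : 0 < pi O;
  sl_C : 0 <= C;
  sl_smooth : smoothing pi C }.

Definition J (pi : ser) (d : nat) (f : ser) : ser := fun n => (f * pi ^ n)%ser (d * n)%nat.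

Lemma l1_coef x N n : l1 x N -> Rabs (x n) <= N.
Proof.
  intros H. eapply Rle_trans; [|apply (H n)]. destruct n as [|n]; simpl; [lra|].
  pose proof (cond_pos_sum (fun k => Rabs (x k)) n (fun k => Rabs_pos _)). lra.
Qed.

Lemma J_add pi d f g n : J pi d (f + g) n = J pi d f n + J pi d g n.
Proof.
  unfold J. now replace ((f + g) * pi ^ n)%ser with (f * pi ^ n + g * pi ^ n)%ser by ring.
Qed.

Lemma J_sub pi d f g n : J pi d (f - g) n = J pi d f n - J pi d g n.
Proof.
  unfold J. now replace ((f - g) * pi ^ n)%ser with (f * pi ^ n - g * pi ^ n)%ser by ring.
Qed.

Lemma J_cst_mul pi d c f n : J pi d (cst c * f) n = c * J pi d f n.
Proof.
  unfold J. rewrite <- cst_mul. now replace (cst c * f * pi ^ n)%ser with (cst c * (f * pi ^ n))%ser by ring.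
Qed.

Lemma J_bound pi d f N n : l1 pi 1 -> l1 f N -> Rabs (J pi d f n) <= N.
Proof.
  intros Hp Hf. unfold J. apply l1_coef. rewrite <- (Rmult_1_r N). apply l1_mul; [assumption|].
  now apply l1_spow_1.
Qed.

Lemma J_omu_pow pi d C f K : step_law pi d C -> expd f ->
  exists C', forall n, Rabs (J pi d (omu ^ (2 * K) * f) n) <= C' * wt n ^ K.
Proof.
  intros HS Hf. destruct (smoothing_spow pi C K) as [C' HC']; try apply HS.
  destruct (expd_summable _ Hf) as [N HN]. exists (N * C'). intros n.
  unfold J. replace (omu ^ (2 * K) * f * pi ^ n)%ser with (f * (omu ^ (2 * K) * pi ^ n))%ser by ring.
  apply l1_coef. rewrite Rmult_assoc. apply l1_mul; [assumption|]. apply HC'.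
Qed.

(* Integration by parts: the coefficient extraction kills total derivatives. *)
Lemma J_by_parts pi d k n :
  (INR n + 1) * J pi d (k * (theta pi - cst (INR d) * pi)) n =
  - J pi d ((cst (INR d) * k + theta k) * pi) n.
Proof.
  assert (E : theta (k * pi ^ S n) (d * n)%nat = INR d * INR n * (k * pi ^ S n)%ser (d * n)%nat).
  { unfold theta. now rewrite mult_INR. }
  rewrite theta_mul, theta_spow, saddE in E.
  replace (k * (cst (INR (S n)) * theta pi * pi ^ n))%ser
    with (cst (INR (S n)) * (k * theta pi * pi ^ n))%ser in E by ring.
  rewrite cst_mul, S_INR in E.
  replace (k * (theta pi - cst (INR d) * pi))%ser with (k * theta pi - cst (INR d) * (k * pi))%ser by ring.
  replace ((cst (INR d) * k + theta k) * pi)%ser with (cst (INR d) * (k * pi) + theta k * pi)%ser by ring.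
  rewrite J_sub, J_add, !J_cst_mul. unfold J.
  replace (k * pi ^ S n)%ser with (k * pi * pi ^ n)%ser in E by (simpl; ring).
  replace (theta k * pi ^ S n)%ser with (theta k * pi * pi ^ n)%ser in E by (simpl; ring).
  lra.
Qed.

Lemma summable_geom_sum a M : summable a -> summable (geom_sum a M).
Proof.
  intros Ha. induction M as [|M IH]; cbn [geom_sum]; [apply summable_cst|].
  apply summable_add; [assumption|]. now apply summable_spow.
Qed.

Lemma expd_geom_sum a M : expd a -> expd (geom_sum a M).
Proof.
  intros Ha. induction M as [|M IH]; cbn [geom_sum]; [apply expd_cst|].
  apply expd_add; [assumption|]. now apply expd_spow.
Qed.

Lemma W_basis (c : nat -> R) M K : (2 <= K)%nat -> c O = 0 ->
  W K (fun n => sum_f_R0 (fun i => c i * e i n) M).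
Proof.
  intros HK c0. induction M as [|M IH].
  - replace (fun n => sum_f_R0 (fun i => c i * e i n) 0) with (cst 0); [apply W_cst|].
    apply functional_extensionality; intros n. simpl. rewrite c0. destruct n; simpl; ring.
  - replace (fun n => sum_f_R0 (fun i => c i * e i n) (S M))
      with (sadd (fun n => sum_f_R0 (fun i => c i * e i n) M) (cst (c (S M)) * (omu ^ M * sq))).
    + apply W_add; [assumption|]. apply W_mul; [assumption|apply W_cst|].
      apply W_mul; [assumption| |apply W_sq]. apply W_spow; [assumption|]. apply W_V, V_omu.
    + apply functional_extensionality; intros n. rewrite saddE, cst_mul. cbn [sum_f_R0].
      assert (E : (omu ^ M * sq)%ser = e (S M)) by (unfold e, sq; cbn [spow]; ring).
      now rewrite E.
Qed.

Section LocalExpansion.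
Context (pi : ser) (d : nat) (C : R) (HS : step_law pi d C).
(** Its coefficients are (k - d) times those of [pi]. Integration by parts applies to multiples of
    [om], and [om] vanishes at 1 because the mean is d. *)
Let om := (theta pi - cst (INR d) * pi)%ser.

Lemma om_expd : expd om.
Proof.
  apply expd_sub; [apply expd_theta, HS|]. apply expd_mul; [apply expd_cst|apply HS].
Qed.

Lemma om_ev : ev om = 0.
Proof.
  unfold om. rewrite sev_sub, sev_cst_mul, (sl_mass _ _ _ HS), (sl_mean _ _ _ HS).
  - ring.
  - apply expd_summable, HS.
  - apply expd_summable, expd_theta, HS.
  - apply summable_mul; [apply summable_cst|apply expd_summable, HS].
Qed.

(** [ev om1] is minus the variance of a step: applying [theta] - d once more gives coefficients (k -
    d)^2 times those of [pi]. The variance is positive since 0 is an atom and d >= 1. *)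
Lemma om_factor : exists om1, expd om1 /\ om = (omu * om1)%ser /\ ev om1 < 0.
Proof.
  destruct (expd_factor om om_expd om_ev) as (om1 & H1 & E). exists om1. split; [assumption|]. split; [assumption|].
  assert (Ht : ev (theta om - cst (INR d) * om) = - ev om1).
  { rewrite sev_sub, sev_cst_mul, om_ev.
    - rewrite E, ev_theta_omu by assumption. ring.
    - apply expd_summable, om_expd.
    - apply expd_summable, expd_theta, om_expd.
    - apply summable_mul; [apply summable_cst|apply expd_summable, om_expd]. }
  set (v := (theta om - cst (INR d) * om)%ser) in *.
  assert (Hv : forall n, v n = (INR n - INR d) ^ 2 * pi n).
  { intros n. unfold v, om. rewrite !ssubE, !cst_mul. unfold theta.
    rewrite !ssubE, !cst_mul. unfold theta. ring. }
  assert (Hsv : summable v).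
  { apply summable_sub; [apply expd_summable, expd_theta, om_expd|].
    apply summable_mul; [apply summable_cst|apply expd_summable, om_expd]. }
  destruct Hsv as [N HN].
  pose proof (series_partial_le v (ev v) 0) as Hp. simpl in Hp.
  assert (v O <= ev v).
  { apply Hp; [|eapply ev_is_series; eauto]. intros k. rewrite Hv.
    apply Rmult_le_pos; [apply pow2_ge_0|apply HS]. }
  rewrite Hv in H. simpl INR in H.
  assert (1 <= INR d) by (pose proof (le_INR _ _ (sl_d _ _ _ HS)); simpl in *; lra).
  pose proof (sl_0 _ _ _ HS). assert (0 < (0 - INR d) ^ 2 * pi 0%nat); [|lra].
  apply Rmult_lt_0_compat; [|assumption]. nra.
Qed.

(* [X] inverts [om / (1-u)] at [u = 1] to high order; the error is killed by [J_omu_pow]. *)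
Lemma J_reduce om1 K : expd om1 -> om = (omu * om1)%ser -> ev om1 < 0 -> (1 <= K)%nat ->
  exists X, expd X /\ ev X * ev om1 = 1 /\
    forall f1, expd f1 ->
      exists C', forall n,
        Rabs (J pi d (omu * f1) n +
              J pi d ((cst (INR d) * (f1 * X) + theta (f1 * X)) * pi) n * wt n) <= C' * wt n ^ K.
Proof.
  intros H1 Eom Hw HK. set (w := ev om1) in *.
  destruct (expd_factor (cst 1 - cst (/ w) * om1)%ser) as (Y & HY & EY).
  { apply expd_sub; [apply expd_cst|]. apply expd_mul; [apply expd_cst|assumption]. }
  { pose proof (expd_summable _ H1).
    rewrite sev_sub, sev_cst_mul, ev_cst; auto using summable_cst, summable_mul. fold w. field. lra. }
  (* Two factors 1 - u per order: [J_omu_pow] converts the power 2 K into n^(-K). *)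
  set (M := (2 * K)%nat). set (a := (omu * Y)%ser) in *.
  assert (Ha : expd a) by (apply expd_mul; [apply expd_omu|assumption]).
  exists (cst (/ w) * geom_sum a M)%ser.
  assert (HX : expd (cst (/ w) * geom_sum a M)) by (apply expd_mul; [apply expd_cst|now apply expd_geom_sum]).
  set (X := (cst (/ w) * geom_sum a M)%ser) in *.
  assert (EX : (X * om1 = cst 1 - a ^ M)%ser).
  { assert (E1 : (cst (/ w) * om1 = cst 1 - a)%ser) by (rewrite <- EY; ring).
    rewrite <- geom_sumE, <- E1. unfold X. ring. }
  split; [assumption|]. split.
  - unfold w. rewrite <- sev_mul, EX by now apply expd_summable.
    rewrite sev_sub, ev_cst, sev_spow; auto using summable_cst, summable_spow, expd_summable.
    unfold a. rewrite sev_mul, ev_omu; auto using summable_omu, expd_summable.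
    rewrite Rmult_0_l, pow_i by (unfold M; lia). ring.
  - intros f1 Hf1.
    destruct (J_omu_pow pi d C (f1 * omu * Y ^ M)%ser K HS) as [C' HC'].
    { apply expd_mul; [apply expd_mul; [assumption|apply expd_omu]|now apply expd_spow]. }
    exists C'. intros n.
    assert (Ef : (omu * f1 = f1 * X * om + omu ^ M * (f1 * omu * Y ^ M))%ser).
    { rewrite Eom. replace (f1 * X * (omu * om1))%ser with (f1 * omu * (X * om1))%ser by ring.
      rewrite EX. unfold a. rewrite smul_spow. ring. }
    rewrite Ef, J_add.
    pose proof (J_by_parts pi d (f1 * X) n) as HP. fold om in HP.
    replace (J pi d (f1 * X * om) n) with (- J pi d ((cst (INR d) * (f1 * X) + theta (f1 * X)) * pi) n * wt n).
    + match goal with |- Rabs ?t <= _ => replace t with (J pi d (omu ^ M * (f1 * omu * Y ^ M)) n) by ring end.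
      apply HC'.
    + rewrite <- HP. transitivity (wt n * (INR n + 1) * J pi d (f1 * X * om) n); [ring|].
      rewrite wt_mul. ring.
Qed.

(** A zero of [f] at 1 makes integration by parts applicable. It trades [f] for another weight and a
    factor 1 / (n+1), which gains an order and removes the leading term. *)
Lemma J_AE1 K : (forall f, expd f -> AE K (J pi d f)) ->
  forall f, expd f -> ev f = 0 -> AE1 (S K) (J pi d f).
Proof.
  intros IH f Hf H0. destruct om_factor as (om1 & H1 & Eom & Hw).
  destruct (J_reduce om1 (S K) H1 Eom Hw ltac:(lia)) as (X & HX & _ & HR).
  destruct (expd_factor f Hf H0) as (f1 & Hf1 & ->).
  destruct (HR f1 Hf1) as [C' HC'].
  set (g := ((cst (INR d) * (f1 * X) + theta (f1 * X)) * pi)%ser) in *.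
  assert (Hg : expd g).
  { apply expd_mul; [|apply HS]. apply expd_add.
    - apply expd_mul; [apply expd_cst|now apply expd_mul].
    - apply expd_theta. now apply expd_mul. }
  apply AE1_ext with (fun n => 1 * (J pi d (omu * f1) n + J pi d g n * wt n) + (-1) * (J pi d g n * wt n));
    [intros; ring|].
  apply AE1_lin; [now apply AE1_err with (C := C')|]. apply AE_div. now apply IH.
Qed.

Lemma theta_var_spow m : theta (var ^ m) = (cst (INR m) * var ^ m)%ser.
Proof.
  destruct m as [|m]; [simpl; rewrite theta_cst; ring|].
  rewrite theta_spow, theta_var. simpl spow. ring.
Qed.

Lemma ev_var_spow m : ev (var ^ m) = 1.
Proof. rewrite sev_spow, ev_var by apply summable_var. apply pow1. Qed.

(** Up to weights vanishing at 1, everything reduces to b = J(u^d). One step changes b by J(g) with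
    g = u^d - pi, which has a double zero at 1 because masses and means agree. One integration by
    parts turns (n+1) J(g) into b / 2 plus the extraction of a weight that vanishes at 1, expanded
    by [J_AE1], and [AE_solve] concludes. *)
Lemma J_AE K : forall f, expd f -> AE K (J pi d f).
Proof.
  induction K as [|K IH]; intros f Hf.
  { destruct (expd_summable _ Hf) as [N HN]. apply AE1_AE, AE1_err with (C := N).
    intros n. simpl. rewrite Rmult_1_r. apply J_bound; [apply HS|assumption]. }
  pose proof (J_AE1 K IH) as IH1.
  set (b := J pi d (var ^ d)). set (g := (var ^ d - pi)%ser).
  assert (Hvd : expd (var ^ d)) by apply expd_spow, expd_var.
  assert (Hg : expd g) by (apply expd_sub; [assumption|apply HS]).
  assert (Hb : forall n, b n - b (S n) = J pi d g n).
  { intros n. unfold g. rewrite J_sub. fold b. f_equal. unfold b, J.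
    rewrite var_spow_mul. replace (d <=? d * S n)%nat with true by (symmetry; apply Nat.leb_le; nia).
    replace (d * S n - d)%nat with (d * n)%nat by nia. reflexivity. }
  assert (Hg0 : ev g = 0).
  { unfold g. rewrite sev_sub, ev_var_spow, (sl_mass _ _ _ HS); [ring|now apply expd_summable|apply expd_summable, HS]. }
  assert (Egom : (om = cst (INR d) * g - theta g)%ser).
  { unfold g, om. rewrite theta_sub, theta_var_spow. ring. }
  destruct om_factor as (om1 & H1 & Eom & Hw).
  destruct (expd_factor g Hg Hg0) as (g1 & Hg1 & Eg1).
  assert (Hg10 : ev g1 = 0).
  { pose proof om_ev as Ho. rewrite Egom in Ho.
    rewrite sev_sub, sev_cst_mul, Hg0, Eg1, ev_theta_omu in Ho; auto using expd_summable, expd_theta.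
    - lra.
    - apply expd_summable, expd_mul; auto using expd_cst. }
  destruct (expd_factor g1 Hg1 Hg10) as (g2 & Hg2 & Eg2).
  (* Here g = (1-u)^2 g2 and om = d g - theta g, so differentiation of the square produces the
     factor 2. It is the origin of the constant 1/2 in the recursion, hence of the square root
     singularity. *)
  assert (Hom1 : ev om1 = 2 * ev g2).
  { assert (E : om1 = (omu * (cst (INR d) * g2 - theta g2) + cst 2 * (var * g2))%ser).
    { apply omu_cancel. rewrite <- Eom, Egom, Eg1, Eg2, !theta_mul, theta_omu.
      replace 2 with (1 + 1) by ring. rewrite cst_add. ring. }
    pose proof (expd_summable _ Hg2). pose proof (expd_summable _ (expd_theta _ Hg2)).
    rewrite E, sev_add, sev_mul, ev_omu, sev_cst_mul, sev_mul, ev_var;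
      auto using summable_mul, summable_sub, summable_cst, summable_omu, summable_var. ring. }
  destruct (J_reduce om1 (S (S K)) H1 Eom Hw ltac:(lia)) as (X & HX & EX & HR).
  destruct (HR g1 Hg1) as [C' HC']. rewrite <- Eg1 in HC'.
  set (f' := ((cst (INR d) * (g1 * X) + theta (g1 * X)) * pi)%ser) in *.
  assert (Hf' : expd f').
  { apply expd_mul; [|apply HS]. apply expd_add.
    - apply expd_mul; [apply expd_cst|now apply expd_mul].
    - apply expd_theta. now apply expd_mul. }
  assert (Hf'0 : ev f' = - / 2).
  { assert (Hs : forall x, expd x -> summable x) by (intros; now apply expd_summable).
    unfold f'. rewrite Eg2. replace (omu * g2 * X)%ser with (omu * (g2 * X))%ser by ring.
    assert (Hk : expd (omu * (g2 * X))) by (apply expd_mul; [apply expd_omu|now apply expd_mul]).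
    rewrite sev_mul, (sl_mass _ _ _ HS), sev_add, sev_cst_mul, sev_mul, ev_omu, ev_theta_omu, sev_mul;
      auto using summable_omu, summable_add, summable_mul, summable_cst, expd_theta, expd_mul.
    - assert (ev g2 * ev X = / 2); [|lra]. apply Rmult_eq_reg_l with 2; [|lra].
      rewrite Hom1 in EX. lra.
    - apply Hs, HS. }
  assert (HbAE : AE (S K) b).
  { apply AE_solve with (r := fun n => (INR n + 1) * (b n - b (S n)) - / 2 * b n); [lia|intros; ring|].
    apply AE1_ext with (fun n => 1 * ((INR n + 1) * (J pi d g n + J pi d f' n * wt n))
       + (-1) * J pi d (f' + cst (/ 2) * var ^ d) n).
    { intros n. rewrite Hb, J_add, J_cst_mul. fold b.
      transitivity ((INR n + 1) * J pi d g n + (wt n * (INR n + 1)) * J pi d f' n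
          - J pi d f' n - / 2 * b n); [ring|]. rewrite wt_mul. ring. }
    apply AE1_lin.
    - apply AE1_err with (C := C'). intros n.
      rewrite Rabs_mult, (Rabs_pos_eq (INR n + 1)) by (pose proof (pos_INR n); lra).
      apply Rle_trans with ((INR n + 1) * (C' * wt n ^ S (S K))).
      + apply Rmult_le_compat_l; [pose proof (pos_INR n); lra|apply HC'].
      + right. transitivity (C' * (wt n * (INR n + 1)) * wt n ^ S K); [simpl; ring|]. rewrite wt_mul. ring.
    - apply IH1.
      + apply expd_add; [assumption|]. apply expd_mul; [apply expd_cst|assumption].
      + rewrite sev_add, sev_cst_mul, ev_var_spow, Hf'0; auto using expd_summable, expd_mul, expd_cst. lra. }
  assert (HfAE : AE (S K) (J pi d (f - cst (ev f) * var ^ d))).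
  { apply AE1_AE, IH1.
    - apply expd_sub; [assumption|]. apply expd_mul; [apply expd_cst|assumption].
    - rewrite sev_sub, sev_cst_mul, ev_var_spow; auto using expd_summable, expd_mul, expd_cst. ring. }
  pose proof (AE_lin (S K) 1 (ev f) _ _ HfAE HbAE) as HA.
  replace (J pi d f) with (fun n => 1 * J pi d (f - cst (ev f) * var ^ d) n + ev f * b n); [assumption|].
  extensionality n. rewrite J_sub, J_cst_mul. fold b. ring.
Qed.

Definition Jlog (f : ser) : ser := fun n => match n with O => 0 | S _ => J pi d f n / INR n end.

(** 1 / n is 1 / (n+1) plus 1 / (n+1) times 1 / n, so division by n becomes two divisions by n + 1,
    one of them applied to [Jlog] itself. The subtracted constant corrects index 0. *)
Lemma Jlog_AE1 f K : expd f -> AE1 K (Jlog f).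
Proof.
  intros Hf. induction K as [|K IH].
  - destruct (expd_summable _ Hf) as [N HN]. apply AE1_err with (C := N).
    intros n. simpl pow. rewrite Rmult_1_r. pose proof (l1_pos _ _ HN). destruct n as [|n].
    + simpl. rewrite Rabs_R0. lra.
    + unfold Jlog. assert (1 <= INR (S n)) by (rewrite S_INR; pose proof (pos_INR n); lra).
      unfold Rdiv. rewrite Rabs_mult, (Rabs_pos_eq (/ _)) by (left; apply Rinv_0_lt_compat; lra).
      rewrite <- (Rmult_1_r N). apply Rmult_le_compat.
      * apply Rabs_pos.
      * left; apply Rinv_0_lt_compat; lra.
      * apply J_bound; [apply HS|assumption].
      * rewrite <- Rinv_1. apply Rinv_le_contravar; lra.
  - destruct (V_cst (S K) (J pi d f O)) as [Cc HCc].
    apply AE1_ext with (fun n => 1 * (1 * (J pi d f n * wt n) + 1 * (Jlog f n * wt n)) + (-1) * cst (J pi d f O) n).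
    + intros n. unfold Jlog. destruct n as [|n].
      * simpl cst. unfold wt. simpl INR. field.
      * simpl cst. unfold wt. rewrite S_INR. pose proof (pos_INR n). field. lra.
    + apply AE1_lin; [|now apply AE1_err with (C := Cc)].
      apply AE1_lin; [apply AE_div, J_AE, Hf|apply AE_div, AE1_AE, IH].
Qed.

Lemma Jlog_W f K : (2 <= K)%nat -> expd f -> W K (Jlog f).
Proof.
  intros HK Hf. destruct (Jlog_AE1 f K Hf) as (c & Cc & c0 & Hc).
  set (b := fun n => sum_f_R0 (fun i => c i * e i n) K).
  replace (Jlog f) with ((Jlog f - b) + b)%ser by ring.
  apply W_add.
  - apply W_V. exists Cc. exact Hc.
  - now apply W_basis.
Qed.

End LocalExpansion.

(** * Inverses of series *)

Lemma geom_sum_inverse (q D : ser) M :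
  ((cst 1 - q) * D = cst 1)%ser -> (D = geom_sum q M + q ^ M * D)%ser.
Proof.
  intros H. transitivity ((cst 1 - q ^ M) * D + q ^ M * D)%ser; [ring|].
  rewrite <- geom_sumE. f_equal.
  replace ((cst 1 - q) * geom_sum q M * D)%ser with ((cst 1 - q) * D * geom_sum q M)%ser by ring.
  rewrite H. ring.
Qed.

Lemma spow_mul_low (q x : ser) M n : q O = 0 -> (n < M)%nat -> (q ^ M * x)%ser n = 0.
Proof.
  intros Hq Hn. rewrite smulE. apply sum_eq_R0. intros k Hk. rewrite spow_low by (assumption || lia). ring.
Qed.

(** As [q] starts at degree 1, [D] and [geom_sum q M] agree below degree M; a bound uniform in M
    therefore carries over to [D]. *)
Lemma l1_geom_sum_limit (q D y : ser) B :
  q O = 0 -> ((cst 1 - q) * D = cst 1)%ser ->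
  (forall M, l1 (y * geom_sum q M) B) -> l1 (y * D) B.
Proof.
  intros Hq HD H n. eapply Rle_trans; [|apply (H (S n) n)]. apply Req_le, sum_eq.
  intros k Hk. f_equal. rewrite (geom_sum_inverse q D (S n) HD) at 1.
  replace (y * (geom_sum q (S n) + q ^ S n * D))%ser
    with (y * geom_sum q (S n) + q ^ S n * (y * D))%ser by ring.
  rewrite saddE, spow_mul_low by (assumption || lia). ring.
Qed.

Lemma l1_neumann (u H : ser) : u O = 0 -> l1 u (/ 2) -> ((cst 1 - u) * H = cst 1)%ser -> l1 H 2.
Proof.
  intros H0 Hu HH. replace H with (cst 1 * H)%ser by ring.
  apply l1_geom_sum_limit with u; [assumption..|]. intros M.
  replace (cst 1 * geom_sum u M)%ser with (geom_sum u M) by ring.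
  apply l1_le with (2 * (1 - (/ 2) ^ M)).
  - induction M as [|M IH]; cbn [geom_sum].
    + eapply l1_le; [apply l1_cst|]. rewrite Rabs_R0. simpl. lra.
    + eapply l1_le; [apply l1_add; [exact IH|apply l1_spow, Hu]|]. simpl. lra.
  - pose proof (pow_lt (/ 2) M). lra.
Qed.

(** All mixed uses of up to i Euler derivatives become absolutely summable after multiplication by a
    power of 1 - u. The condition is stable under products and passes to inverses, and says that 1
    is the only point where [f] can be singular on the circle. *)
Fixpoint tempered (i : nat) (f : ser) : Prop :=
  match i with
  | O => exists k, summable (omu ^ k * f)
  | S j => tempered j f /\ tempered j (theta f)
  end.

Lemma omu_pow_summable k k' f : (k <= k')%nat -> summable (omu ^ k * f) -> summable (omu ^ k' * f).
Proof.
  intros H Hf. replace (omu ^ k' * f)%ser with (omu ^ (k' - k) * (omu ^ k * f))%ser.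
  - apply summable_mul; [|assumption]. apply summable_spow, summable_omu.
  - replace k' with (k' - k + k)%nat at 2 by lia. rewrite spow_add. ring.
Qed.

Lemma tempered_add i f g : tempered i f -> tempered i g -> tempered i (f + g).
Proof.
  revert f g; induction i as [|i IH]; intros f g.
  - intros [k Hf] [l Hg]. exists (k + l)%nat.
    replace (omu ^ (k + l) * (f + g))%ser with (omu ^ (k + l) * f + omu ^ (k + l) * g)%ser by ring.
    apply summable_add; [apply omu_pow_summable with k|apply omu_pow_summable with l]; try lia; assumption.
  - intros [H1 H2] [H3 H4]. split; [now apply IH|]. rewrite theta_add. now apply IH.
Qed.

Lemma tempered_mul i f g : tempered i f -> tempered i g -> tempered i (f * g).
Proof.
  revert f g; induction i as [|i IH]; intros f g.
  - intros [k Hf] [l Hg]. exists (k + l)%nat.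
    replace (omu ^ (k + l) * (f * g))%ser with ((omu ^ k * f) * (omu ^ l * g))%ser by (rewrite spow_add; ring).
    now apply summable_mul.
  - intros [H1 H2] [H3 H4]. split; [now apply IH|]. rewrite theta_mul. apply tempered_add; now apply IH.
Qed.

Lemma tempered_V i a : V (S (S i)) a -> tempered i a.
Proof.
  revert a; induction i as [|i IH]; intros a Ha.
  - exists O. replace (omu ^ 0 * a)%ser with a by (simpl; ring). now apply (V_summable 2).
  - split; [apply IH; apply V_mono with (2 := Ha); lia|]. apply IH. now apply V_theta.
Qed.

Lemma tempered_omu_cancel i f : tempered i (omu * f) -> tempered i f.
Proof.
  revert f; induction i as [|i IH]; intros f.
  - intros [k H]. exists (S k). replace (omu ^ S k * f)%ser with (omu ^ k * (omu * f))%ser by (simpl; ring).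
    assumption.
  - intros [H1 H2]. split; [now apply IH|]. apply IH.
    replace (omu * theta f)%ser with (theta (omu * f) + var * f)%ser by (rewrite theta_mul, theta_omu; ring).
    apply tempered_add; [assumption|]. apply tempered_mul; [apply tempered_V, V_var|now apply IH].
Qed.

Lemma omu_theta_sq : (omu * theta sq = cst (- / 2) * (var * sq))%ser.
Proof.
  pose proof (omu_theta_e 1) as H. replace (e 1) with sq in H by (unfold e, sq; simpl; ring).
  rewrite H. simpl INR. f_equal. f_equal. field.
Qed.

Lemma tempered_sq i : tempered i sq.
Proof.
  induction i as [|i IH].
  - exists O. replace (omu ^ 0 * sq)%ser with sq by (simpl; ring). apply sq_summable.
  - split; [assumption|]. apply tempered_omu_cancel. rewrite omu_theta_sq.
    apply tempered_mul; [apply tempered_V, V_cst|]. apply tempered_mul; [apply tempered_V, V_var|assumption].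
Qed.

Lemma tempered_W i f : W (S (S i)) f -> tempered i f.
Proof.
  intros (a & b & Ha & Hb & ->). apply tempered_add; [now apply tempered_V|].
  apply tempered_mul; [now apply tempered_V|apply tempered_sq].
Qed.

(** Differentiating (1 - q) D = 1 gives theta D = D^2 theta q, so derivatives of [D] reduce to [D]
    and derivatives of [q]. *)
Lemma tempered_inverse i q D : ((cst 1 - q) * D = cst 1)%ser ->
  tempered i q -> tempered 0 D -> tempered i D.
Proof.
  intros HD. induction i as [|i IH]; intros Hq H0; [assumption|].
  destruct Hq as [Hq1 Hq2]. specialize (IH Hq1 H0). split; [assumption|].
  assert (E : theta D = (theta q * (D * D))%ser).
  { assert (E1 : theta ((cst 1 - q) * D) = cst 0) by (rewrite HD; apply theta_cst).
    rewrite theta_mul, theta_sub, theta_cst in E1.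
    transitivity ((cst 1 - q) * D * theta D)%ser; [rewrite HD; ring|].
    transitivity (((cst 0 - theta q) * D + (cst 1 - q) * theta D) * D + theta q * (D * D))%ser; [ring|].
    rewrite E1. ring. }
  rewrite E. repeat apply tempered_mul; assumption.
Qed.

Lemma V_var_mul i x : V i x -> V i (var * x).
Proof.
  intros [c Hc]. pose proof (Vn_nonneg _ _ _ Hc). exists (2 ^ i * c). intros [|n].
  - rewrite var_mul_0, Rabs_R0. pose proof (wt_pow_pos 0 i). pose proof (pow_lt 2 i ltac:(lra)). nonneg.
  - rewrite var_mul_S. eapply Rle_trans; [apply Hc|].
    replace (2 ^ i * c * wt (S n) ^ i) with (c * (2 ^ i * wt (S n) ^ i)) by ring.
    apply Rmult_le_compat_l; [assumption|]. apply wt_pow_half. lia.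
Qed.

Lemma V_cst_mul i c x : V i x -> V i (cst c * x).
Proof.
  intros [C HC]. exists (Rabs c * C). intros n. rewrite cst_mul, Rabs_mult, Rmult_assoc.
  apply Rmult_le_compat_l; [apply Rabs_pos|apply HC].
Qed.

Lemma V_of_theta i x : V i x -> V i (theta x) -> V (S i) x.
Proof.
  intros [c Hc] [c' Hc']. exists (c + c'). intros n. specialize (Hc n). specialize (Hc' n).
  unfold theta in Hc'. rewrite Rabs_mult, (Rabs_pos_eq _ (pos_INR n)) in Hc'.
  apply Rmult_le_reg_l with (INR n + 1); [pose proof (pos_INR n); lra|].
  apply Rle_trans with ((c + c') * wt n ^ i); [lra|]. right.
  transitivity ((c + c') * wt n ^ i * (wt n * (INR n + 1))); [rewrite wt_mul; ring|simpl; ring].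
Qed.

Lemma theta_omu_spow k : theta (omu ^ S k) = (cst (- INR (S k)) * (var * omu ^ k))%ser.
Proof. rewrite theta_spow, theta_omu, cst_opp. ring. Qed.

(** Control of a derivative is control of n times the coefficients, hence one order of decay.
    Differentiating (1-u)^k lowers the power by one, so k has to be large. *)
Lemma tempered_decay i f : tempered i f -> exists k0, forall k, (k0 <= k)%nat -> V i (omu ^ k * f).
Proof.
  revert f; induction i as [|i IH]; intros f.
  - intros [k0 H]. exists k0. intros k Hk.
    destruct (omu_pow_summable _ _ _ Hk H) as [N HN]. exists N. intros n. simpl. rewrite Rmult_1_r.
    now apply l1_coef.
  - intros [H1 H2]. destruct (IH _ H1) as [k1 Hk1]. destruct (IH _ H2) as [k2 Hk2].
    exists (S (k1 + k2)). intros k Hk. apply V_of_theta; [apply Hk1; lia|].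
    destruct k as [|k]; [lia|]. rewrite theta_mul, theta_omu_spow.
    replace (cst (- INR (S k)) * (var * omu ^ k) * f)%ser
      with (cst (- INR (S k)) * (var * (omu ^ k * f)))%ser by ring.
    apply V_add.
    + apply V_cst_mul, V_var_mul, Hk1. lia.
    + apply Hk2. lia.
Qed.

Lemma W_geom_sum K a M : (2 <= K)%nat -> W K a -> W K (geom_sum a M).
Proof.
  intros HK Ha. induction M as [|M IH]; cbn [geom_sum]; [apply W_cst|].
  apply W_add; [assumption|]. now apply W_spow.
Qed.

Lemma spow_even_sq k : (sq ^ (2 * k) = omu ^ k)%ser.
Proof.
  rewrite spow_mul. f_equal. simpl. rewrite <- sq_mul_sq. ring.
Qed.

(* A local version of Wiener's lemma: [G] is already known to be tempered, so that only its
   behaviour at 1 matters, where [x + y sqrt(1-z)] is inverted by a geometric series. *)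
Lemma W_inverse (x y G : ser) : V 5 x -> V 5 y -> ev x <> 0 ->
  ((x + y * sq) * G = cst 1)%ser -> tempered 4 G -> W 4 G.
Proof.
  intros Hx Hy Hev HG Ht. set (w := ev x) in *.
  (* Chosen so that x + y sqrt(1-z) = w (1 - sqrt(1-z) Y), using x = w - (1-z) [tails x]. *)
  set (Y := (cst (/ w) * (sq * tails x - y))%ser).
  assert (HY : W 4 Y).
  { apply W_mul; [lia|apply W_cst|]. apply W_sub; [lia| |].
    - apply W_mul; [lia|apply W_sq|]. apply W_V, V_tails; [lia|assumption].
    - apply W_V. apply V_mono with (2 := Hy). lia. }
  set (a := (sq * Y)%ser).
  assert (Ha : W 4 a) by (apply W_mul; [lia|apply W_sq|assumption]).
  assert (E : (x + y * sq = cst w * (cst 1 - a))%ser).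
  { unfold a, Y. transitivity (cst w - (cst w * cst (/ w)) * (sq * (sq * tails x - y)))%ser; [|ring].
    rewrite <- cst_mul_cst, Rinv_r by assumption.
    rewrite (omu_tails x) at 1. fold w. rewrite <- sq_mul_sq. ring. }
  assert (HG' : ((cst 1 - a) * (cst w * G) = cst 1)%ser) by (rewrite E in HG; transitivity (cst w * (cst 1 - a) * G)%ser; [ring|exact HG]).
  destruct (tempered_decay 4 G Ht) as [k Hk]. specialize (Hk k (le_n k)).
  assert (EG : G = (cst (/ w) * (geom_sum a (2 * k) + a ^ (2 * k) * (cst w * G)))%ser).
  { rewrite <- geom_sum_inverse by assumption.
    replace (cst (/ w) * (cst w * G))%ser with ((cst (/ w) * cst w) * G)%ser by ring.
    rewrite <- cst_mul_cst, Rinv_l by assumption. ring. }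
  rewrite EG. apply W_mul; [lia|apply W_cst|]. apply W_add; [now apply W_geom_sum; [lia|]|].
  (* The even power of the root is (1-z)^k, which brings [G] into [V 4] by [Hk]; the powers of [Y]
     stay in [W 4]. *)
  replace (a ^ (2 * k) * (cst w * G))%ser with (Y ^ (2 * k) * (cst w * (omu ^ k * G)))%ser
    by (unfold a; rewrite smul_spow, spow_even_sq; ring).
  apply W_mul; [lia|now apply W_spow; [lia|]|]. apply W_mul; [lia|apply W_cst|]. now apply W_V.
Qed.

(** * Renewal sequences *)

(** [D] is the sum of the powers of [q]. Each pair of factors 1 - u gains 1 / k on q^k, so four
    factors give the summable rate k^(-2), where two would only give 1 / k. *)
Lemma renewal_tempered (q D : ser) A :
  (forall n, 0 <= q n) -> l1 q 1 -> q O = 0 -> 0 < q A -> 0 < q (S A) ->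
  ((cst 1 - q) * D = cst 1)%ser -> summable (omu ^ 4 * D).
Proof.
  intros Hq H1 H0 HA HB HD. destruct (adjacent_smoothing q A Hq H1 HA HB) as [C HC].
  assert (HC' : smoothing q (Rabs C)).
  { intros k. eapply l1_le; [apply HC|]. apply sqrt_le_1_alt.
    apply Rmult_le_compat_r; [left; apply wt_pos|apply RRle_abs]. }
  destruct (smoothing_spow q _ 2 (Rabs_pos C) H1 HC') as [B HB'].
  assert (HB0 : 0 <= B).
  { specialize (HB' O). apply l1_pos in HB'. pose proof (wt_pow_pos 0 2) as P. unfold wt in P.
    eapply Rmult_le_reg_r; [exact P|]. rewrite Rmult_0_l. exact HB'. }
  exists (B * 2). apply l1_geom_sum_limit with q; [assumption..|]. intros M.
  apply l1_le with (B * match M with O => 0 | S m => sum_f_R0 (fun k => wt k ^ 2) m end).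
  - induction M as [|M IH]; cbn [geom_sum].
    + replace (omu ^ 4 * cst 0)%ser with (cst 0) by ring. eapply l1_le; [apply l1_cst|]. rewrite Rabs_R0. lra.
    + replace (omu ^ 4 * (geom_sum q M + q ^ M))%ser with (omu ^ 4 * geom_sum q M + omu ^ 4 * q ^ M)%ser by ring.
      eapply l1_le; [apply l1_add; [exact IH|apply (HB' M)]|]. fold (wt M).
      right. destruct M as [|M]; cbn [sum_f_R0]; ring.
  - apply Rmult_le_compat_l; [assumption|]. destruct M as [|M]; [lra|apply wt_sq_sum].
Qed.

Lemma pow_minus_1_bound r n : 1 <= r -> 0 <= r ^ n - 1 <= (r - 1) * (INR n * r ^ n).
Proof.
  intros Hr. induction n as [|n IH]; [simpl; lra|]. rewrite S_INR. simpl pow.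
  pose proof (pow_R1_Rle r n Hr). pose proof (pos_INR n).
  split; [nra|].
  assert (r * (r ^ n - 1) <= r * ((r - 1) * (INR n * r ^ n))) by (apply Rmult_le_compat_l; lra).
  assert (0 <= (r - 1) * (r * r ^ n - 1)) by (apply Rmult_le_pos; nra). nra.
Qed.

Lemma scale_perturbation F eps : expd F -> 0 < eps ->
  exists r, 1 < r /\ l1 (scale r F - F) eps.
Proof.
  intros HF He. destruct (expd_theta F HF) as (r1 & Hr1 & B & HB).
  pose proof (l1_pos _ _ HB) as HB0.
  set (t := Rmin (r1 - 1) (eps / (B + 1))).
  assert (Ht : 0 < t) by (apply Rmin_glb_lt; [lra|apply Rdiv_lt_0_compat; lra]).
  pose proof (Rmin_l (r1 - 1) (eps / (B + 1))) as T1. pose proof (Rmin_r (r1 - 1) (eps / (B + 1))) as T2.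
  fold t in T1, T2. exists (1 + t). split; [lra|].
  apply l1_le with (Rabs t * B).
  - apply l1_dom with (cst t * scale r1 (theta F))%ser; [|apply l1_mul; [apply l1_cst|assumption]].
    intros n. rewrite ssubE, cst_mul. unfold scale, theta.
    replace (F n * (1 + t) ^ n - F n) with (F n * ((1 + t) ^ n - 1)) by ring.
    replace (t * (INR n * F n * r1 ^ n)) with (F n * (t * (INR n * r1 ^ n))) by ring.
    rewrite !(Rabs_mult (F n)). apply Rmult_le_compat_l; [apply Rabs_pos|].
    pose proof (pow_minus_1_bound (1 + t) n ltac:(lra)). pose proof (pos_INR n).
    assert ((1 + t) ^ n <= r1 ^ n) by (apply pow_incr; lra).
    pose proof (pow_le (1 + t) n ltac:(lra)).
    rewrite !Rabs_pos_eq; [|nonneg|lra].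
    eapply Rle_trans; [apply H|]. replace (1 + t - 1) with t by ring.
    apply Rmult_le_compat_l; [lra|]. apply Rmult_le_compat_l; lra.
  - rewrite Rabs_pos_eq by lra. apply Rle_trans with (eps / (B + 1) * B).
    + apply Rmult_le_compat_r; lra.
    + replace (eps / (B + 1) * B) with (eps - eps / (B + 1)) by (field; lra).
      assert (0 < eps / (B + 1)) by (apply Rdiv_lt_0_compat; lra). lra.
Qed.

(** A slightly larger radius r changes [F] by at most 1 / (2 (N + 1)) in norm, so F(r z) G(z) = 1 -
    u with u of norm at most 1/2. A Neumann series then bounds the inverse at radius r. *)
Lemma expd_inverse (F G : ser) : expd F -> summable G -> (F * G = cst 1)%ser -> expd G.
Proof.
  intros HF [N HN] HFG. pose proof (l1_pos _ _ HN) as HN0.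
  destruct (scale_perturbation F (/ (2 * (N + 1))) HF) as (r & Hr & HE).
  { apply Rinv_0_lt_compat; lra. }
  exists r. split; [assumption|].
  set (E := (scale r F - F)%ser) in *. set (u := (cst (-1) * (E * G))%ser).
  assert (Hs : (scale r F * scale r G = cst 1)%ser) by (rewrite <- scale_mul, HFG; apply scale_cst).
  assert (Hu : ((cst 1 - u) = scale r F * G)%ser).
  { unfold u, E. replace (-1) with (- (1)) by ring. rewrite cst_opp.
    transitivity (cst 1 + (scale r F * G - F * G))%ser; [ring|]. rewrite HFG. ring. }
  assert (HH : l1 (scale r G * F) 2).
  { apply l1_neumann with u.
    - unfold u. rewrite cst_mul, smul_0. unfold E. rewrite ssubE. unfold scale. simpl. ring.
    - unfold u. eapply l1_le; [apply l1_mul; [apply l1_cst|apply l1_mul; [exact HE|exact HN]]|].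
      rewrite Rabs_left by lra. replace (- -1 * (/ (2 * (N + 1)) * N)) with (/ 2 - / (2 * (N + 1))) by (field; lra).
      assert (0 < / (2 * (N + 1))) by (apply Rinv_0_lt_compat; lra). lra.
    - rewrite Hu. transitivity ((scale r F * scale r G) * (F * G))%ser; [ring|]. rewrite Hs, HFG. ring. }
  replace (scale r G) with ((scale r G * F) * G)%ser.
  - apply summable_mul; [eexists; eauto|eexists; eauto].
  - transitivity (scale r G * (F * G))%ser; [ring|]. rewrite HFG. ring.
Qed.

(** 1 - q has a simple zero at 1 with slope given by the mean. Once it is divided out, [G] = (1-z) D
    is the inverse of a series analytic beyond the unit circle, and D n - G(1) is minus a tail of
    [G]. *)
Lemma geometric_renewal (q D : ser) A :
  expd q -> (forall n, 0 <= q n) -> ev q = 1 -> q O = 0 -> 0 < q A -> 0 < q (S A) ->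
  ((cst 1 - q) * D = cst 1)%ser ->
  exists r N, 1 < r /\ 0 <= N /\ forall n, Rabs (D n - / ev (theta q)) <= N * (/ r) ^ n.
Proof.
  intros Hexp Hq H1 H0 HA HB HD.
  assert (Hl1 : l1 q 1).
  { intros n. rewrite (sum_eq _ q) by (intros; now apply Rabs_pos_eq). rewrite <- H1.
    apply series_partial_le; [assumption|]. destruct (expd_summable _ Hexp) as [N HN].
    eapply ev_is_series; eauto. }
  assert (Ht : summable (omu ^ 4 * D)) by now apply renewal_tempered with q A.
  destruct (expd_factor (cst 1 - q)%ser) as (F & HF & EF).
  { apply expd_sub; [apply expd_cst|assumption]. }
  { rewrite sev_sub, ev_cst, H1 by (apply summable_cst || now apply expd_summable). ring. }
  set (G := (omu * D)%ser).
  assert (HFG : (F * G = cst 1)%ser) by (rewrite EF in HD; unfold G; transitivity (omu * F * D)%ser; [ring|exact HD]).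
  assert (Ew : ev F = ev (theta q)).
  { pose proof (ev_theta_omu F HF) as H. rewrite <- EF, theta_sub, theta_cst in H.
    rewrite sev_sub, ev_cst in H; [lra|apply summable_cst|now apply expd_summable, expd_theta]. }
  assert (Hw : 0 < ev (theta q)).
  { apply Rlt_le_trans with (theta q (S A)).
    - unfold theta. apply Rmult_lt_0_compat; [apply lt_0_INR; lia|assumption].
    - destruct (expd_summable _ (expd_theta _ Hexp)) as [N HN].
      assert (Hpos : forall k, 0 <= theta q k) by (intros; apply Rmult_le_pos; [apply pos_INR|apply Hq]).
      eapply Rle_trans; [|apply (series_partial_le (theta q) _ (S A) Hpos); eapply ev_is_series; eauto].
      simpl. pose proof (cond_pos_sum (theta q) A Hpos). lra. }
  set (w := ev F) in *.
  destruct (expd_factor (cst 1 - cst (/ w) * F)%ser) as (Y & HY & EY).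
  { apply expd_sub; [apply expd_cst|]. apply expd_mul; [apply expd_cst|assumption]. }
  { pose proof (expd_summable _ HF).
    rewrite sev_sub, sev_cst_mul, ev_cst; auto using summable_cst, summable_mul. fold w. field. lra. }
  assert (HG : summable G).
  { assert (Hi : ((cst 1 - omu * Y) * (cst w * G) = cst 1)%ser).
    { rewrite <- EY. transitivity ((cst (/ w) * cst w) * (F * G))%ser; [ring|].
      rewrite HFG, <- cst_mul_cst, Rinv_l by lra. ring. }
    assert (HwG : summable (cst w * G)).
    (* Three terms leave (1-z)^3 G = (1-z)^4 D, which is known to be summable. *)
    { rewrite (geom_sum_inverse _ _ 3 Hi). apply summable_add.
      - apply summable_geom_sum, summable_mul; [apply summable_omu|now apply expd_summable].
      - replace ((omu * Y) ^ 3 * (cst w * G))%ser with (cst w * Y ^ 3 * (omu ^ 4 * D))%ser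
          by (unfold G; simpl; ring).
        apply summable_mul; [|assumption]. apply summable_mul; [apply summable_cst|].
        now apply summable_spow, expd_summable. }
    replace G with (cst (/ w) * (cst w * G))%ser.
    - apply summable_mul; [apply summable_cst|assumption].
    - transitivity ((cst (/ w) * cst w) * G)%ser; [ring|]. rewrite <- cst_mul_cst, Rinv_l by lra. ring. }
  assert (HGe : expd G) by now apply expd_inverse with F.
  assert (EvG : ev G = / ev (theta q)).
  { assert (HE : ev (F * G) = 1) by (rewrite HFG; apply ev_cst).
    rewrite sev_mul in HE by (now apply expd_summable). fold w in HE. rewrite <- Ew.
    apply Rmult_eq_reg_l with w; [|lra]. rewrite HE. field. lra. }
  assert (HDn : forall n, D n - / ev (theta q) = - tails G n).
  { intros n. rewrite tailsE, <- geom_mul, EvG. unfold G.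
    replace (geom * (omu * D))%ser with ((omu * geom) * D)%ser by ring. rewrite omu_geom, cst_mul. ring. }
  destruct HGe as (r & Hr & N & HN). exists r, N. split; [assumption|]. split; [now apply l1_pos in HN|].
  intros n. rewrite HDn, Rabs_Ropp. now apply expd_tails_bound.
Qed.

(** * Wiener-Hopf factorisation *)

(** The outer index is the exponent of z, the time; the inner series is in u and records the
    altitude. *)
Definition bser := nat -> ser.
Definition badd : bser -> bser -> bser := gadd sadd.
Definition bsub : bser -> bser -> bser := gsub ssub.
Definition bopp : bser -> bser := gopp sopp.
Definition bmul : bser -> bser -> bser := gmul sadd smul.
Definition bcst : ser -> bser := gconst (cst 0).
Definition ssum : (nat -> ser) -> nat -> ser := gsum sadd.

Lemma bser_ring : ring_theory (bcst (cst 0)) (bcst (cst 1)) badd bmul bsub bopp (@eq bser).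
Proof. exact (gps_ring _ _ _ _ _ _ ser_ring). Qed.
Add Ring bser_ring_inst : bser_ring.

Lemma bmulE X Y n : bmul X Y n = ssum (fun k => (X k * Y (n - k)%nat)%ser) n.
Proof. reflexivity. Qed.

Lemma ssum_ext f g n : (forall k, (k <= n)%nat -> f k = g k) -> ssum f n = ssum g n.
Proof. exact (gsum_ext _ f g n). Qed.

Lemma ssum_add f g n : ssum (fun k => (f k + g k)%ser) n = (ssum f n + ssum g n)%ser.
Proof. exact (gsum_add _ _ _ _ _ _ ser_ring f g n). Qed.

Lemma ssum_mul_l c f n : ssum (fun k => (c * f k)%ser) n = (c * ssum f n)%ser.
Proof. exact (gsum_mul_l _ _ _ _ _ _ ser_ring c f n). Qed.

Lemma ssum_zero f n : (forall k, (k <= n)%nat -> f k = cst 0) -> ssum f n = cst 0.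
Proof. exact (gsum_zero _ _ _ _ _ _ ser_ring f n). Qed.

Lemma ssum_single f n i :
  (i <= n)%nat -> (forall k, (k <= n)%nat -> k <> i -> f k = cst 0) -> ssum f n = f i.
Proof. exact (gsum_single _ _ _ _ _ _ ser_ring f n i). Qed.

Lemma ssum_coef f n j : ssum f n j = sum_f_R0 (fun k => f k j) n.
Proof. induction n as [|n IH]; [reflexivity|]. cbn [ssum gsum sum_f_R0]. rewrite <- IH. reflexivity. Qed.

Definition dz (X : bser) : bser := fun n => (cst (INR n) * X n)%ser.

Lemma dz_mul X Y : dz (bmul X Y) = badd (bmul (dz X) Y) (bmul X (dz Y)).
Proof.
  apply functional_extensionality; intros n. unfold dz at 1. unfold badd, gadd.
  rewrite !bmulE, <- ssum_mul_l, <- ssum_add. apply ssum_ext; intros k Hk. unfold dz.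
  replace (INR n) with (INR k + INR (n - k)) by (rewrite minus_INR by assumption; ring).
  rewrite cst_add. ring.
Qed.

Lemma dz_sub X Y : dz (bsub X Y) = bsub (dz X) (dz Y).
Proof. apply functional_extensionality; intros n. unfold dz, bsub, gsub. ring. Qed.

Lemma dz_bcst x : dz (bcst x) = bcst (cst 0).
Proof.
  apply functional_extensionality; intros [|n]; unfold dz; simpl bcst; cbn [bcst gconst].
  - simpl INR. ring.
  - ring.
Qed.

Definition zvar : bser := fun n => match n with 1%nat => cst 1 | _ => cst 0 end.

Lemma dz_zvar : dz zvar = zvar.
Proof.
  apply functional_extensionality; intros [|[|n]]; unfold dz, zvar; [ring| |ring].
  simpl INR. ring.
Qed.

Lemma zvar_mul_0 X : bmul zvar X O = cst 0.
Proof. rewrite bmulE. simpl. unfold zvar. ring. Qed.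

Lemma zvar_mul_S X n : bmul zvar X (S n) = X n.
Proof.
  rewrite bmulE, (ssum_single _ (S n) 1); [|lia|].
  - unfold zvar. replace (S n - 1)%nat with n by lia. ring.
  - intros [|[|k]] _ Hk; unfold zvar; [ring|congruence|ring].
Qed.

Lemma bcst_mul x X n : bmul (bcst x) X n = (x * X n)%ser.
Proof. exact (gconst_mul _ _ _ _ _ _ ser_ring x X n). Qed.

Definition btheta (X : bser) : bser := fun n => theta (X n).

Lemma theta_ssum f n : theta (ssum f n) = ssum (fun k => theta (f k)) n.
Proof. induction n as [|n IH]; [reflexivity|]. cbn [ssum gsum] in *. now rewrite theta_add, IH. Qed.

Lemma btheta_mul X Y : btheta (bmul X Y) = badd (bmul (btheta X) Y) (bmul X (btheta Y)).
Proof.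
  apply functional_extensionality; intros n. unfold btheta at 1, badd, gadd.
  rewrite !bmulE, theta_ssum, <- ssum_add. apply ssum_ext; intros k Hk. unfold btheta. apply theta_mul.
Qed.

Lemma btheta_dz X : btheta (dz X) = dz (btheta X).
Proof. apply functional_extensionality; intros n. unfold btheta, dz. apply theta_cst_mul. Qed.

Lemma bsub_zero (X Y : bser) : bsub X Y = bcst (cst 0) -> X = Y.
Proof.
  intros H. transitivity (badd (bsub X Y) Y); [ring|]. rewrite H. ring.
Qed.

Lemma dz_linear_zero (Y X : bser) : Y O = cst 0 -> X O = cst 0 -> dz X = bmul Y X -> X = bcst (cst 0).
Proof.
  intros HY HX H. apply functional_extensionality. intros n. induction n as [n IH] using lt_wf_ind.
  destruct n as [|n]; [assumption|].
  assert (E : dz X (S n) = cst 0).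
  { rewrite H, bmulE. apply ssum_zero. intros [|k] Hk; [rewrite HY; ring|].
    rewrite IH by lia. destruct (S n - S k)%nat; cbn [bcst gconst]; ring. }
  unfold dz in E. cbn [bcst gconst].
  transitivity (cst (/ INR (S n)) * (cst (INR (S n)) * X (S n)))%ser.
  - transitivity ((cst (/ INR (S n)) * cst (INR (S n))) * X (S n))%ser; [|ring].
    rewrite <- cst_mul_cst, Rinv_l by (apply not_0_INR; lia). ring.
  - rewrite E. ring.
Qed.

(* coefficients of z^n of degree < c n in u, apart from the constant 1 *)
Definition low_degree (c : nat) (X : bser) :=
  forall n j, (c * n <= j)%nat -> (n <> O \/ j <> O) -> X n j = 0.

Lemma low_degree_mul c X Y : low_degree c X -> low_degree c Y -> low_degree c (bmul X Y).
Proof.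
  intros HX HY n j Hj H0. rewrite bmulE, ssum_coef. apply sum_eq_R0. intros i Hi.
  rewrite smulE. apply sum_eq_R0. intros a Ha.
  destruct (Nat.le_gt_cases (c * i) a) as [H1|H1].
  - destruct (Nat.eq_dec i 0) as [Ei|Ei]; [destruct (Nat.eq_dec a 0) as [Ea|Ea]|].
    + rewrite (HY (n - i)%nat (j - a)%nat); [ring|subst; rewrite !Nat.sub_0_r; lia|subst; rewrite !Nat.sub_0_r; lia].
    + rewrite HX; [ring|assumption|now right].
    + rewrite HX; [ring|assumption|now left].
  - rewrite (HY (n - i)%nat (j - a)%nat); [ring| |].
    + rewrite Nat.mul_sub_distr_l. lia.
    + right. assert (c * i <= c * n)%nat by (apply Nat.mul_le_mono_l; lia). lia.
Qed.

Definition drop (m : nat) (a : ser) : ser := fun j => a (j + m)%nat.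

Lemma var_spow_drop m a j : (var ^ m * drop m a)%ser j = if (m <=? j)%nat then a j else 0.
Proof.
  rewrite var_spow_mul. destruct (Nat.leb_spec m j); [|reflexivity]. unfold drop. f_equal. lia.
Qed.

Lemma var_spow_cancel m a b : (var ^ m * a = var ^ m * b)%ser -> a = b.
Proof.
  intros H. apply functional_extensionality. intros j.
  assert (E : (var ^ m * a)%ser (j + m)%nat = (var ^ m * b)%ser (j + m)%nat) by now rewrite H.
  rewrite !var_spow_mul in E. replace (m <=? j + m)%nat with true in E by (symmetry; apply Nat.leb_le; lia).
  now replace (j + m - m)%nat with j in E by lia.
Qed.

Section Spitzer.
Context (c : nat) (P : ser) (mu nu : bser).
Context (mu_0 : mu O = cst 1).
Context (mu_S : forall n, (P * mu n = var ^ c * mu (S n) + nu n)%ser).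
Context (nu_low : forall n j, (c <= j)%nat -> nu n j = 0).

(** Coefficient j at time n is [u^(cn+j)] P^n, the weight of unconstrained paths of length n that
    end at altitude j >= 0. *)
Definition spitzer_lambda : bser := fun n => match n with O => cst 0 | _ => drop (c * n) (P ^ n)%ser end.

(* With M = (1 - zP)^(-1) H, H = 1 + (negative part): both dM - Lambda M and dH + Gamma H
   (Lambda + Gamma = zP / (1 - zP) split into its nonnegative and negative parts) are related by the
   factor 1 - zP, and they have disjoint supports. *)
Lemma spitzer : dz mu = bmul spitzer_lambda mu.
Proof.
  (* The factor u^(cn) at time n puts [mu] on the same shifted scale as P^n, where a nonnegative
     altitude means a degree at least c n. *)
  set (M := (fun n => (var ^ (c * n) * mu n)%ser) : bser).
  set (La := (fun n => (var ^ (c * n) * spitzer_lambda n)%ser) : bser).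
  set (R := (fun n => match n with O => cst 0 | _ => (P ^ n)%ser end) : bser).
  set (Ga := bsub R La).
  set (zP := bmul zvar (bcst P)).
  set (H := bsub M (bmul zP M)).
  assert (zP_S : forall X n, bmul zP X (S n) = (P * X n)%ser).
  { intros X n. replace (bmul zP X) with (bmul zvar (bmul (bcst P) X)) by (unfold zP; ring).
    rewrite zvar_mul_S. apply bcst_mul. }
  assert (zP_0 : forall X, bmul zP X O = cst 0).
  { intros X. replace (bmul zP X) with (bmul zvar (bmul (bcst P) X)) by (unfold zP; ring). apply zvar_mul_0. }
  assert (ER : R = badd zP (bmul zP R)).
  { apply functional_extensionality. intros [|n].
    - unfold badd, gadd. rewrite zP_0. replace zP with (bmul zP (bcst (cst 1))) by ring.
      rewrite zP_0. simpl. ring.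
    - unfold badd, gadd. rewrite zP_S. replace zP with (bmul zP (bcst (cst 1))) by ring.
      rewrite zP_S. destruct n as [|n]; cbn [R bcst gconst spow]; ring. }
  set (A := bsub (dz M) (bmul La M)).
  set (B := badd (dz H) (bmul Ga H)).
  assert (EB : B = bsub A (bmul zP A)).
  { assert (Ed : dz zP = zP).
    { unfold zP. rewrite dz_mul, dz_zvar, dz_bcst. ring. }
    unfold B, H, A, Ga. rewrite dz_sub, dz_mul, Ed.
    assert (E1 : bmul (bsub R La) (bsub M (bmul zP M)) =
       bsub (bmul (bsub R (bmul zP R)) M) (bsub (bmul La M) (bmul zP (bmul La M)))) by ring.
    rewrite E1. replace (bsub R (bmul zP R)) with zP by (rewrite ER at 1; ring). ring. }
  assert (LB : low_degree c B).
  { assert (LH : low_degree c H).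
    { intros n j Hj H0. unfold H, bsub, gsub. destruct n as [|n].
      - rewrite zP_0. unfold M. rewrite mu_0, Nat.mul_0_r. simpl spow.
        replace (cst 1 * cst 1 - cst 0)%ser with (cst 1) by ring.
        destruct j; [destruct H0; congruence|reflexivity].
      - rewrite zP_S. unfold M. replace (c * S n)%nat with (c * n + c)%nat in * by lia. rewrite spow_add.
        replace (var ^ (c * n) * var ^ c * mu (S n) - P * (var ^ (c * n) * mu n))%ser
          with (var ^ (c * n) * (var ^ c * mu (S n)) - var ^ (c * n) * (P * mu n))%ser by ring.
        rewrite mu_S.
        replace (var ^ (c * n) * (var ^ c * mu (S n)) - var ^ (c * n) * (var ^ c * mu (S n) + nu n))%ser
          with (- (var ^ (c * n) * nu n))%ser by ring.
        rewrite soppE, var_spow_mul. destruct (c * n <=? j)%nat; [|ring]. rewrite nu_low by lia. ring. }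
    assert (LG : low_degree c Ga).
    { intros n j Hj H0. unfold Ga, bsub, gsub. rewrite ssubE. unfold La, R, spitzer_lambda.
      destruct n as [|n].
      - replace (var ^ (c * 0) * cst 0)%ser with (cst 0) by ring. ring.
      - rewrite var_spow_drop. replace (c * S n <=? j)%nat with true by (symmetry; now apply Nat.leb_le). ring. }
    pose proof (low_degree_mul c Ga H LG LH) as LGH.
    intros n j Hj H0. unfold B, badd, gadd. rewrite saddE. unfold dz.
    rewrite cst_mul, (LH n j Hj H0), (LGH n j Hj H0). ring. }
  assert (EA : forall n, A n = (var ^ (c * n) * (dz mu n - bmul spitzer_lambda mu n))%ser).
  { intros n. unfold A, bsub, gsub. unfold dz at 1. unfold M at 1.
    replace (bmul La M n) with (var ^ (c * n) * bmul spitzer_lambda mu n)%ser.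
    - unfold dz. ring.
    - rewrite !bmulE, <- ssum_mul_l. apply ssum_ext. intros k Hk. unfold La, M.
      replace (c * n)%nat with (c * k + c * (n - k))%nat by nia. rewrite spow_add. ring. }
  (* If [A] vanishes at time n, then [A] and [B] agree at time n + 1. There [B] lives in degrees
     below c (n+1) and [A] in the others, so both vanish. *)
  assert (A0 : forall n, A n = cst 0).
  { induction n as [|n IH].
    - rewrite EA. rewrite bmulE. simpl ssum. unfold dz, spitzer_lambda. simpl INR. cbn [ssum gsum]. ring.
    - assert (EBn : B (S n) = A (S n)).
      { rewrite EB. unfold bsub, gsub. rewrite zP_S, IH. ring. }
      apply functional_extensionality. intros j. change (cst 0 (S j)) with 0.
      destruct (Nat.le_gt_cases (c * S n) j) as [Hj|Hj].
      + rewrite <- EBn, LB by (assumption || now left). destruct j; reflexivity.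
      + rewrite EA, var_spow_mul. replace (c * S n <=? j)%nat with false by (symmetry; now apply Nat.leb_gt).
        destruct j; reflexivity. }
  apply functional_extensionality. intros n.
  assert (E : (dz mu n - bmul spitzer_lambda mu n)%ser = cst 0).
  { apply (var_spow_cancel (c * n)). rewrite <- EA, A0. ring. }
  transitivity (dz mu n - bmul spitzer_lambda mu n + bmul spitzer_lambda mu n)%ser; [ring|].
  rewrite E. ring.
Qed.

Definition spitzer_log : bser :=
  fun n => match n with O => cst 0 | _ => (cst (/ INR n) * spitzer_lambda n)%ser end.

Lemma dz_spitzer_log : dz spitzer_log = spitzer_lambda.
Proof.
  apply functional_extensionality. intros [|n]; unfold dz, spitzer_log, spitzer_lambda; [ring|].
  set (x := drop _ _). transitivity ((cst (/ INR (S n)) * cst (INR (S n))) * x)%ser; [ring|].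
  rewrite <- cst_mul_cst, Rinv_l by (apply not_0_INR; lia). ring.
Qed.

(** [mu] is the exponential of [spitzer_log], so its u-derivative obeys the same rule as its
    z-derivative. No bivariate exponential is built: the difference of the two sides solves a linear
    equation in z with initial value zero. The recursion on altitudes comes from this
    u-derivative. *)
Lemma spitzer_theta : btheta mu = bmul (btheta spitzer_log) mu.
Proof.
  apply bsub_zero. pose proof spitzer as HS. rewrite <- dz_spitzer_log in HS.
  apply (dz_linear_zero (dz spitzer_log)).
  - rewrite dz_spitzer_log. reflexivity.
  - unfold bsub, gsub. rewrite bmulE. cbn [ssum gsum]. unfold btheta. rewrite mu_0, theta_cst.
    unfold spitzer_log. rewrite theta_cst. ring.
  - assert (E : btheta (dz mu) = btheta (bmul (dz spitzer_log) mu)) by now rewrite HS.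
    rewrite btheta_dz, btheta_mul, btheta_dz in E.
    rewrite dz_sub, dz_mul, E, HS. ring.
Qed.

Definition mu_at (j : nat) : ser := fun n => mu n j.
Definition log_at (j : nat) : ser := fun n => spitzer_log n j.

Lemma mu_at_0_ode : theta (mu_at 0) = (theta (log_at 0) * mu_at 0)%ser.
Proof.
  apply functional_extensionality. intros n.
  assert (E : dz mu n O = bmul (dz spitzer_log) mu n O) by (rewrite dz_spitzer_log; now rewrite spitzer).
  unfold dz at 1 in E. rewrite cst_mul, bmulE, ssum_coef in E.
  unfold theta at 1, mu_at at 1. rewrite E, smulE. apply sum_eq. intros k Hk.
  rewrite smul_0. unfold dz. rewrite cst_mul. reflexivity.
Qed.

Lemma mu_at_rec j n :
  INR j * mu_at j n = sum_f_R0 (fun a => (cst (INR a) * log_at a * mu_at (j - a))%ser n) j.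
Proof.
  assert (E : btheta mu n j = bmul (btheta spitzer_log) mu n j) by now rewrite spitzer_theta.
  unfold btheta at 1, theta at 1 in E. unfold mu_at at 1. rewrite E, bmulE, ssum_coef.
  transitivity (sum_f_R0 (fun k => sum_f_R0 (fun a => INR a * spitzer_log k a * mu (n - k)%nat (j - a)%nat) j) n).
  - apply sum_eq. intros k Hk. reflexivity.
  - rewrite sum_swap. apply sum_eq. intros a Ha.
    replace (cst (INR a) * log_at a * mu_at (j - a))%ser with (cst (INR a) * (log_at a * mu_at (j - a)))%ser by ring.
    rewrite cst_mul, smulE, <- sum_mul_l. apply sum_eq. intros k Hk. unfold log_at, mu_at. ring.
Qed.

(** Altitude 0 is the exponential of a series in [W]; by [mu_at_rec], where the term a = 0 carries
    the factor 0, every other altitude is a combination of products with lower ones. *)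
Lemma W_mu_at K : (2 <= K)%nat -> (forall j, W K (log_at j)) -> forall j, W K (mu_at j).
Proof.
  intros HK HL j. induction j as [j IH] using lt_wf_ind. destruct j as [|j].
  - apply W_ode with (log_at 0); auto.
    + unfold mu_at. now rewrite mu_0.
    + apply mu_at_0_ode.
  - assert (E : mu_at (S j) = (cst (/ INR (S j)) *
        (fun n => sum_f_R0 (fun a => (cst (INR (S a)) * log_at (S a) * mu_at (j - a))%ser n) j))%ser).
    { apply functional_extensionality. intros n. rewrite cst_mul.
      apply Rmult_eq_reg_l with (INR (S j)); [|apply not_0_INR; lia].
      rewrite mu_at_rec, <- Rmult_assoc, Rinv_r, Rmult_1_l by (apply not_0_INR; lia).
      rewrite decomp_sum by lia. cbn [pred].
      replace ((cst (INR 0) * log_at 0 * mu_at (S j - 0))%ser n) with 0.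
      - rewrite Rplus_0_l. apply sum_eq. intros; reflexivity.
      - replace (cst (INR 0) * log_at 0 * mu_at (S j - 0))%ser with (cst (INR 0) * (log_at 0 * mu_at (S j - 0)))%ser by ring.
        rewrite cst_mul. simpl. ring. }
    rewrite E. apply W_mul; [assumption|apply W_cst|].
    assert (Hs : forall m, (m <= j)%nat -> W K (fun n => sum_f_R0 (fun a => (cst (INR (S a)) * log_at (S a) * mu_at (j - a))%ser n) m)).
    { induction m as [|m IHm]; intros Hm.
      - apply (W_mul K (cst (INR 1) * log_at 1)%ser (mu_at (j - 0))); [assumption| |apply IH; lia].
        apply W_mul; auto using W_cst.
      - apply (W_add K (fun n => sum_f_R0 (fun a => (cst (INR (S a)) * log_at (S a) * mu_at (j - a))%ser n) m)
           (cst (INR (S (S m))) * log_at (S (S m)) * mu_at (j - S m))%ser); [apply IHm; lia|].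
        apply W_mul; [assumption| |apply IH; lia]. apply W_mul; auto using W_cst. }
    now apply Hs.
Qed.

Definition mu_value (v : R) : ser := fun n => ev (scale v (mu n)).
Definition log_value (v : R) : ser := fun n => ev (scale v (spitzer_log n)).

Lemma ev_scale_ssum v (f : nat -> ser) n : (forall k, summable (scale v (f k))) ->
  summable (scale v (ssum f n)) /\ ev (scale v (ssum f n)) = sum_f_R0 (fun k => ev (scale v (f k))) n.
Proof.
  intros H. induction n as [|n [IH1 IH2]]; [split; [apply H|reflexivity]|].
  cbn [ssum gsum sum_f_R0] in *. fold (ssum f n) in *. rewrite scale_add. split.
  - now apply summable_add.
  - rewrite sev_add, IH2; auto.
Qed.

(** Spitzer's identity evaluated at u = v is an ordinary differential equation in z, to which
    [W_ode] applies. *)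
Lemma W_mu_value K v : (2 <= K)%nat ->
  (forall n, summable (scale v (mu n))) -> (forall n, summable (scale v (spitzer_log n))) ->
  W K (log_value v) -> W K (mu_value v).
Proof.
  intros HK Hmu Hlog HW. apply W_ode with (log_value v); auto.
  - unfold log_value, spitzer_log. rewrite scale_cst. apply ev_cst.
  - unfold mu_value. rewrite mu_0, scale_cst. apply ev_cst.
  - apply functional_extensionality. intros n.
    assert (E : ev (scale v (dz mu n)) = ev (scale v (bmul (dz spitzer_log) mu n)))
      by (rewrite dz_spitzer_log; now rewrite spitzer).
    assert (Hd : forall k, ev (scale v (dz mu k)) = theta (mu_value v) k).
    { intros k. unfold dz. rewrite scale_mul, scale_cst, sev_cst_mul by apply Hmu. reflexivity. }
    assert (Hl : forall k, ev (scale v (dz spitzer_log k)) = theta (log_value v) k).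
    { intros k. unfold dz. rewrite scale_mul, scale_cst, sev_cst_mul by apply Hlog. reflexivity. }
    assert (Hls : forall k, summable (scale v (dz spitzer_log k))).
    { intros k. unfold dz. rewrite scale_mul, scale_cst. apply summable_mul; [apply summable_cst|apply Hlog]. }
    rewrite <- Hd, E, bmulE.
    destruct (ev_scale_ssum v (fun k => (dz spitzer_log k * mu (n - k)%nat)%ser) n) as [_ ->].
    + intros k. rewrite scale_mul. apply summable_mul; auto.
    + rewrite smulE. apply sum_eq. intros k Hk. rewrite scale_mul, sev_mul, Hl by auto. reflexivity.
Qed.

End Spitzer.

(** * Meanders of a normalised walk *)

(* [P] is the step law shifted by [c]; [mu n] is the law at time [n] of the walk killed when it
   becomes negative, and [nu n] is the mass killed at the next step, at position [j - c]. *)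
Record walk (c d : nat) (P : ser) (mu nu : bser) : Prop := {
  wk_c : (1 <= c)%nat;
  wk_d : (1 <= d)%nat;
  wk_pos : forall k, 0 <= P k;
  wk_fin : forall k, (c + d < k)%nat -> P k = 0;
  wk_mass : ev P = 1;
  wk_down : 0 < P O;
  wk_up : 0 < P (c + d)%nat;
  wk_0 : mu O = cst 1;
  wk_S : forall n, (P * mu n = var ^ c * mu (S n) + nu n)%ser;
  wk_low : forall n j, (c <= j)%nat -> nu n j = 0 }.

Lemma smul_pos (a b : ser) n : (forall k, 0 <= a k) -> (forall k, 0 <= b k) -> 0 <= (a * b)%ser n.
Proof.
  intros Ha Hb. rewrite smulE. apply cond_pos_sum. intros k. now apply Rmult_le_pos.
Qed.

Lemma smul_term_le (a b : ser) i j : (forall k, 0 <= a k) -> (forall k, 0 <= b k) ->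
  a i * b j <= (a * b)%ser (i + j)%nat.
Proof.
  intros Ha Hb. rewrite smulE.
  assert (H : forall n, (i <= n)%nat -> a i * b (n - i)%nat <= sum_f_R0 (fun k => a k * b (n - k)%nat) n).
  { intros n Hn. 
    apply Rle_trans with (sum_f_R0 (fun k => a k * b (n - k)%nat) i).
    - destruct i as [|i]; [simpl; lra|]. cbn [sum_f_R0].
      pose proof (cond_pos_sum (fun k => a k * b (n - k)%nat) i (fun k => Rmult_le_pos _ _ (Ha k) (Hb _))). lra.
    - apply sum_pos_mono; [|assumption]. intros k. now apply Rmult_le_pos. }
  specialize (H (i + j)%nat ltac:(lia)). now replace (i + j - i)%nat with j in H by lia.
Qed.

Lemma ev_nonneg (a : ser) : summable a -> (forall k, 0 <= a k) -> 0 <= ev a.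
Proof.
  intros [N HN] Ha. apply Rle_trans with (sum_f_R0 a 0); [apply Ha|].
  apply series_partial_le; [assumption|]. eapply ev_is_series; eauto.
Qed.

Lemma ev_ge_partial (a : ser) n : summable a -> (forall k, 0 <= a k) -> sum_f_R0 a n <= ev a.
Proof. intros [N HN] Ha. apply series_partial_le; [assumption|]. eapply ev_is_series; eauto. Qed.

Lemma ev_mono (a b : ser) : summable a -> summable b -> (forall k, a k <= b k) -> ev a <= ev b.
Proof.
  intros Ha Hb H. assert (0 <= ev (b - a)); [|rewrite sev_sub in H0 by assumption; lra].
  apply ev_nonneg; [now apply summable_sub|]. intros k. rewrite ssubE. specialize (H k). lra.
Qed.

Lemma coef_le_partial_sum (a : ser) n : (forall k, 0 <= a k) -> a n <= sum_f_R0 a n.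
Proof.
  intros Ha. destruct n as [|n]; simpl; [lra|]. pose proof (cond_pos_sum a n Ha). lra.
Qed.

Section Walk.
Context (c d : nat) (P : ser) (mu nu : bser) (H : walk c d P mu nu).

Lemma walk_step n j : mu (S n) j = (P * mu n)%ser (c + j)%nat.
Proof.
  rewrite (wk_S _ _ _ _ _ H), saddE, (wk_low _ _ _ _ _ H) by lia. rewrite var_spow_mul.
  replace (c <=? c + j)%nat with true by (symmetry; apply Nat.leb_le; lia).
  replace (c + j - c)%nat with j by lia. ring.
Qed.

Lemma walk_exit n j : (j < c)%nat -> nu n j = (P * mu n)%ser j.
Proof.
  intros Hj. rewrite (wk_S _ _ _ _ _ H), saddE, var_spow_mul.
  replace (c <=? j)%nat with false by (symmetry; now apply Nat.leb_gt). ring.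
Qed.

Lemma mu_pos n k : 0 <= mu n k.
Proof.
  revert k; induction n as [|n IH]; intros k.
  - rewrite (wk_0 _ _ _ _ _ H). destruct k; simpl; lra.
  - rewrite walk_step. apply smul_pos; [apply H|assumption].
Qed.

Lemma nu_pos n k : 0 <= nu n k.
Proof.
  destruct (Nat.lt_ge_cases k c).
  - rewrite walk_exit by assumption. apply smul_pos; [apply H|apply mu_pos].
  - rewrite (wk_low _ _ _ _ _ H) by assumption. lra.
Qed.

Lemma mu_fin n k : (d * n < k)%nat -> mu n k = 0.
Proof.
  revert k; induction n as [|n IH]; intros k Hk.
  - rewrite (wk_0 _ _ _ _ _ H). destruct k; [lia|reflexivity].
  - rewrite walk_step, smulE. apply sum_eq_R0. intros i Hi.
    destruct (Nat.le_gt_cases i (c + d)).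
    + rewrite IH by nia. ring.
    + rewrite (wk_fin _ _ _ _ _ H) by assumption. ring.
Qed.

Lemma mu_summable n : summable (mu n).
Proof. apply summable_finite with (d * n)%nat. apply mu_fin. Qed.

Lemma nu_summable n : summable (nu n).
Proof. apply summable_finite with c. intros k Hk. apply H; lia. Qed.

Lemma P_summable : summable P.
Proof. apply summable_finite with (c + d)%nat. apply H. Qed.

Lemma theta_summable (a : ser) m : (forall k, (m < k)%nat -> a k = 0) -> summable (theta a).
Proof.
  intros Ha. apply summable_finite with m. intros k Hk. unfold theta. rewrite Ha by assumption. ring.
Qed.

Definition alive n := ev (mu n).
Definition exits n := ev (nu n).
Definition moment n := ev (theta (mu n)).

Lemma alive_S n : alive (S n) = alive n - exits n.
Proof.
  assert (E : ev (P * mu n) = ev (var ^ c * mu (S n) + nu n)) by now rewrite (wk_S _ _ _ _ _ H).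
  rewrite sev_mul, (wk_mass _ _ _ _ _ H), sev_add, sev_mul, ev_var_spow in E;
    auto using P_summable, mu_summable, nu_summable, summable_mul, summable_spow, summable_var.
  unfold alive, exits. lra.
Qed.

Lemma alive_0 : alive 0 = 1.
Proof. unfold alive. rewrite (wk_0 _ _ _ _ _ H). apply ev_cst. Qed.

Lemma exits_nonneg n : 0 <= exits n.
Proof. apply ev_nonneg; [apply nu_summable|apply nu_pos]. Qed.

Lemma alive_nonneg n : 0 <= alive n.
Proof. apply ev_nonneg; [apply mu_summable|apply mu_pos]. Qed.

Lemma alive_le_1 n : alive n <= 1.
Proof.
  induction n as [|n IH]; [rewrite alive_0; lra|]. rewrite alive_S. pose proof (exits_nonneg n). lra.
Qed.

(** Here ev (theta P) - c is the drift and [y] the mean overshoot on exit: an exit lands at altitude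
    j - c with 0 <= j < c, hence between 1 and c below zero. *)
Lemma moment_S n : exists y, exits n <= y <= INR c * exits n /\
  moment (S n) = moment n + (ev (theta P) - INR c) * alive n + y.
Proof.
  exists (INR c * exits n - ev (theta (nu n))). split.
  - assert (Hle : ev (theta (nu n)) <= INR c * exits n - exits n).
    { unfold exits. rewrite <- sev_cst_mul, <- sev_sub by
        (try apply summable_mul; try apply summable_cst; apply nu_summable).
      apply ev_mono.
      - apply theta_summable with c. intros; apply H; lia.
      - apply summable_sub; [apply summable_mul; [apply summable_cst|apply nu_summable]|apply nu_summable].
      - intros k. rewrite ssubE, cst_mul. unfold theta. pose proof (nu_pos n k).
        destruct (Nat.lt_ge_cases k c) as [Hk|Hk].
        + apply le_INR in Hk. rewrite S_INR in Hk. nra.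
        + rewrite (wk_low _ _ _ _ _ H) by assumption. lra. }
    assert (0 <= ev (theta (nu n))).
    { apply ev_nonneg; [apply theta_summable with c; intros; apply H; lia|].
      intros k. apply Rmult_le_pos; [apply pos_INR|apply nu_pos]. }
    lra.
  - assert (Hs1 : summable (theta P)) by (apply theta_summable with (c + d)%nat; apply H).
    assert (Hs2 : forall m, summable (theta (mu m))) by (intros; apply theta_summable with (d * m)%nat; apply mu_fin).
    assert (Hs3 : summable (theta (nu n))) by (apply theta_summable with c; intros; apply H; lia).
    assert (E : ev (theta (P * mu n)) = ev (theta (var ^ c * mu (S n) + nu n))) by now rewrite (wk_S _ _ _ _ _ H).
    rewrite theta_add, !theta_mul, theta_var_spow in E.
    rewrite !sev_add, !sev_mul, ev_cst, ev_var_spow, (wk_mass _ _ _ _ _ H) in E;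
      auto using P_summable, mu_summable, summable_mul, summable_add, summable_spow, summable_var, summable_cst.
    pose proof (alive_S n) as Ea. unfold alive, exits, moment in *. nra.
Qed.

Lemma moment_0 : moment 0 = 0.
Proof. unfold moment. rewrite (wk_0 _ _ _ _ _ H), theta_cst. apply ev_cst. Qed.

Lemma moment_upper n : moment n <= INR (d * n) * alive n.
Proof.
  unfold moment, alive. rewrite <- sev_cst_mul by apply mu_summable. apply ev_mono.
  - apply theta_summable with (d * n)%nat. apply mu_fin.
  - apply summable_mul; [apply summable_cst|apply mu_summable].
  - intros k. rewrite cst_mul. unfold theta. destruct (Nat.le_gt_cases k (d * n)) as [Hk|Hk].
    + apply Rmult_le_compat_r; [apply mu_pos|]. now apply le_INR.
    + rewrite mu_fin by assumption. lra.
Qed.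

(* Wald: the stopped walk has nonnegative mean displacement. *)
Lemma alive_lower n : INR c <= ev (theta P) -> 1 <= (INR (d * n) + 1) * alive n.
Proof.
  intros Hm. assert (Hmom : 1 - alive n <= moment n).
  { induction n as [|n IH]; [rewrite alive_0, moment_0; lra|].
    destruct (moment_S n) as (y & Hy & ->). rewrite alive_S.
    pose proof (alive_nonneg n). assert (0 <= (ev (theta P) - INR c) * alive n) by (apply Rmult_le_pos; lra).
    lra. }
  pose proof (moment_upper n). lra.
Qed.

Lemma moment_bounded n : ev (theta P) = INR c -> moment n <= INR c.
Proof.
  intros Hm. assert (Hmom : moment n <= INR c * (1 - alive n)).
  { induction n as [|n IH]; [rewrite alive_0, moment_0; lra|].
    destruct (moment_S n) as (y & Hy & ->). rewrite alive_S, Hm. lra. }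
  pose proof (alive_nonneg n). pose proof (pos_INR c). nra.
Qed.

Lemma mu_up n s k : P (c + d)%nat ^ s * mu n k <= mu (s + n)%nat (d * s + k)%nat.
Proof.
  induction s as [|s IH].
  - rewrite Nat.mul_0_r. simpl. lra.
  - change (S s + n)%nat with (S (s + n)). rewrite walk_step.
    replace (c + (d * S s + k))%nat with (c + d + (d * s + k))%nat by lia.
    eapply Rle_trans; [|apply smul_term_le; [apply H|apply mu_pos]].
    simpl. rewrite Rmult_assoc. apply Rmult_le_compat_l; [apply H|exact IH].
Qed.

Lemma mu_down n s k : P O ^ s * mu n (c * s + k)%nat <= mu (s + n)%nat k.
Proof.
  revert k; induction s as [|s IH]; intros k.
  - rewrite Nat.mul_0_r. simpl. lra.
  - change (S s + n)%nat with (S (s + n)). rewrite walk_step.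
    specialize (IH (c + k)%nat). replace (c * s + (c + k))%nat with (c * S s + k)%nat in IH by lia.
    eapply Rle_trans; [|apply (smul_term_le P (mu (s + n)%nat) 0 (c + k)%nat); [apply H|apply mu_pos]].
    simpl. rewrite Rmult_assoc. apply Rmult_le_compat_l; [apply H|exact IH].
Qed.

(** From altitude k, the first k / c steps of size -c stay nonnegative and end below c; one more
    exits. *)
Lemma exits_lower n k : P O ^ S (k / c) * mu n k <= exits (k / c + n).
Proof.
  pose proof (wk_c _ _ _ _ _ H) as Hc.
  assert (Hk : k = (c * (k / c) + k mod c)%nat) by (apply Nat.div_mod; lia).
  pose proof (mu_down n (k / c) (k mod c)) as Hd. rewrite <- Hk in Hd.
  pose proof (Nat.mod_upper_bound k c ltac:(lia)) as Hm.
  apply Rle_trans with (nu (k / c + n)%nat (k mod c)).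
  - rewrite walk_exit by assumption.
    eapply Rle_trans; [|apply (smul_term_le P (mu (k / c + n)%nat) 0 (k mod c)); [apply H|apply mu_pos]].
    simpl pow. rewrite Rmult_assoc. apply Rmult_le_compat_l; [apply H|exact Hd].
  - eapply Rle_trans; [apply (coef_le_partial_sum (nu (k / c + n)%nat)); apply nu_pos|].
    apply ev_ge_partial; [apply nu_summable|apply nu_pos].
Qed.

(** Markov's inequality for the altitude. *)
Lemma alive_truncation n B : alive n <= sum_f_R0 (mu n) B + moment n / (INR B + 1).
Proof.
  assert (HB : 0 < INR B + 1) by (pose proof (pos_INR B); lra).
  set (low := (fun k => if (k <=? B)%nat then mu n k else 0) : ser).
  assert (Hlow : forall k, (B < k)%nat -> low k = 0).
  { intros k Hk. unfold low. now replace (k <=? B)%nat with false by (symmetry; now apply Nat.leb_gt). }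
  assert (El : ev low = sum_f_R0 (mu n) B).
  { rewrite (ev_finite _ B Hlow). apply sum_eq. intros k Hk. unfold low.
    now replace (k <=? B)%nat with true by (symmetry; now apply Nat.leb_le). }
  assert (Hs : summable (theta (mu n))) by (apply theta_summable with (d * n)%nat; apply mu_fin).
  unfold alive, moment, Rdiv. rewrite <- El, Rmult_comm, <- sev_cst_mul, <- sev_add.
  - apply ev_mono.
    + apply mu_summable.
    + apply summable_add; [now apply summable_finite with B|]. apply summable_mul; [apply summable_cst|assumption].
    + intros k. rewrite saddE, cst_mul. unfold theta, low. pose proof (mu_pos n k).
      assert (0 < / (INR B + 1)) by now apply Rinv_0_lt_compat.
      destruct (Nat.leb_spec k B) as [Hk|Hk].
      * pose proof (pos_INR k). assert (0 <= / (INR B + 1) * (INR k * mu n k)) by nonneg. lra.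
      * assert (1 <= / (INR B + 1) * INR k).
        { rewrite Rmult_comm. apply Rle_div_r; [assumption|]. apply le_INR in Hk. rewrite S_INR in Hk. lra. }
        rewrite <- Rmult_assoc. nra.
  - now apply summable_finite with B.
  - apply summable_mul; [apply summable_cst|assumption].
  - assumption.
Qed.

Lemma alive_limit : exists th, 0 <= th /\ is_lim_seq alive th /\ forall n, th <= alive n.
Proof.
  assert (Hd : forall n, alive (S n) <= alive n).
  { intros n. rewrite alive_S. pose proof (exits_nonneg n). lra. }
  destruct (ex_finite_lim_seq_decr alive 0 Hd alive_nonneg) as [th Hth]. exists th.
  split; [|split; [assumption|]].
  - apply (is_lim_seq_le (fun _ => 0) alive 0 th); [apply alive_nonneg|apply is_lim_seq_const|assumption].
  - intros n. apply (is_lim_seq_decr_compare alive th Hth Hd).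
Qed.

(* A positive survival probability would keep mass at bounded height (the mean is bounded),
   from which the walk exits with probability bounded below. *)
Lemma alive_lim_0 : ev (theta P) = INR c -> is_lim_seq exits 0 -> is_lim_seq alive 0.
Proof.
  intros Hm Hx. destruct alive_limit as (th & Hth0 & Hth & Hle).
  destruct (Req_dec th 0) as [->|Hne]; [assumption|exfalso].
  assert (Hpos : 0 < th) by lra.
  (* Since the moment is at most c, this height makes the Markov term at most th / 2, so mass at
     least th / 2 stays below it. *)
  destruct (INR_unbounded (2 * INR c / th)) as [B HB].
  assert (Hmu : forall k, is_lim_seq (fun n => mu n k) 0).
  { intros k. assert (HP : 0 < P O ^ S (k / c)) by apply pow_lt, H.
    apply is_lim_seq_le_le with (fun _ => 0) (fun n => / P O ^ S (k / c) * exits (n + k / c)).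
    - intros n. split; [apply mu_pos|]. apply Rmult_le_reg_l with (P O ^ S (k / c)); [assumption|].
      rewrite <- Rmult_assoc, Rinv_r, Rmult_1_l by lra. rewrite Nat.add_comm. apply exits_lower.
    - apply is_lim_seq_const.
    - replace (Finite 0) with (Rbar_mult (/ P O ^ S (k / c)) 0) by (simpl; f_equal; ring).
      apply is_lim_seq_scal_l. now apply (is_lim_seq_incr_n exits). }
  assert (Hsum : is_lim_seq (fun n => sum_f_R0 (mu n) B) (sum_f_R0 (fun _ => 0) B)).
  { apply (is_lim_seq_sum (fun k n => mu n k) (fun _ => 0)). intros; apply Hmu. }
  rewrite sum_eq_R0 in Hsum by reflexivity.
  assert (Hc : INR c / (INR B + 1) <= th / 2).
  { pose proof (pos_INR B). pose proof (pos_INR c). apply Rle_div_l; [lra|].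
    apply Rlt_div_l in HB; [|assumption]. nra. }
  assert (Hge : th / 2 <= 0).
  { apply (is_lim_seq_le (fun _ => th / 2) (fun n => sum_f_R0 (mu n) B) (th / 2) 0); [|apply is_lim_seq_const|assumption].
    intros n. pose proof (alive_truncation n B). pose proof (moment_bounded n Hm). specialize (Hle n).
    assert (moment n / (INR B + 1) <= INR c / (INR B + 1)).
    { apply Rmult_le_compat_r; [left; apply Rinv_0_lt_compat; pose proof (pos_INR B); lra|assumption]. }
    lra. }
  lra.
Qed.

(** Survival tends to 0, so exits of order n^(-5/2) would make the survival probability, which is
    the sum of later exits, of order n^(-3/2). By [alive_lower] it is at least of order 1 / n. *)
Lemma exits_not_small C : ev (theta P) = INR c ->
  ~ (forall n, exits n <= C * (h n * wt n ^ 2)).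
Proof.
  intros Hm Hx.
  assert (HC : 0 <= C).
  { pose proof (exits_nonneg 0). specialize (Hx O). pose proof (h_wt_pos 0 2). nra. }
  assert (Hw0 : is_lim_seq wt 0).
  { apply is_lim_seq_ext with (fun n => / INR (S n)); [intros; unfold wt; now rewrite S_INR|].
    apply (is_lim_seq_incr_1 (fun n => / INR n)).
    replace (Finite 0) with (Rbar_inv p_infty) by reflexivity.
    apply is_lim_seq_inv; [apply is_lim_seq_INR|discriminate]. }
  assert (Hlim : is_lim_seq exits 0).
  { apply is_lim_seq_le_le with (fun _ => 0) (fun n => C * wt n); [|apply is_lim_seq_const|].
    - intros n. split; [apply exits_nonneg|]. eapply Rle_trans; [apply Hx|].
      apply Rmult_le_compat_l; [assumption|]. pose proof (h_decr 0 n ltac:(lia)) as Hh. change (h 0) with 1 in Hh.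
      pose proof (wt_pos n). pose proof (wt_le_1 n). pose proof (h_pos n).
      rewrite <- (Rmult_1_l (wt n)) at 2. apply Rmult_le_compat; try lra; [apply pow2_ge_0|]. simpl. nra.
    - replace (Finite 0) with (Rbar_mult C 0) by (simpl; f_equal; ring). now apply is_lim_seq_scal_l. }
  pose proof (alive_lim_0 Hm Hlim) as Hal.
  (* [h] decreases and is taken out at its first value; the squares of [wt] telescope. *)
  assert (Hd : forall n m, alive n - alive (n + m)%nat <= C * h n * (wt n ^ 2 + wt n)).
  { intros n m.
    apply Rle_trans with (C * h n * (wt n ^ 2 + match m with O => 0 | S m' => wt n - wt (n + m')%nat end)).
    2:{ apply Rmult_le_compat_l; [pose proof (h_pos n); nra|]. pose proof (wt_pos n).
        destruct m as [|m]; [lra|]. pose proof (wt_pos (n + m)). lra. }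
    assert (Hch : 0 <= C * h n) by (pose proof (h_pos n); nra).
    induction m as [|m IH].
    - rewrite Nat.add_0_r. pose proof (wt_pow_pos n 2). nra.
    - rewrite <- plus_n_Sm, alive_S.
      assert (Hxm : exits (n + m) <= C * h n * wt (n + m) ^ 2).
      { eapply Rle_trans; [apply Hx|]. rewrite <- Rmult_assoc. apply Rmult_le_compat_r; [left; apply wt_pow_pos|].
        apply Rmult_le_compat_l; [assumption|]. apply h_decr; lia. }
      destruct m as [|m].
      + rewrite Nat.add_0_r in *. lra.
      + pose proof (wt_sq_tail (n + m) 0) as Ht. cbn [sum_f_R0] in Ht. rewrite Nat.add_0_r in Ht.
        replace (n + S m)%nat with (S (n + m)) in * by lia.
        assert (C * h n * wt (S (n + m)) ^ 2 <= C * h n * (wt (n + m) - wt (S (n + m)))) by (apply Rmult_le_compat_l; lra).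
        lra. }
  assert (Hal2 : forall n, alive n <= 2 * C * h n * wt n).
  { intros n. assert (Hl : alive n - 0 <= C * h n * (wt n ^ 2 + wt n)).
    { apply (is_lim_seq_le (fun m => alive n - alive (n + m)%nat) (fun _ => C * h n * (wt n ^ 2 + wt n))
        (alive n - 0) (C * h n * (wt n ^ 2 + wt n))); [apply Hd| |apply is_lim_seq_const].
      apply is_lim_seq_minus'; [apply is_lim_seq_const|].
      apply (is_lim_seq_incr_n alive n) in Hal. eapply is_lim_seq_ext; [|exact Hal].
      intros m. simpl. now rewrite Nat.add_comm. }
    pose proof (wt_pos n). pose proof (wt_le_1 n). pose proof (h_pos n).
    assert (0 <= C * h n) by nra. assert (wt n ^ 2 <= wt n) by (simpl; nra). nra. }
  pose proof (wk_d _ _ _ _ _ H) as Hd1. apply le_INR in Hd1. simpl in Hd1.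
  assert (Hh : forall n, 1 <= INR d * (2 * C * h n)).
  { intros n. pose proof (alive_lower n ltac:(lra)) as Hl. rewrite mult_INR in Hl.
    pose proof (pos_INR n). pose proof (alive_nonneg n). specialize (Hal2 n).
    assert ((INR d * INR n + 1) * alive n <= INR d * (INR n + 1) * (2 * C * h n * wt n)).
    { apply Rmult_le_compat; nra. }
    replace (INR d * (INR n + 1) * (2 * C * h n * wt n)) with (INR d * (2 * C * h n) * (wt n * (INR n + 1))) in H2 by ring.
    rewrite wt_mul in H2. lra. }
  assert (Hh2 : forall n, 1 <= (INR d * (2 * C)) ^ 2 * wt n).
  { intros n. specialize (Hh n). pose proof (h_sq_le_wt n). pose proof (h_pos n).
    apply Rle_trans with ((INR d * (2 * C)) ^ 2 * h n ^ 2).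
    - rewrite <- Rpow_mult_distr. replace (INR d * (2 * C) * h n) with (INR d * (2 * C * h n)) by ring. nra.
    - apply Rmult_le_compat_l; [apply pow2_ge_0|assumption]. }
  assert (1 <= (INR d * (2 * C)) ^ 2 * 0); [|lra].
  apply (is_lim_seq_le (fun _ => 1) (fun n => (INR d * (2 * C)) ^ 2 * wt n) 1 ((INR d * (2 * C)) ^ 2 * 0));
    [assumption|apply is_lim_seq_const|]. now apply (is_lim_seq_scal_l wt _ 0).
Qed.

End Walk.

(** * Meander counts as a walk *)

(** Convertible with the folds inside [zsum] and [meander_count], which [change] rewrites into this
    form. *)
Definition lsum {T : Type} (f : T -> R) (l : list T) : R := fold_right Rplus 0 (map f l).

Lemma lsum_app {T} (f : T -> R) l l' : lsum f (l ++ l') = lsum f l + lsum f l'.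
Proof. unfold lsum. induction l as [|x l IH]; simpl in *; [ring|]. rewrite IH. ring. Qed.

Lemma lsum_ext {T} (f g : T -> R) l : (forall x, In x l -> f x = g x) -> lsum f l = lsum g l.
Proof.
  unfold lsum. induction l as [|x l IH]; intros Hx; simpl; [reflexivity|].
  rewrite Hx, IH; auto with datatypes.
Qed.

Lemma lsum_filter {T} (f : T -> R) g l : lsum f (filter g l) = lsum (fun x => if g x then f x else 0) l.
Proof.
  unfold lsum. induction l as [|x l IH]; simpl; [reflexivity|].
  destruct (g x); simpl; rewrite IH; ring.
Qed.

Lemma lsum_flat_map {S T} (f : T -> R) (g : S -> list T) l :
  lsum f (flat_map g l) = lsum (fun x => lsum f (g x)) l.
Proof.
  induction l as [|x l IH]; [reflexivity|]. simpl flat_map. rewrite lsum_app, IH. reflexivity.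
Qed.

Lemma lsum_map {S T} (f : T -> R) (g : S -> T) l : lsum f (map g l) = lsum (fun x => f (g x)) l.
Proof. unfold lsum. now rewrite map_map. Qed.

Lemma lsum_mul_l {T} c (f : T -> R) l : lsum (fun x => c * f x) l = c * lsum f l.
Proof. unfold lsum. induction l as [|x l IH]; simpl; [ring|]. rewrite IH. ring. Qed.

Lemma lsum_add {T} (f g : T -> R) l : lsum (fun x => f x + g x) l = lsum f l + lsum g l.
Proof. unfold lsum. induction l as [|x l IH]; simpl; [ring|]. rewrite IH. ring. Qed.

Lemma lsum_zero {T} (l : list T) : lsum (fun _ => 0) l = 0.
Proof. unfold lsum. induction l as [|x l IH]; simpl; [reflexivity|]. rewrite IH. ring. Qed.

Lemma lsum_swap {S T} (F : S -> T -> R) l l' :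
  lsum (fun x => lsum (fun y => F x y) l') l = lsum (fun y => lsum (fun x => F x y) l) l'.
Proof.
  induction l as [|x l IH].
  - unfold lsum at 1. simpl. now rewrite lsum_zero.
  - change (lsum (fun x => lsum (fun y => F x y) l') (x :: l))
      with (lsum (fun y => F x y) l' + lsum (fun x => lsum (fun y => F x y) l') l).
    rewrite IH, <- lsum_add. reflexivity.
Qed.

Lemma lsum_seq f n : lsum f (seq 0 (S n)) = sum_f_R0 f n.
Proof.
  induction n as [|n IH]; [unfold lsum; simpl; ring|].
  rewrite seq_S, lsum_app, IH. unfold lsum. simpl. ring.
Qed.

Lemma zsum_seq f a n : zsum f a (a + Z.of_nat n) = sum_f_R0 (fun k => f (a + Z.of_nat k)%Z) n.
Proof.
  unfold zsum, zrange. fold (lsum f). rewrite <- lsum_seq.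
  change (fold_right Rplus 0 (map f ?l)) with (lsum f l). rewrite lsum_map.
  replace (Z.to_nat (a + Z.of_nat n - a + 1)) with (S n) by lia. reflexivity.
Qed.

Section Words.
Context (c d : nat) (p : Z -> R).

(** The start [a] is a parameter because [words] grows at its first letter while the walk recursion
    removes the last step; the induction exchanging the two needs arbitrary starts. *)
Definition meanders (n : nat) (a k : Z) : R :=
  lsum (path_weight p) (filter (fun w => andb (stays_nonneg a w) (Z.eqb (a + end_alt w) k)) (words c d n)).

Lemma meanders_0 a k : meanders 0 a k = if (a =? k)%Z then 1 else 0.
Proof.
  unfold meanders, lsum. simpl. rewrite Z.add_0_r. destruct (a =? k)%Z; simpl; ring.
Qed.

Lemma meanders_first n a k :
  meanders (S n) a k =
  zsum (fun i => if (0 <=? a + i)%Z then p i * meanders n (a + i) k else 0) (- Z.of_nat c) (Z.of_nat d).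
Proof.
  unfold meanders. rewrite lsum_filter. simpl words. rewrite lsum_flat_map.
  unfold zsum. change (fold_right Rplus 0 (map ?f ?l)) with (lsum f l).
  apply lsum_ext. intros i _. rewrite lsum_map. simpl.
  destruct (0 <=? a + i)%Z; simpl; [|apply lsum_zero].
  rewrite <- lsum_mul_l, lsum_filter. apply lsum_ext. intros w _.
  rewrite Z.add_assoc. unfold path_weight.
  destruct (stays_nonneg (a + i) w && (a + i + end_alt w =? k)%Z)%bool; simpl; [reflexivity|ring].
Qed.

Lemma zsum_ext f g a b : (forall i, f i = g i) -> zsum f a b = zsum g a b.
Proof. intros H. unfold zsum. f_equal. apply map_ext. assumption. Qed.

Lemma meanders_last n a k :
  meanders (S n) a k =
  if (0 <=? k)%Z then zsum (fun i => p i * meanders n a (k - i)) (- Z.of_nat c) (Z.of_nat d) else 0.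
Proof.
  revert a; induction n as [|n IH]; intros a.
  - rewrite meanders_first. transitivity
      (zsum (fun i => if (0 <=? k)%Z then p i * meanders 0 a (k - i) else 0) (- Z.of_nat c) (Z.of_nat d)).
    + apply zsum_ext. intros i. rewrite !meanders_0.
      destruct (Z.eqb_spec (a + i) k), (Z.eqb_spec a (k - i)); try lia.
      * subst. reflexivity.
      * destruct (0 <=? a + i)%Z, (0 <=? k)%Z; ring.
    + destruct (0 <=? k)%Z; [reflexivity|]. apply lsum_zero.
  - rewrite meanders_first. destruct (0 <=? k)%Z eqn:Hk.
    + transitivity (zsum (fun i => zsum (fun j =>
          p j * (if (0 <=? a + i)%Z then p i * meanders n (a + i) (k - j) else 0)) (- Z.of_nat c) (Z.of_nat d))
          (- Z.of_nat c) (Z.of_nat d)).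
      * apply zsum_ext. intros i. rewrite IH, ?Hk. destruct (0 <=? a + i)%Z.
        -- unfold zsum. change (fold_right Rplus 0 (map ?f ?l)) with (lsum f l).
           rewrite <- lsum_mul_l. apply lsum_ext. intros; ring.
        -- symmetry. rewrite (zsum_ext _ (fun _ => 0)) by (intros; ring). apply lsum_zero.
      * unfold zsum. change (fold_right Rplus 0 (map ?f ?l)) with (lsum f l).
        etransitivity; [exact (lsum_swap _ _ _)|].
        apply lsum_ext. intros j _. rewrite meanders_first.
        unfold zsum. change (fold_right Rplus 0 (map ?f ?l)) with (lsum f l). now rewrite <- lsum_mul_l.
    + rewrite (zsum_ext _ (fun _ => 0)); [apply lsum_zero|]. intros i. rewrite IH, ?Hk.
      destruct (0 <=? a + i)%Z; ring.
Qed.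

Lemma meanders_count n k : meander_count c d p n k = meanders n 0 k.
Proof. reflexivity. Qed.

Lemma meander_count_0 k : meander_count c d p 0 k = if (0 =? k)%Z then 1 else 0.
Proof. rewrite meanders_count. apply meanders_0. Qed.

Lemma meander_count_S n k : (0 <= k)%Z ->
  meander_count c d p (S n) k =
  sum_f_R0 (fun m => p (Z.of_nat m - Z.of_nat c)%Z * meander_count c d p n (k + Z.of_nat c - Z.of_nat m)) (c + d).
Proof.
  intros Hk. rewrite meanders_count, meanders_last. replace (0 <=? k)%Z with true by (symmetry; now apply Z.leb_le).
  replace (Z.of_nat d) with (- Z.of_nat c + Z.of_nat (c + d))%Z by lia. rewrite zsum_seq.
  apply sum_eq. intros m _. rewrite meanders_count. f_equal; [|f_equal]; try lia. f_equal; lia.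
Qed.

Lemma meander_count_neg n k : (k < 0)%Z -> meander_count c d p n k = 0.
Proof.
  intros Hk. rewrite meanders_count. destruct n as [|n].
  - rewrite meanders_0. destruct (Z.eqb_spec 0 k); [lia|reflexivity].
  - rewrite meanders_last. now replace (0 <=? k)%Z with false by (symmetry; now apply Z.leb_gt).
Qed.

Lemma end_alt_upper n w : In w (words c d n) -> (end_alt w <= Z.of_nat (d * n))%Z.
Proof.
  revert w; induction n as [|n IH]; intros w; simpl.
  - intros [<-|[]]. simpl. lia.
  - rewrite in_flat_map. intros (i & Hi & Hw). apply in_map_iff in Hw. destruct Hw as (w' & <- & Hw').
    specialize (IH _ Hw'). simpl. unfold zrange in Hi. apply in_map_iff in Hi. destruct Hi as (k & <- & Hk).
    apply in_seq in Hk. lia.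
Qed.

Lemma end_alt_lower a w : (0 <= a)%Z -> stays_nonneg a w = true -> (0 <= a + end_alt w)%Z.
Proof.
  revert a; induction w as [|i w IH]; intros a Ha; simpl; [lia|].
  intros Hs. apply andb_prop in Hs. destruct Hs as [H1 H2]. apply Z.leb_le in H1.
  specialize (IH _ H1 H2). lia.
Qed.

Lemma meander_total_sum n :
  meander_total c d p n = sum_f_R0 (fun k => meander_count c d p n (Z.of_nat k)) (d * n).
Proof.
  rewrite (sum_eq _ (fun k => lsum (fun w => if (stays_nonneg 0 w && (end_alt w =? Z.of_nat k)%Z)%bool
    then path_weight p w else 0) (words c d n))) by (intros; exact (lsum_filter _ _ _)).
  change (meander_total c d p n) with (lsum (path_weight p) (filter (fun w => stays_nonneg 0 w) (words c d n))).
  rewrite lsum_filter, <- lsum_seq.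
  etransitivity; [|exact (lsum_swap _ _ _)]. apply lsum_ext. intros w Hw.
  rewrite lsum_seq. destruct (stays_nonneg 0 w) eqn:Es; simpl.
  - pose proof (end_alt_upper _ _ Hw). pose proof (end_alt_lower 0 w ltac:(lia) Es).
    rewrite (sum_single _ (d * n) (Z.to_nat (end_alt w))); [|lia|].
    + replace (end_alt w =? Z.of_nat (Z.to_nat (end_alt w)))%Z with true; [reflexivity|].
      symmetry; apply Z.eqb_eq; lia.
    + intros k _ Hk. destruct (Z.eqb_spec (end_alt w) (Z.of_nat k)); [lia|reflexivity].
  - symmetry. now apply sum_eq_R0.
Qed.

(* exponential tilting by t, with time weight r *)
Definition tilted_step (t r : R) : ser :=
  fun m => p (Z.of_nat m - Z.of_nat c)%Z * powerRZ t (Z.of_nat m - Z.of_nat c) * r.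
Definition tilted_mu (t r : R) : bser :=
  fun n k => meander_count c d p n (Z.of_nat k) * t ^ k * r ^ n.
Definition tilted_nu (t r : R) : bser :=
  fun n j => if (j <? c)%nat then (tilted_step t r * tilted_mu t r n)%ser j else 0.

Context (Hsupp : forall i : Z, (i < - Z.of_nat c)%Z \/ (Z.of_nat d < i)%Z -> p i = 0).

Lemma tilted_step_fin t r k : (c + d < k)%nat -> tilted_step t r k = 0.
Proof. intros Hk. unfold tilted_step. rewrite Hsupp; [ring|]. right; lia. Qed.

Lemma sum_stop (f : nat -> R) n m : (n <= m)%nat -> (forall k, (n < k)%nat -> f k = 0) ->
  sum_f_R0 f m = sum_f_R0 f n.
Proof. intros H Hf. induction H as [|m H IH]; [reflexivity|]. simpl. rewrite Hf, IH by lia. ring. Qed.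

Lemma tilted_mu_step t r n j : 0 < t ->
  (tilted_step t r * tilted_mu t r n)%ser (c + j)%nat = tilted_mu t r (S n) j.
Proof.
  intros Ht. unfold tilted_mu at 2. rewrite meander_count_S by lia. rewrite smulE.
  set (f := fun m => p (Z.of_nat m - Z.of_nat c)%Z * meander_count c d p n (Z.of_nat j + Z.of_nat c - Z.of_nat m)).
  (* One sum runs over jumps up to c + d, the other over exponents up to c + j. Both are padded to
     this length, the extra terms vanishing by the support of [p] or by negative altitude. *)
  set (M := (c + j + (c + d))%nat).
  assert (E1 : sum_f_R0 f (c + d) = sum_f_R0 f M).
  { symmetry. apply sum_stop; [unfold M; lia|]. intros k Hk. unfold f. rewrite Hsupp; [ring|right; lia]. }
  assert (E2 : sum_f_R0 f (c + j) = sum_f_R0 f M).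
  { symmetry. apply sum_stop; [unfold M; lia|]. intros k Hk. unfold f. rewrite meander_count_neg by lia. ring. }
  fold f. rewrite E1, <- E2, <- !sum_mul_r. apply sum_eq. intros m Hm. unfold f, tilted_step, tilted_mu.
  replace (Z.of_nat (c + j - m)) with (Z.of_nat j + Z.of_nat c - Z.of_nat m)%Z by lia.
  assert (Et : powerRZ t (Z.of_nat m - Z.of_nat c) * t ^ (c + j - m) = t ^ j).
  { rewrite !pow_powerRZ, <- powerRZ_add by lra. f_equal. lia. }
  rewrite <- Et. simpl. ring.
Qed.

Lemma tilted_mu_0 t r : tilted_mu t r 0%nat = cst 1.
Proof.
  apply functional_extensionality. intros k. unfold tilted_mu. rewrite meander_count_0.
  destruct (Z.eqb_spec 0 (Z.of_nat k)) as [Hk|Hk].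
  - replace k with O by lia. simpl. ring.
  - destruct k; [lia|]. simpl cst. ring.
Qed.

Lemma tilted_walk t r : (1 <= c)%nat -> (1 <= d)%nat -> (forall i, 0 <= p i) ->
  p (- Z.of_nat c)%Z <> 0 -> p (Z.of_nat d) <> 0 -> 0 < t -> 0 < r -> ev (tilted_step t r) = 1 ->
  walk c d (tilted_step t r) (tilted_mu t r) (tilted_nu t r).
Proof.
  intros Hc Hd Hp Hpc Hpd Ht Hr Hm.
  assert (Hpos : forall i k, p i <> 0 -> 0 < p i * powerRZ t k * r).
  { intros i k Hi. specialize (Hp i). apply Rmult_lt_0_compat; [|assumption].
    apply Rmult_lt_0_compat; [lra|]. now apply powerRZ_lt. }
  split; try assumption.
  - intros k. unfold tilted_step. apply Rmult_le_pos; [|lra]. apply Rmult_le_pos; [apply Hp|].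
    now apply powerRZ_le.
  - apply tilted_step_fin.
  - apply Hpos. replace (Z.of_nat 0 - Z.of_nat c)%Z with (- Z.of_nat c)%Z by lia. assumption.
  - apply Hpos. replace (Z.of_nat (c + d) - Z.of_nat c)%Z with (Z.of_nat d) by lia. assumption.
  - apply tilted_mu_0.
  - intros n. apply functional_extensionality. intros j. rewrite saddE, var_spow_mul. unfold tilted_nu.
    destruct (Nat.leb_spec c j) as [Hj|Hj].
    + replace (j <? c)%nat with false by (symmetry; now apply Nat.ltb_ge).
      rewrite <- tilted_mu_step by assumption. replace (c + (j - c))%nat with j by lia. ring.
    + replace (j <? c)%nat with true by (symmetry; now apply Nat.ltb_lt). ring.
  - intros n j Hj. unfold tilted_nu. now replace (j <? c)%nat with false by (symmetry; now apply Nat.ltb_ge).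
Qed.

Lemma tilted_step_sum (t r : R) : ev (tilted_step t r) = jumpP c d p t * r.
Proof.
  rewrite (ev_finite _ (c + d)) by apply tilted_step_fin.
  unfold jumpP. replace (Z.of_nat d) with (- Z.of_nat c + Z.of_nat (c + d))%Z by lia. rewrite zsum_seq, <- sum_mul_r.
  apply sum_eq. intros m _. unfold tilted_step.
  replace (- Z.of_nat c + Z.of_nat m)%Z with (Z.of_nat m - Z.of_nat c)%Z by lia. reflexivity.
Qed.

Definition jump_derivative (t : R) : R :=
  sum_f_R0 (fun m => p (Z.of_nat m - Z.of_nat c)%Z * (IZR (Z.of_nat m - Z.of_nat c) *
     powerRZ t (Z.of_nat m - Z.of_nat c - 1))) (c + d).

Lemma is_derive_powerRZ i t : 0 < t -> is_derive (fun u => powerRZ u i) t (IZR i * powerRZ t (i - 1)).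
Proof.
  intros Ht. destruct i as [|n|n].
  - simpl. rewrite Rmult_0_l. apply is_derive_ext with (fun _ => 1); [reflexivity|]. apply is_derive_Reals, derivable_pt_lim_const.
  - replace (powerRZ t (Z.pos n - 1)) with (t ^ pred (Pos.to_nat n)).
    + simpl powerRZ. replace (IZR (Z.pos n)) with (INR (Pos.to_nat n)) by (rewrite INR_IZR_INZ; f_equal; lia).
      apply is_derive_Reals, derivable_pt_lim_pow.
    + rewrite pow_powerRZ. f_equal. lia.
  - simpl powerRZ at 1. assert (Hn : t ^ Pos.to_nat n <> 0) by (apply pow_nonzero; lra).
    replace (IZR (Z.neg n) * powerRZ t (Z.neg n - 1)) with
      (- (INR (Pos.to_nat n) * t ^ pred (Pos.to_nat n)) / (t ^ Pos.to_nat n) ^ 2).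
    + apply (is_derive_inv (fun u => u ^ Pos.to_nat n)); [|assumption].
      apply is_derive_Reals, derivable_pt_lim_pow.
    + replace (Z.neg n - 1)%Z with (- Z.of_nat (S (Pos.to_nat n)))%Z by lia.
      rewrite powerRZ_neg', <- pow_powerRZ.
      replace (IZR (Z.neg n)) with (- INR (Pos.to_nat n)) by (rewrite INR_IZR_INZ, <- opp_IZR; f_equal; lia).
      destruct (Pos.to_nat n) as [|m] eqn:E; [lia|]. simpl pred. simpl pow in *.
      field. split; [apply pow_nonzero; lra|lra].
Qed.

Lemma is_derive_sum (f g : nat -> R -> R) n t :
  (forall m, is_derive (f m) t (g m t)) ->
  is_derive (fun u => sum_f_R0 (fun m => f m u) n) t (sum_f_R0 (fun m => g m t) n).
Proof.
  intros H. induction n as [|n IH]; cbn [sum_f_R0]; [apply H|].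
  apply (is_derive_plus (fun u => sum_f_R0 (fun m => f m u) n) (f (S n))); [assumption|apply H].
Qed.

Lemma Derive_jumpP t : 0 < t -> Derive (jumpP c d p) t = jump_derivative t.
Proof.
  intros Ht. apply is_derive_unique.
  apply is_derive_ext with (fun u => sum_f_R0 (fun m => p (Z.of_nat m - Z.of_nat c)%Z * powerRZ u (Z.of_nat m - Z.of_nat c)) (c + d)).
  - intros u. unfold jumpP. replace (Z.of_nat d) with (- Z.of_nat c + Z.of_nat (c + d))%Z by lia. rewrite zsum_seq.
    apply sum_eq. intros m _. replace (- Z.of_nat c + Z.of_nat m)%Z with (Z.of_nat m - Z.of_nat c)%Z by lia. reflexivity.
  - apply (is_derive_sum (fun m u => p (Z.of_nat m - Z.of_nat c)%Z * powerRZ u (Z.of_nat m - Z.of_nat c))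
      (fun m t => p (Z.of_nat m - Z.of_nat c)%Z * (IZR (Z.of_nat m - Z.of_nat c) * powerRZ t (Z.of_nat m - Z.of_nat c - 1)))).
    intros m. apply (is_derive_scal (fun u => powerRZ u (Z.of_nat m - Z.of_nat c))). now apply is_derive_powerRZ.
Qed.

(** The mean differs from c times the mass by r t P'(t), so a critical point of P yields a walk
    without drift. *)
Lemma tilted_step_mean t r : 0 < t ->
  ev (theta (tilted_step t r)) = INR c * (jumpP c d p t * r) + r * t * jump_derivative t.
Proof.
  intros Ht. rewrite <- tilted_step_sum.
  rewrite (ev_finite (theta _) (c + d)) by (intros k Hk; unfold theta; rewrite tilted_step_fin by assumption; ring).
  rewrite (ev_finite (tilted_step t r) (c + d)) by apply tilted_step_fin.
  unfold jump_derivative. rewrite <- !sum_mul_l, <- sum_plus. apply sum_eq. intros m _.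
  unfold theta, tilted_step. rewrite minus_IZR, <- !INR_IZR_INZ.
  replace (powerRZ t (Z.of_nat m - Z.of_nat c)) with (t * powerRZ t (Z.of_nat m - Z.of_nat c - 1)).
  - ring.
  - rewrite <- (powerRZ_1 t) at 1. rewrite <- powerRZ_add by lra. f_equal. lia.
Qed.

End Words.

(** * Convexity of the jump polynomial *)

Lemma powerRZ_bernoulli x i : 0 < x -> 1 + IZR i * (x - 1) <= powerRZ x i.
Proof.
  intros Hx. assert (HB : forall y n, 0 < y -> 1 + INR n * (y - 1) <= y ^ n).
  { intros y n Hy. induction n as [|n IH]; [simpl; lra|]. rewrite S_INR. simpl pow.
    assert (0 <= y * (y ^ n - (1 + INR n * (y - 1)))) by (apply Rmult_le_pos; lra).
    assert (0 <= INR n * (y - 1) ^ 2) by (apply Rmult_le_pos; [apply pos_INR|apply pow2_ge_0]). lra. }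
  destruct i as [|n|n].
  - simpl. lra.
  - simpl powerRZ. replace (IZR (Z.pos n)) with (INR (Pos.to_nat n)) by (rewrite INR_IZR_INZ; f_equal; lia).
    now apply HB.
  - simpl powerRZ. replace (IZR (Z.neg n)) with (- INR (Pos.to_nat n)) by (rewrite INR_IZR_INZ, <- opp_IZR; f_equal; lia).
    rewrite <- pow_inv. eapply Rle_trans; [|apply HB; now apply Rinv_0_lt_compat].
    assert (1 - x <= / x - 1).
    { apply Rmult_le_reg_l with x; [assumption|]. replace (x * (/ x - 1)) with (1 - x) by (field; lra).
      pose proof (pow2_ge_0 (1 - x)). lra. }
    pose proof (pos_INR (Pos.to_nat n)). nra.
Qed.

(** Bernoulli's inequality at u / t for each monomial, negative exponents included. It turns a
    critical point into a global minimum. *)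
Lemma jumpP_tangent c d p t u : (forall i : Z, 0 <= p i) -> 0 < t -> 0 < u ->
  jumpP c d p t + jump_derivative c d p t * (u - t) <= jumpP c d p u.
Proof.
  intros Hp Ht Hu. unfold jumpP.
  replace (Z.of_nat d) with (- Z.of_nat c + Z.of_nat (c + d))%Z by lia. rewrite !zsum_seq.
  unfold jump_derivative. rewrite <- sum_mul_r, <- sum_plus. apply sum_Rle. intros m _.
  replace (- Z.of_nat c + Z.of_nat m)%Z with (Z.of_nat m - Z.of_nat c)%Z by lia.
  set (i := (Z.of_nat m - Z.of_nat c)%Z). specialize (Hp i).
  pose proof (powerRZ_bernoulli (u / t) i ltac:(now apply Rdiv_lt_0_compat)) as HB.
  assert (Et : powerRZ t i = t * powerRZ t (i - 1)).
  { rewrite <- (powerRZ_1 t) at 2. rewrite <- powerRZ_add by lra. f_equal. lia. }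
  assert (Eu : powerRZ u i = powerRZ t i * powerRZ (u / t) i).
  { rewrite <- powerRZ_mult. f_equal. field. lra. }
  assert (0 < powerRZ t i) by now apply powerRZ_lt.
  rewrite Eu, Rmult_assoc, <- Rmult_plus_distr_l. apply Rmult_le_compat_l; [assumption|].
  apply Rle_trans with (powerRZ t i * (1 + IZR i * (u / t - 1))); [|apply Rmult_le_compat_l; lra].
  rewrite Et. right. field. lra.
Qed.

(** * The reversed step law *)

(** After reversal, [u^(cn+j)] P^n becomes [u^(dn)] u^j pi^n. A fixed altitude and a weighted sum
    over altitudes thus both take the form [J] of some weight. *)
Definition srev (N : nat) (a : ser) : ser := fun x => if (x <=? N)%nat then a (N - x)%nat else 0.

Lemma spow_fin (a : ser) N n x : (forall k, (N < k)%nat -> a k = 0) -> (N * n < x)%nat -> (a ^ n)%ser x = 0.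
Proof.
  intros Ha. revert x; induction n as [|n IH]; intros x Hx.
  - simpl spow. destruct x; [lia|reflexivity].
  - simpl spow. rewrite smulE. apply sum_eq_R0. intros k Hk. destruct (Nat.le_gt_cases k N).
    + rewrite IH by nia. ring.
    + rewrite Ha by assumption. ring.
Qed.

(** Reversal is u^N a(1/u), hence multiplicative. With truncated indices, both convolutions are
    padded to the range 0..N and one is read backwards. *)
Lemma srev_spow N a n : (forall k, (N < k)%nat -> a k = 0) -> (srev N a ^ n = srev (N * n) (a ^ n))%ser.
Proof.
  intros Ha. induction n as [|n IH].
  - apply functional_extensionality. intros x. unfold srev. rewrite Nat.mul_0_r.
    destruct x; reflexivity.
  - apply functional_extensionality. intros x.
    change (srev N a ^ S n)%ser with (srev N a * srev N a ^ n)%ser. rewrite IH, smulE.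
    set (F := fun k => if ((k <=? x) && (k <=? N) && (x - k <=? N * n))%nat%bool
       then a (N - k)%nat * (a ^ n)%ser (N * n - (x - k))%nat else 0).
    assert (E1 : sum_f_R0 (fun k => srev N a k * srev (N * n) (a ^ n) (x - k)%nat) x = sum_f_R0 F (x + N)).
    { rewrite (sum_stop F x (x + N)); [|lia|].
      - apply sum_eq. intros k Hk. unfold srev, F. replace (k <=? x)%nat with true by (symmetry; now apply Nat.leb_le).
        destruct (k <=? N)%nat, (x - k <=? N * n)%nat; simpl; ring.
      - intros k Hk. unfold F. now replace (k <=? x)%nat with false by (symmetry; now apply Nat.leb_gt). }
    rewrite E1, (sum_stop F N (x + N)); [|lia|].
    2:{ intros k Hk. unfold F. replace (k <=? N)%nat with false by (symmetry; now apply Nat.leb_gt).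
        now rewrite Bool.andb_false_r. }
    unfold srev. destruct (Nat.leb_spec x (N * S n)) as [Hx|Hx].
    + change (a ^ S n)%ser with (a * a ^ n)%ser. rewrite smulE.
      set (G := fun i => a i * (if (i <=? N * S n - x)%nat then (a ^ n)%ser (N * S n - x - i)%nat else 0)).
      assert (E2 : sum_f_R0 (fun k => a k * (a ^ n)%ser (N * S n - x - k)%nat) (N * S n - x) = sum_f_R0 G N).
      { transitivity (sum_f_R0 G (N * S n - x)).
        - apply sum_eq. intros k Hk. unfold G. now replace (k <=? N * S n - x)%nat with true by (symmetry; now apply Nat.leb_le).
        - transitivity (sum_f_R0 G (N * S n - x + N)).
          + symmetry. apply sum_stop; [lia|]. intros k Hk. unfold G.
            replace (k <=? N * S n - x)%nat with false by (symmetry; now apply Nat.leb_gt). ring.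
          + apply sum_stop; [lia|]. intros k Hk. unfold G. rewrite Ha by assumption. ring. }
      rewrite E2. transitivity (sum_f_R0 (fun k => G (N - k)%nat) N).
      * apply sum_eq. intros k Hk. unfold F, G.
        replace (k <=? N)%nat with true by (symmetry; now apply Nat.leb_le). rewrite Bool.andb_true_r.
        destruct (Nat.leb_spec k x) as [Hkx|Hkx]; simpl.
        -- destruct (Nat.leb_spec (x - k) (N * n)), (Nat.leb_spec (N - k) (N * S n - x)); try nia; [|ring].
           do 2 f_equal. nia.
        -- destruct (Nat.leb_spec (N - k) (N * S n - x)); [|ring].
           rewrite (spow_fin a N n) by (assumption || nia). ring.
      * symmetry. exact (gsum_rev _ _ _ _ _ _ R_ring_theory G N).
    + apply sum_eq_R0. intros k Hk. unfold F.
      destruct (Nat.leb_spec (x - k) (N * n)); [nia|]. now rewrite Bool.andb_false_r.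
Qed.

Lemma spow_pos (a : ser) n x : (forall k, 0 <= a k) -> 0 <= (a ^ n)%ser x.
Proof.
  intros Ha. revert x; induction n as [|n IH]; intros x; simpl spow.
  - destruct x; simpl; lra.
  - now apply smul_pos.
Qed.

Lemma least_nat (Q : nat -> Prop) : (exists n, Q n) -> exists n, Q n /\ forall m, Q m -> (n <= m)%nat.
Proof.
  intros [n Hn]. induction n as [n IH] using lt_wf_ind.
  destruct (classic (exists m, (m < n)%nat /\ Q m)) as [(m & Hm & HQ)|Hno]; [eauto|].
  exists n. split; [assumption|]. intros m Hm. destruct (Nat.le_gt_cases n m); [assumption|].
  exfalso. apply Hno. eauto.
Qed.

(* The support of the powers is an additive semigroup; its least positive difference divides
   all its elements. *)
Lemma adjacent_support (pi : ser) N : (forall k, 0 <= pi k) -> 0 < pi O -> (1 <= N)%nat -> 0 < pi N ->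
  (forall g, (2 <= g)%nat -> exists k, 0 < pi k /\ Nat.modulo k g <> O) ->
  exists r x, r <> O /\ 0 < (pi ^ r)%ser x /\ 0 < (pi ^ r)%ser (S x).
Proof.
  intros Hpos H0 HN HpN Hg.
  set (Sup := fun x => exists n, 0 < (pi ^ n)%ser x).
  assert (Hadd : forall x y, Sup x -> Sup y -> Sup (x + y)%nat).
  { intros x y [n Hn] [m Hm]. exists (n + m)%nat. rewrite spow_add.
    eapply Rlt_le_trans; [|apply smul_term_le; intros; now apply spow_pos]. now apply Rmult_lt_0_compat. }
  assert (Hmul : forall x k, Sup x -> Sup (k * x)%nat).
  { intros x k Hx. induction k as [|k IH]; [exists O; simpl; lra|]. simpl. now apply Hadd. }
  assert (H1 : forall x, 0 < pi x -> Sup x).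
  { intros x Hx. exists 1%nat. now rewrite spow_1. }
  destruct (least_nat (fun g => (1 <= g)%nat /\ exists x, Sup x /\ Sup (x + g)%nat)) as (g & (Hg1 & x & Hx & Hxg) & Hmin).
  { exists N. split; [assumption|]. exists O. split; now apply H1. }
  assert (Hdiv : forall y, Sup y -> Nat.modulo y g = O).
  { intros y Hy. destruct (Nat.eq_dec (y mod g) 0) as [|Hne]; [assumption|exfalso].
    pose proof (Nat.mod_upper_bound y g ltac:(lia)). pose proof (Nat.div_mod y g ltac:(lia)) as Hdm.
    specialize (Hmin (y mod g)%nat). assert (g <= y mod g)%nat; [|lia]. apply Hmin. split; [lia|].
    (* Adding y mod g to this element gives y + (y / g) x, again in the support; so y mod g would be
       a difference smaller than g. *)
    exists (y / g * (x + g))%nat. split; [now apply Hmul|].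
    replace (y / g * (x + g) + y mod g)%nat with (y + y / g * x)%nat by nia. apply Hadd; [assumption|now apply Hmul]. }
  assert (g = 1%nat) as ->.
  { destruct (Nat.eq_dec g 1) as [|Hne]; [assumption|]. destruct (Hg g ltac:(lia)) as (k & Hk & Hkm).
    exfalso. now apply Hkm, Hdiv, H1. }
  (* The atom at 0 allows extra steps that do not move, which brings both atoms to the same
     power. *)
  assert (Hpad : forall y n m, 0 < (pi ^ n)%ser y -> 0 < (pi ^ (m + n))%ser y).
  { intros y n m Hy. rewrite spow_add. eapply Rlt_le_trans; [|apply (smul_term_le _ _ 0 y); intros; now apply spow_pos].
    apply Rmult_lt_0_compat; [|assumption]. rewrite spow_0th. now apply pow_lt. }
  destruct Hx as [n Hn]. destruct Hxg as [m Hm]. exists (S (n + m)), x. split; [lia|]. split.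
  - replace (S (n + m)) with (S m + n)%nat by lia. now apply Hpad.
  - rewrite Nat.add_1_r in Hm. replace (S (n + m)) with (S n + m)%nat by lia. now apply Hpad.
Qed.

(** The condition P'(t) = 0 centres the law. The reversed law has its atoms at d - i for jumps i; a
    common divisor g >= 2 of them would give P(u) = u^d H(u^g), so aperiodicity yields adjacent
    atoms in some power. *)
Lemma aperiodic_step_law c d p t r :
  (1 <= c)%nat -> (1 <= d)%nat -> (forall i, 0 <= p i) ->
  (forall i : Z, (i < - Z.of_nat c)%Z \/ (Z.of_nat d < i)%Z -> p i = 0) ->
  p (- Z.of_nat c)%Z <> 0 -> p (Z.of_nat d) <> 0 -> aperiodic p ->
  0 < t -> 0 < r -> jumpP c d p t * r = 1 -> jump_derivative c d p t = 0 ->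
  exists C, step_law (srev (c + d) (tilted_step c p t r)) d C.
Proof.
  intros Hc Hd Hp Hsupp Hpc Hpd Hap Ht Hr Hmass Hmean.
  pose proof (tilted_walk c d p Hsupp t r Hc Hd Hp Hpc Hpd Ht Hr
     (eq_trans (tilted_step_sum c d p Hsupp t r) Hmass)) as HW.
  set (P := tilted_step c p t r) in *. set (N := (c + d)%nat) in *. set (pi := srev N P).
  assert (Hpos : forall k, 0 <= pi k).
  { intros k. unfold pi, srev. destruct (k <=? N)%nat; [apply HW|lra]. }
  assert (Hfin : forall k, (N < k)%nat -> pi k = 0).
  { intros k Hk. unfold pi, srev. now replace (k <=? N)%nat with false by (symmetry; now apply Nat.leb_gt). }
  assert (Hrev : forall k, (k <= N)%nat -> pi k = P (N - k)%nat).
  { intros k Hk. unfold pi, srev. now replace (k <=? N)%nat with true by (symmetry; now apply Nat.leb_le). }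
  assert (Hev : ev pi = 1).
  { rewrite (ev_finite _ N Hfin), <- (wk_mass _ _ _ _ _ HW), (ev_finite P N (wk_fin _ _ _ _ _ HW)).
    rewrite (sum_eq _ (fun k => P (N - k)%nat)) by (intros; now apply Hrev).
    symmetry. exact (gsum_rev _ _ _ _ _ _ R_ring_theory P N). }
  assert (Hl1 : l1 pi 1).
  { intros n. rewrite (sum_eq _ pi) by (intros; now apply Rabs_pos_eq). rewrite <- Hev.
    apply ev_ge_partial; [|assumption]. now apply summable_finite with N. }
  assert (H0 : 0 < pi O).
  { rewrite Hrev, Nat.sub_0_r by lia. apply HW. }
  destruct (adjacent_support pi N Hpos H0) as (m & x & Hm & Hx & Hx1).
  { unfold N; lia. }
  { rewrite Hrev, Nat.sub_diag by lia. apply HW. }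
  { intros g Hg. destruct (classic (exists k, 0 < pi k /\ (k mod g)%nat <> O)) as [|Hno]; [assumption|exfalso].
    apply Hap. exists (Z.of_nat d), g, (fun j => p (Z.of_nat d + Z.of_nat g * j)%Z).
    split; [assumption|]. split.
    - exists (Z.of_nat N). intros j Hj. apply Hsupp. unfold N in Hj. nia.
    - intros i. pose proof (Z.div_mod (i - Z.of_nat d) (Z.of_nat g) ltac:(lia)) as Hdm.
      destruct (Z.eqb_spec ((i - Z.of_nat d) mod Z.of_nat g) 0) as [E|E].
      + f_equal. lia.
      + destruct (Req_dec (p i) 0) as [|Hne]; [assumption|exfalso].
        assert (Hi : (- Z.of_nat c <= i <= Z.of_nat d)%Z).
        { split; apply Z.le_ngt; intros Hlt; apply Hne, Hsupp; lia. }
        apply Hno. exists (Z.to_nat (Z.of_nat d - i)). split.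
        * rewrite Hrev by (unfold N; lia). unfold P, tilted_step.
          replace (Z.of_nat (N - Z.to_nat (Z.of_nat d - i)) - Z.of_nat c)%Z with i by (unfold N; lia).
          specialize (Hp i). apply Rmult_lt_0_compat; [|assumption]. apply Rmult_lt_0_compat; [lra|]. now apply powerRZ_lt.
        * intros Hmod. apply E. apply Nat.Div0.mod_divides in Hmod. destruct Hmod as [k Hk].
          replace (i - Z.of_nat d)%Z with (- Z.of_nat k * Z.of_nat g)%Z by nia. apply Z_mod_mult. }
  destruct (adjacent_smoothing (pi ^ m)%ser x) as [C HC]; auto.
  { intros k. now apply spow_pos. }
  { now apply l1_spow_1. }
  exists (Rabs C * INR m). split; auto.
  - now apply expd_finite with N.
  - rewrite (ev_finite _ N) by (intros k Hk; unfold theta; rewrite Hfin by assumption; ring).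
    pose proof (tilted_step_mean c d p Hsupp t r Ht) as HM. rewrite Hmass, Hmean in HM. fold P in HM.
    rewrite (ev_finite (theta P) N) in HM by (intros k Hk; unfold theta; rewrite (wk_fin _ _ _ _ _ HW) by assumption; ring).
    rewrite (sum_eq _ (fun k => INR (N - (N - k)) * P (N - k)%nat))
      by (intros k Hk; unfold theta; rewrite Hrev by assumption; do 2 f_equal; lia).
    transitivity (sum_f_R0 (fun k => INR (N - k) * P k) N).
    { symmetry. exact (gsum_rev _ _ _ _ _ _ R_ring_theory (fun k => INR (N - k) * P k) N). }
    rewrite (sum_eq _ (fun k => INR N * P k - theta P k)) by (intros k Hk; unfold theta; rewrite minus_INR by assumption; ring).
    rewrite minus_sum, sum_mul_l, HM, <- (ev_finite P N (wk_fin _ _ _ _ _ HW)), (wk_mass _ _ _ _ _ HW).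
    unfold N. rewrite plus_INR. ring.
  - apply Rmult_le_pos; [apply Rabs_pos|apply pos_INR].
  - apply smoothing_root; auto using Rabs_pos.
    intros k. eapply l1_le; [apply HC|]. apply sqrt_le_1_alt.
    apply Rmult_le_compat_r; [left; apply wt_pos|apply RRle_abs].
Qed.

(** The Spitzer logarithm at altitude j is [Jlog] of u^j, and its value at u = v is [Jlog] of 1 / (1
    - v u). The second weight is analytic beyond the unit circle because v < 1. *)
Lemma walk_W c d P mu nu C K : walk c d P mu nu -> step_law (srev (c + d) P) d C -> (2 <= K)%nat ->
  (forall j, W K (mu_at mu j)) /\ (forall v, 0 <= v < 1 -> W K (mu_value mu v)).
Proof.
  intros HW HS HK. pose proof (wk_fin _ _ _ _ _ HW) as Hfin. set (N := (c + d)%nat) in *.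
  assert (Hlog : forall n j, spitzer_log c P (S n) j = if (j <=? d * S n)%nat
      then (srev N P ^ S n)%ser (d * S n - j)%nat / INR (S n) else 0).
  { intros n j. unfold spitzer_log, spitzer_lambda. rewrite cst_mul. unfold drop.
    destruct (Nat.leb_spec j (d * S n)) as [Hj|Hj].
    - rewrite srev_spow by assumption. unfold srev.
      replace (d * S n - j <=? N * S n)%nat with true by (symmetry; apply Nat.leb_le; unfold N; nia).
      replace (N * S n - (d * S n - j))%nat with (j + c * S n)%nat by (unfold N; nia).
      unfold Rdiv. ring.
    - rewrite (spow_fin P N) by (assumption || (unfold N; nia)). ring. }
  split.
  - apply (W_mu_at c P mu nu); try apply HW; [assumption|]. intros j.
    replace (log_at c P j) with (Jlog (srev N P) d (var ^ j)).
    + apply (Jlog_W _ _ _ HS); [assumption|]. apply expd_spow, expd_var.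
    + apply functional_extensionality. intros [|n]; unfold log_at, Jlog.
      * unfold spitzer_log. destruct j; reflexivity.
      * rewrite Hlog. unfold J. rewrite var_spow_mul. destruct (j <=? d * S n)%nat; [reflexivity|].
        unfold Rdiv. ring.
  - intros v Hv. assert (Hsl : forall n, summable (scale v (spitzer_log c P n))).
    { intros [|n].
      - unfold spitzer_log. rewrite scale_cst. apply summable_cst.
      - apply summable_finite with (d * S n)%nat. intros j Hj. unfold scale. rewrite Hlog.
        replace (j <=? d * S n)%nat with false by (symmetry; now apply Nat.leb_gt). ring. }
    apply (W_mu_value c P mu nu); try apply HW; auto.
    + intros n. apply summable_finite with (d * n)%nat. intros j Hj. unfold scale.
      rewrite (mu_fin c d P mu nu HW) by assumption. ring.
    + replace (log_value c P v) with (Jlog (srev N P) d (fun n => v ^ n)).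
      * apply (Jlog_W _ _ _ HS); [assumption|].
        exists (2 / (1 + v)). assert (Hr : 1 < 2 / (1 + v)) by (apply Rlt_div_r; lra). split; [assumption|].
        apply summable_of_bound with 1 v; try lra.
        -- replace (v * (2 / (1 + v))) with (2 * v / (1 + v)) by (field; lra). apply Rlt_div_l; lra.
        -- intros n. rewrite Rmult_1_l, Rabs_pos_eq; [lra|apply pow_le; lra].
      * apply functional_extensionality. intros [|n]; unfold log_value, Jlog.
        -- unfold spitzer_log. rewrite scale_cst. symmetry. apply ev_cst.
        -- rewrite (ev_finite _ (d * S n)).
           ++ unfold J, Rdiv. rewrite smulE, <- sum_mul_r. apply sum_eq. intros j Hj. unfold scale. rewrite Hlog.
              replace (j <=? d * S n)%nat with true by (symmetry; now apply Nat.leb_le). unfold Rdiv. ring.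
           ++ intros j Hj. unfold scale. rewrite Hlog.
              replace (j <=? d * S n)%nat with false by (symmetry; now apply Nat.leb_gt). ring.
Qed.

(** * Wallis' formula *)

Definition wallis (n : nat) : R := RInt (fun x => sin x ^ n) 0 (PI / 2).

Lemma ex_RInt_sin_pow n : ex_RInt (fun x => sin x ^ n) 0 (PI / 2).
Proof.
  apply (ex_RInt_continuous (V := R_CompleteNormedModule)). intros x _.
  apply (ex_derive_continuous (K := R_AbsRing) (V := R_NormedModule)). auto_derive. exact I.
Qed.

Lemma wallis_0 : wallis 0 = PI / 2.
Proof.
  unfold wallis. simpl. rewrite RInt_const. unfold scal; simpl; unfold mult; simpl. lra.
Qed.

Lemma wallis_1 : wallis 1 = 1.
Proof.
  unfold wallis. apply is_RInt_unique.
  replace 1 with (minus (- cos (PI / 2)) (- cos 0)).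
  2:{ rewrite cos_PI2, cos_0. unfold minus, plus, opp; simpl. ring. }
  apply (is_RInt_derive (fun x => - cos x) (fun x => sin x ^ 1)).
  - intros x _. auto_derive; [exact I|ring].
  - intros x _. apply (ex_derive_continuous (K := R_AbsRing) (V := R_NormedModule)). auto_derive. exact I.
Qed.

Lemma wallis_rec n : (INR n + 2) * wallis (S (S n)) = (INR n + 1) * wallis n.
Proof.
  assert (H : is_RInt (fun x => (INR n + 2) * sin x ^ S (S n) - (INR n + 1) * sin x ^ n) 0 (PI / 2) 0).
  { replace 0 with (minus (- cos (PI / 2) * sin (PI / 2) ^ S n) (- cos 0 * sin 0 ^ S n)) at 2.
    2:{ rewrite cos_PI2, sin_0. unfold minus, plus, opp; simpl. ring. }
    apply (is_RInt_derive (fun x => - cos x * sin x ^ S n)).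
    - intros x _. auto_derive; [exact I|].
      change (match n with O => 1 | S _ => INR n + 1 end) with (INR (S n)). rewrite S_INR.
      assert (E : cos x * cos x = 1 - sin x * sin x) by (pose proof (sin2_cos2 x) as Hx; unfold Rsqr in Hx; lra).
      simpl pow. 
      transitivity (sin x * (sin x * sin x ^ n) - (INR n + 1) * sin x ^ n * (cos x * cos x)); [ring|].
      rewrite E. ring.
    - intros x _. apply (ex_derive_continuous (K := R_AbsRing) (V := R_NormedModule)). auto_derive. exact I. }
  apply (is_RInt_unique (V := R_CompleteNormedModule)) in H.
  rewrite (RInt_minus (V := R_CompleteNormedModule) (fun x => (INR n + 2) * sin x ^ S (S n)) (fun x => (INR n + 1) * sin x ^ n)) in H.
  - rewrite (RInt_scal (V := R_CompleteNormedModule) (fun x => sin x ^ S (S n))) in H by apply ex_RInt_sin_pow.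
    rewrite (RInt_scal (V := R_CompleteNormedModule) (fun x => sin x ^ n)) in H by apply ex_RInt_sin_pow.
    unfold minus, plus, opp, scal in H; simpl in H. unfold mult in H; simpl in H. unfold wallis. simpl pow. lra.
  - apply (ex_RInt_scal (V := R_CompleteNormedModule)). apply ex_RInt_sin_pow.
  - apply (ex_RInt_scal (V := R_CompleteNormedModule)). apply ex_RInt_sin_pow.
Qed.

Lemma wallis_decr n : wallis (S n) <= wallis n.
Proof.
  pose proof PI_RGT_0. apply RInt_le; [lra|apply ex_RInt_sin_pow|apply ex_RInt_sin_pow|].
  intros x Hx. simpl. assert (0 <= sin x) by (apply sin_ge_0; lra). pose proof (SIN_bound x).
  pose proof (pow_le (sin x) n H0). nra.
Qed.

Lemma wallis_even n : wallis (2 * n) = PI / 2 * h n.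
Proof.
  induction n as [|n IH]; [rewrite Nat.mul_0_r, wallis_0; simpl; ring|].
  replace (2 * S n)%nat with (S (S (2 * n))) by lia. pose proof (wallis_rec (2 * n)) as Hr.
  rewrite IH, mult_INR in Hr. simpl (INR 2) in Hr. rewrite h_S. pose proof (pos_INR n).
  apply Rmult_eq_reg_l with ((1 + 1) * INR n + 2); [|lra]. rewrite Hr. field. lra.
Qed.

Lemma wallis_odd n : wallis (S (2 * n)) * ((2 * INR n + 1) * h n) = 1.
Proof.
  induction n as [|n IH]; [rewrite Nat.mul_0_r, wallis_1; simpl; ring|].
  replace (2 * S n)%nat with (S (S (2 * n))) by lia. pose proof (wallis_rec (S (2 * n))) as Hr.
  rewrite S_INR, mult_INR in Hr. simpl (INR 2) in Hr. rewrite h_S, S_INR. pose proof (pos_INR n).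
  transitivity (wallis (S (2 * n)) * ((2 * INR n + 1) * h n)); [|exact IH].
  transitivity (((1 + 1) * INR n + 1 + 2) * wallis (S (S (S (2 * n)))) * (h n * ((2 * INR n + 1) / (2 * INR n + 2)))); [ring|].
  rewrite Hr. field. lra.
Qed.

(** Even integrals are (pi/2) h n and odd ones 1 / ((2n+1) h n). Comparing consecutive integrals,
    here and in [h_sq_PI_upper], pins h n ^ 2 to 1 / (pi n) up to a relative O(1/n). *)
Lemma h_sq_PI_lower n : 2 / (PI * (2 * INR n + 1)) <= h n ^ 2.
Proof.
  pose proof PI_RGT_0. pose proof (pos_INR n). pose proof (h_pos n).
  pose proof (wallis_decr (2 * n)) as Hd. rewrite wallis_even in Hd. pose proof (wallis_odd n) as Ho.
  apply Rle_div_l; [nra|].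
  assert (wallis (S (2 * n)) * ((2 * INR n + 1) * h n) <= PI / 2 * h n * ((2 * INR n + 1) * h n)).
  { apply Rmult_le_compat_r; nra. }
  lra.
Qed.

Lemma h_sq_PI_upper n : (1 <= n)%nat -> h n ^ 2 * (PI * INR n) <= 1.
Proof.
  intros Hn. destruct n as [|n]; [lia|].
  pose proof PI_RGT_0. pose proof (pos_INR n). pose proof (h_pos n). pose proof (h_pos (S n)).
  pose proof (wallis_decr (S (2 * n))) as Hd. replace (S (S (2 * n))) with (2 * S n)%nat in Hd by lia.
  rewrite wallis_even in Hd. pose proof (wallis_odd n) as Ho.
  assert (E : (2 * INR n + 1) * h n = 2 * INR (S n) * h (S n)).
  { rewrite h_S, S_INR. field. lra. }
  rewrite E in Ho. rewrite S_INR in *.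
  assert (PI / 2 * h (S n) * (2 * (INR n + 1) * h (S n)) <= wallis (S (2 * n)) * (2 * (INR n + 1) * h (S n))).
  { apply Rmult_le_compat_r; nra. }
  lra.
Qed.

Lemma h_asymptotic n : (1 <= n)%nat -> Rabs (h n * sqrt (PI * INR n) - 1) <= / INR n.
Proof.
  intros Hn. pose proof PI_RGT_0. assert (HnR : 1 <= INR n) by (apply le_INR in Hn; simpl in Hn; lra).
  pose proof (h_pos n). set (x := h n * sqrt (PI * INR n)).
  assert (Hx0 : 0 <= x) by (apply Rmult_le_pos; [lra|apply sqrt_pos]).
  assert (Hx2 : x * x = h n ^ 2 * (PI * INR n)).
  { unfold x. replace (h n * sqrt (PI * INR n) * (h n * sqrt (PI * INR n)))
      with (h n ^ 2 * (sqrt (PI * INR n) * sqrt (PI * INR n))) by ring. rewrite sqrt_sqrt by nra. ring. }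
  pose proof (h_sq_PI_upper n Hn) as Hu. rewrite <- Hx2 in Hu.
  pose proof (h_sq_PI_lower n) as Hl.
  assert (Hl2 : 1 - / INR n <= x * x).
  { rewrite Hx2. apply Rle_trans with (2 / (PI * (2 * INR n + 1)) * (PI * INR n)).
    - replace (2 / (PI * (2 * INR n + 1)) * (PI * INR n)) with (1 - / (2 * INR n + 1)) by (field; nra).
      assert (/ (2 * INR n + 1) <= / INR n) by (apply Rinv_le_contravar; lra). lra.
    - apply Rmult_le_compat_r; [nra|assumption]. }
  assert (Hx1 : x <= 1) by nra.
  (* For 0 <= x <= 1 the defect 1 - x is at most 1 - x^2. *)
  rewrite Rabs_left1 by lra. assert (x * x <= x) by nra. lra.
Qed.

(** * The series Q *)

Lemma CV_radius_ge (a : ser) R M : 0 < R -> (forall n, Rabs (a n * R ^ n) <= M) -> Rbar_le R (CV_radius a).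
Proof. intros HR HM. apply CV_radius_bounded. now exists M. Qed.

Lemma bounded_expd (a : ser) R M x : 0 < x < R -> (forall n, Rabs (a n * R ^ n) <= M) -> expd (scale x a).
Proof.
  intros Hx HM. exists ((1 + R / x) / 2).
  assert (Hq : 1 < R / x) by (apply Rlt_div_r; lra). split; [lra|].
  apply summable_of_bound with M (x / R).
  - eapply Rle_trans; [|apply (HM O)]. apply Rabs_pos.
  - left. apply Rdiv_lt_0_compat; lra.
  - lra.
  - replace (x / R * ((1 + R / x) / 2)) with ((x / R + 1) / 2) by (field; lra).
    assert (x / R < 1) by (apply Rlt_div_l; lra). lra.
  - intros n. unfold scale. replace (a n * x ^ n) with (a n * R ^ n * (x / R) ^ n).
    + rewrite Rabs_mult, (Rabs_pos_eq ((x / R) ^ n)) by (apply pow_le; left; apply Rdiv_lt_0_compat; lra).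
      apply Rmult_le_compat_r; [apply pow_le; left; apply Rdiv_lt_0_compat; lra|apply HM].
    + rewrite Rmult_assoc, <- Rpow_mult_distr. do 2 f_equal. field. lra.
Qed.

(** A partial sum, being polynomial, still exceeds 1 at some x1 < R. Inside the disk the series is
    continuous, which may fail at R, so the intermediate value theorem is used on [0, x1]. *)
Lemma series_reaches_one (a : ser) R M N :
  0 < R -> (forall n, 0 <= a n) -> a O = 0 -> (forall n, Rabs (a n * R ^ n) <= M) ->
  1 < sum_f_R0 (scale R a) N -> exists r, 0 < r < R /\ is_series (fun n => a n * r ^ n) 1.
Proof.
  intros HR Ha H0 HM HN.
  assert (Hcv : forall x, 0 <= x < R -> Rbar_lt (Rabs x) (CV_radius a)).
  { intros x Hx. eapply Rbar_lt_le_trans; [|apply (CV_radius_ge a R M HR HM)]. simpl.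
    rewrite Rabs_pos_eq; lra. }
  assert (Hex : forall x, 0 <= x < R -> is_series (fun n => a n * x ^ n) (PSeries a x)).
  { intros x Hx. apply Series_correct. apply ex_series_Rabs.
    apply CV_disk_inside. now apply Hcv. }
  assert (Hpol : exists x1, 0 < x1 < R /\ 1 < sum_f_R0 (scale x1 a) N).
  { assert (Hc : continuity_pt (fun x => sum_f_R0 (fun k => a k * x ^ k) N) R).
    { apply derivable_continuous_pt, derivable_pt_finite_sum. }
    destruct (Hc (sum_f_R0 (scale R a) N - 1)) as (al & Hal & Hd); [lra|].
    set (x1 := R - Rmin (al / 2) (R / 2)).
    assert (Hm : 0 < Rmin (al / 2) (R / 2)) by (apply Rmin_glb_lt; lra).
    pose proof (Rmin_l (al / 2) (R / 2)). pose proof (Rmin_r (al / 2) (R / 2)).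
    exists x1. split; [unfold x1; lra|].
    specialize (Hd x1). simpl in Hd. unfold R_dist in Hd.
    assert (Hlt : Rabs (sum_f_R0 (fun k => a k * x1 ^ k) N - sum_f_R0 (fun k => a k * R ^ k) N) < sum_f_R0 (scale R a) N - 1).
    { apply Hd. split.
      - split; [exact I|]. unfold x1; lra.
      - unfold x1. rewrite Rabs_left; lra. }
    apply Rabs_lt_between in Hlt. unfold scale in *. lra. }
  destruct Hpol as (x1 & Hx1 & Hs1).
  destruct (IVT_interv (fun x => PSeries a x - 1) 0 x1) as (z & Hz & Hz0).
  - intros x Hx. apply (continuity_pt_minus (PSeries a) (fun _ => 1)).
    + apply PSeries_continuity, Hcv. lra.
    + apply continuity_pt_const. intros u v; reflexivity.
  - lra.
  - rewrite PSeries_0, H0. lra.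
  - pose proof (series_partial_le (fun n => a n * x1 ^ n) _ N (fun k => Rmult_le_pos _ _ (Ha k) (pow_le x1 k ltac:(lra))) (Hex x1 ltac:(lra))).
    unfold scale in Hs1. lra.
  - exists z. assert (Hz1 : z <> 0).
    { intros ->. rewrite PSeries_0, H0 in Hz0. lra. }
    split; [lra|]. replace 1 with (PSeries a z) by lra. apply Hex. lra.
Qed.

Lemma sum_wt_unbounded B : exists n, B < sum_f_R0 wt n.
Proof.
  assert (H : forall n, INR n + 2 <= exp (sum_f_R0 wt n)).
  { induction n as [|n IH].
    - simpl sum_f_R0. unfold wt. simpl INR. replace (/ (0 + 1)) with 1 by field.
      pose proof (exp_ineq1_le 1). lra.
    - cbn [sum_f_R0]. rewrite exp_plus, S_INR. pose proof (exp_ineq1_le (wt (S n))) as He.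
      unfold wt in He. rewrite S_INR in He. pose proof (pos_INR n).
      apply Rle_trans with ((INR n + 2) * (1 + / (INR n + 1 + 1))); [right; field; lra|].
      unfold wt at 2. rewrite S_INR.
      assert (0 < / (INR n + 1 + 1)) by (apply Rinv_0_lt_compat; lra).
      apply Rmult_le_compat; lra. }
  destruct (INR_unbounded (exp B)) as [n Hn]. exists n. apply exp_lt_inv. specialize (H n). lra.
Qed.

Lemma sum_shift_le (a : nat -> R) m n : (forall k, 0 <= a k) -> (1 <= m)%nat ->
  sum_f_R0 (fun k => a (m + k)%nat) n <= sum_f_R0 a (m + n).
Proof.
  intros Ha Hm. rewrite (tech2 a (m - 1) (m + n)) by lia.
  replace (m + n - S (m - 1))%nat with n by lia.
  rewrite (sum_eq (fun i => a (S (m - 1) + i)%nat) (fun k => a (m + k)%nat)) by (intros; f_equal; lia).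
  pose proof (cond_pos_sum a (m - 1) Ha). lra.
Qed.

Lemma drop_summable (a : ser) m : summable a -> summable (drop m a).
Proof.
  intros [N HN]. exists N. intros n. eapply Rle_trans; [|apply (HN (m + n)%nat)].
  destruct m as [|m].
  - apply Req_le, sum_eq. intros k _. unfold drop. now rewrite Nat.add_0_r.
  - eapply Rle_trans; [|apply (sum_shift_le (fun k => Rabs (a k))); [intros; apply Rabs_pos|lia]].
    apply Req_le, sum_eq. intros k _. unfold drop. now rewrite Nat.add_comm.
Qed.

Lemma ev_drop (a : ser) m : summable a -> ev a = sum_f_R0 a m + ev (drop (S m) a).
Proof.
  intros [N HN]. unfold ev. rewrite (Series_incr_n a (S m)); [|lia|now apply l1_ex_series with N].
  simpl pred. f_equal. apply Series_ext. intros k. unfold drop. f_equal. lia.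
Qed.

Lemma jumpP_pos c d p t : (forall i : Z, 0 <= p i) -> p (- Z.of_nat c)%Z <> 0 -> 0 < t -> 0 < jumpP c d p t.
Proof.
  intros Hp Hpc Ht. unfold jumpP. replace (Z.of_nat d) with (- Z.of_nat c + Z.of_nat (c + d))%Z by lia. rewrite zsum_seq.
  set (f := fun k => p (- Z.of_nat c + Z.of_nat k)%Z * powerRZ t (- Z.of_nat c + Z.of_nat k)).
  assert (Hf : forall k, 0 <= f k) by (intros k; apply Rmult_le_pos; [apply Hp|now apply powerRZ_le]).
  apply Rlt_le_trans with (f O); [|apply (sum_pos_mono f 0); [assumption|lia]].
  unfold f. rewrite Z.add_0_r. specialize (Hp (- Z.of_nat c)%Z). apply Rmult_lt_0_compat; [lra|now apply powerRZ_lt].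
Qed.

Lemma D_inverse c d p q dn : D_coeffs c d p q dn -> ((cst 1 - Qcoef c d p q) * dn = cst 1)%ser.
Proof.
  intros [H0 HS]. replace ((cst 1 - Qcoef c d p q) * dn)%ser with (dn - Qcoef c d p q * dn)%ser by ring.
  apply functional_extensionality. intros [|n]; rewrite ssubE, smulE.
  - simpl. rewrite H0. ring.
  - rewrite decomp_sum by lia. cbn [pred]. rewrite HS. simpl (Qcoef c d p q 0).
    match goal with |- ?x - (_ + ?y) = _ => change y with x end. simpl cst. ring.
Qed.

Lemma D_inverse_scale c d p q dn r : D_coeffs c d p q dn -> ((cst 1 - scale r (Qcoef c d p q)) * scale r dn = cst 1)%ser.
Proof.
  intros H. rewrite <- (scale_cst r 1) at 1. rewrite <- scale_sub, <- scale_mul, D_inverse by assumption.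
  apply scale_cst.
Qed.

Section QSeries.
Context (c d : nat) (p : Z -> R) (q : R).
Context (Hc : (1 <= c)%nat) (Hd : (1 <= d)%nat) (Hp : forall i : Z, 0 <= p i)
  (Hsupp : forall i : Z, (i < - Z.of_nat c)%Z \/ (Z.of_nat d < i)%Z -> p i = 0)
  (Hpc : p (- Z.of_nat c)%Z <> 0) (Hpd : p (Z.of_nat d) <> 0) (Hq : 0 < q).

Lemma jump_walk t : 0 < t -> walk c d (tilted_step c p t (/ jumpP c d p t))
  (tilted_mu c d p t (/ jumpP c d p t)) (tilted_nu c d p t (/ jumpP c d p t)).
Proof.
  intros Ht. pose proof (jumpP_pos c d p t Hp Hpc Ht). apply tilted_walk; auto.
  - now apply Rinv_0_lt_compat.
  - rewrite (tilted_step_sum c d p Hsupp). apply Rinv_r. lra.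
Qed.

Definition raw (n : nat) : ser := fun k => meander_count c d p n (Z.of_nat k).

Lemma raw_tilted t r n k : raw n k * t ^ k * r ^ n = tilted_mu c d p t r n k.
Proof. reflexivity. Qed.

(** Transfers positivity and finite support from the normalised walk to the plain counts. *)
Lemma raw_eq_tilted_1 n k :
  raw n k = jumpP c d p 1 ^ n * tilted_mu c d p 1 (/ jumpP c d p 1) n k.
Proof.
  rewrite <- raw_tilted. pose proof (jumpP_pos c d p 1 Hp Hpc ltac:(lra)).
  rewrite pow1, pow_inv. field. apply pow_nonzero. lra.
Qed.

Lemma raw_pos n k : 0 <= raw n k.
Proof.
  rewrite raw_eq_tilted_1. pose proof (jumpP_pos c d p 1 Hp Hpc ltac:(lra)).
  apply Rmult_le_pos; [apply pow_le; lra|]. apply (mu_pos _ _ _ _ _ (jump_walk 1 ltac:(lra))).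
Qed.

Lemma raw_fin n k : (d * n < k)%nat -> raw n k = 0.
Proof.
  intros Hk. rewrite raw_eq_tilted_1, (mu_fin _ _ _ _ _ (jump_walk 1 ltac:(lra))) by assumption. ring.
Qed.

Lemma raw_summable n : summable (raw n).
Proof. apply summable_finite with (d * n)%nat. apply raw_fin. Qed.

(** Index j stands for altitude j + 1. The term is retained when a jump leads from there to 0, that
    is when a catastrophe is not allowed. *)
Definition kept (j : nat) (x : R) : R := if Req_EM_T (p (- Z.of_nat (S j))%Z) 0 then 0 else x.

Lemma Qcoef_S n : Qcoef c d p q (S n) =
  q * (ev (raw n) - raw n 0%nat - sum_f_R0 (fun j => kept j (raw n (S j))) (c - 1)).
Proof.
  cbn [Qcoef]. rewrite meander_total_sum, (ev_finite _ (d * n)) by apply raw_fin.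
  assert (Ez : forall f, zsum f 1 (Z.of_nat c) = sum_f_R0 (fun k => f (1 + Z.of_nat k)%Z) (c - 1))
    by (intros f; rewrite <- zsum_seq; f_equal; lia).
  rewrite Ez. f_equal. f_equal. apply sum_eq. intros j _. unfold kept, raw.
  replace (1 + Z.of_nat j)%Z with (Z.of_nat (S j)) by lia. reflexivity.
Qed.

(** No jump reaches 0 from above altitude c, so a catastrophe is always available there. *)
Lemma Qcoef_lower n : q * ev (drop (S c) (raw n)) <= Qcoef c d p q (S n).
Proof.
  rewrite Qcoef_S. apply Rmult_le_compat_l; [lra|]. rewrite (ev_drop (raw n) c) by apply raw_summable.
  rewrite decomp_sum by lia. replace (pred c) with (c - 1)%nat by lia.
  assert (sum_f_R0 (fun j => kept j (raw n (S j))) (c - 1) <= sum_f_R0 (fun i => raw n (S i)) (c - 1)); [|lra].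
  apply sum_Rle. intros j _. unfold kept. destruct (Req_EM_T _ _); [apply raw_pos|lra].
Qed.

Lemma ev_drop_raw_pos n : 0 <= ev (drop (S c) (raw n)).
Proof. apply ev_nonneg; [apply drop_summable, raw_summable|intros; apply raw_pos]. Qed.

Lemma Qcoef_pos n : 0 <= Qcoef c d p q n.
Proof.
  destruct n as [|n]; [simpl; lra|]. eapply Rle_trans; [|apply Qcoef_lower].
  apply Rmult_le_pos; [lra|apply ev_drop_raw_pos].
Qed.

Lemma Qcoef_ge_raw n k : (c < k)%nat -> q * raw n k <= Qcoef c d p q (S n).
Proof.
  intros Hk. eapply Rle_trans; [|apply Qcoef_lower]. apply Rmult_le_compat_l; [lra|].
  replace (raw n k) with (drop (S c) (raw n) (k - S c)%nat) by (unfold drop; f_equal; lia).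
  eapply Rle_trans; [apply coef_le_partial_sum; intros; apply raw_pos|].
  apply ev_ge_partial; [apply drop_summable, raw_summable|intros; apply raw_pos].
Qed.

Lemma Qcoef_upper n : Qcoef c d p q (S n) <= q * ev (raw n).
Proof.
  rewrite Qcoef_S. apply Rmult_le_compat_l; [lra|]. pose proof (raw_pos n 0).
  assert (0 <= sum_f_R0 (fun j => kept j (raw n (S j))) (c - 1)); [|lra].
  apply cond_pos_sum. intros j. unfold kept. destruct (Req_EM_T _ _); [lra|apply raw_pos].
Qed.

(** The path of n steps of size d ends above c. This supplies the adjacent atoms for the renewal
    estimates. *)
Lemma Qcoef_positive n : (c < n)%nat -> 0 < Qcoef c d p q (S n).
Proof.
  intros Hn. eapply Rlt_le_trans; [|apply (Qcoef_ge_raw n (d * n + 0)); nia].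
  apply Rmult_lt_0_compat; [assumption|]. rewrite raw_eq_tilted_1.
  pose proof (jumpP_pos c d p 1 Hp Hpc ltac:(lra)). pose proof (jump_walk 1 ltac:(lra)) as HW.
  apply Rmult_lt_0_compat; [now apply pow_lt|].
  pose proof (mu_up _ _ _ _ _ HW 0 n 0) as Hu. rewrite Nat.add_0_r in Hu at 1.
  rewrite (wk_0 _ _ _ _ _ HW) in Hu. simpl cst in Hu. rewrite Rmult_1_r in Hu.
  eapply Rlt_le_trans; [|exact Hu]. apply pow_lt, HW.
Qed.

(** For t >= 1 the factor t^k only increases weights, so plain totals are dominated by the survival
    probability of the tilted walk. Hence [Q] has radius of convergence at least 1 / P(t). *)
Lemma Qcoef_bounded t n : 1 <= t ->
  Rabs (Qcoef c d p q n * (/ jumpP c d p t) ^ n) <= q * / jumpP c d p t.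
Proof.
  intros Ht. pose proof (jumpP_pos c d p t Hp Hpc ltac:(lra)) as HP. set (r := / jumpP c d p t).
  assert (Hr : 0 < r) by now apply Rinv_0_lt_compat.
  rewrite Rabs_pos_eq by (apply Rmult_le_pos; [apply Qcoef_pos|apply pow_le; lra]).
  destruct n as [|n]; [simpl; nra|].
  pose proof (jump_walk t ltac:(lra)) as HW. fold r in HW.
  assert (Hl : ev (raw n) * r ^ n <= 1).
  { eapply Rle_trans; [|apply (alive_le_1 _ _ _ _ _ HW n)]. unfold alive.
    rewrite Rmult_comm, <- sev_cst_mul by apply raw_summable. apply ev_mono.
    - apply summable_mul; [apply summable_cst|apply raw_summable].
    - apply (mu_summable _ _ _ _ _ HW).
    - intros k. rewrite cst_mul, <- raw_tilted. pose proof (raw_pos n k). pose proof (pow_R1_Rle t k Ht).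
      pose proof (pow_lt r n Hr). assert (0 <= r ^ n * raw n k) by nra. nra. }
  pose proof (Qcoef_upper n). simpl pow. pose proof (pow_lt r n Hr).
  apply Rle_trans with (q * ev (raw n) * (r * r ^ n)).
  { apply Rmult_le_compat_r; [apply Rmult_le_pos; lra|assumption]. }
  replace (q * ev (raw n) * (r * r ^ n)) with (q * r * (ev (raw n) * r ^ n)) by ring.
  rewrite <- (Rmult_1_r (q * r)) at 2. apply Rmult_le_compat_l; nra.
Qed.

(** At tilt 1 the drift is nonnegative, so survival is at least of order 1 / n; c + 1 further steps
    of size d lead above altitude c, and the coefficients dominate a harmonic series. *)
Lemma Q_series_diverges : 0 <= jump_derivative c d p 1 ->
  exists N, 1 < sum_f_R0 (scale (/ jumpP c d p 1) (Qcoef c d p q)) N.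
Proof.
  intros Hdel. pose proof (jumpP_pos c d p 1 Hp Hpc ltac:(lra)) as HP. set (r := / jumpP c d p 1).
  assert (Hr : 0 < r) by now apply Rinv_0_lt_compat.
  pose proof (jump_walk 1 ltac:(lra)) as HW. fold r in HW.
  set (P := tilted_step c p 1 r) in *. set (mu := tilted_mu c d p 1 r) in *.
  assert (HdR : 1 <= INR d) by (apply le_INR in Hd; simpl in Hd; lra).
  (* The weight of a catastrophe and of its time unit, the cost of c + 1 top steps, and 1 / d from
     [alive_lower]. *)
  set (K := q * r * (P (c + d)%nat ^ S c * / INR d)).
  assert (HK : 0 < K).
  { unfold K. apply Rmult_lt_0_compat; [nra|]. apply Rmult_lt_0_compat; [apply pow_lt, HW|apply Rinv_0_lt_compat; lra]. }
  set (a := scale r (Qcoef c d p q)).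
  assert (Ha : forall n, 0 <= a n) by (intros n; apply Rmult_le_pos; [apply Qcoef_pos|apply pow_le; lra]).
  assert (Hlow : forall n, K * wt n <= a (S (S c) + n)%nat).
  { intros n. change (S (S c) + n)%nat with (S (S c + n)).
    assert (Hmean : INR c <= ev (theta P)).
    { unfold P. rewrite (tilted_step_mean c d p Hsupp) by lra. unfold r at 1. rewrite Rinv_r by lra. nra. }
    pose proof (alive_lower _ _ _ _ _ HW n Hmean) as Hal. rewrite mult_INR in Hal.
    assert (Hal2 : wt n <= INR d * alive mu n).
    { apply Rmult_le_reg_l with (INR n + 1); [pose proof (pos_INR n); lra|]. rewrite Rmult_comm, wt_mul.
      eapply Rle_trans; [exact Hal|]. pose proof (alive_nonneg _ _ _ _ _ HW n). pose proof (pos_INR n).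
      replace ((INR n + 1) * (INR d * alive mu n)) with ((INR n + 1) * INR d * alive mu n) by ring.
      apply Rmult_le_compat_r; nra. }
    assert (Hev : P (c + d)%nat ^ S c * alive mu n <= ev (drop (S c) (mu (S c + n)%nat))).
    { unfold alive. pose proof (mu_summable _ _ _ _ _ HW) as Hs.
      apply Rle_trans with (ev (drop (d * S c) (mu (S c + n)%nat))).
      - rewrite <- sev_cst_mul by apply Hs. apply ev_mono.
        + apply summable_mul; [apply summable_cst|apply Hs].
        + apply drop_summable, Hs.
        + intros k. rewrite cst_mul. unfold drop. rewrite (Nat.add_comm k). apply (mu_up _ _ _ _ _ HW).
      - set (x := mu (S c + n)%nat). assert (Hx : forall k, 0 <= x k) by (intros; apply (mu_pos _ _ _ _ _ HW)).
        destruct (Nat.eq_dec (d * S c) (S c)) as [->|Hne]; [lra|].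
        rewrite (ev_drop (drop (S c) x) (d * S c - S c - 1)) by (apply drop_summable, Hs).
        replace (drop (S (d * S c - S c - 1)) (drop (S c) x)) with (drop (d * S c) x).
        + pose proof (cond_pos_sum (drop (S c) x) (d * S c - S c - 1) (fun k => Hx _)). lra.
        + apply functional_extensionality. intros k. unfold drop. f_equal. nia. }
    unfold a, scale. apply Rle_trans with (q * ev (drop (S c) (raw (S c + n))) * r ^ S (S c + n)).
    2:{ apply Rmult_le_compat_r; [apply pow_le; lra|apply Qcoef_lower]. }
    assert (Er : ev (drop (S c) (mu (S c + n)%nat)) = r ^ (S c + n) * ev (drop (S c) (raw (S c + n)))).
    { rewrite <- sev_cst_mul by apply drop_summable, raw_summable. f_equal.
      apply functional_extensionality. intros k. rewrite cst_mul. unfold drop, mu. rewrite <- raw_tilted, pow1. ring. }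
    replace (q * ev (drop (S c) (raw (S c + n))) * r ^ S (S c + n))
      with (q * r * (r ^ (S c + n) * ev (drop (S c) (raw (S c + n))))) by (rewrite <- tech_pow_Rmult; ring).
    rewrite <- Er. unfold K. rewrite Rmult_assoc. apply Rmult_le_compat_l; [nra|].
    eapply Rle_trans; [|exact Hev]. rewrite Rmult_assoc. apply Rmult_le_compat_l; [apply pow_le, HW|].
    apply Rmult_le_reg_l with (INR d); [lra|]. rewrite <- Rmult_assoc, Rinv_r by lra. lra. }
  destruct (sum_wt_unbounded (/ K)) as [n Hn]. exists (S (S c) + n)%nat. fold a.
  eapply Rlt_le_trans; [|apply sum_shift_le; [assumption|lia]].
  apply Rlt_le_trans with (K * sum_f_R0 wt n).
  - apply Rmult_lt_compat_l with (r := K) in Hn; [|assumption]. rewrite Rinv_r in Hn; lra.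
  - rewrite <- sum_mul_l. apply sum_Rle. intros; apply Hlow.
Qed.

(** Undoing the tilt multiplies the weight at altitude k by t^(-k), so the total over altitudes is
    the value of the tilted walk at v = 1 / t, admissible because t > 1. *)
Lemma W_scale_Q K t C : (2 <= K)%nat -> 1 < t -> 
  step_law (srev (c + d) (tilted_step c p t (/ jumpP c d p t))) d C ->
  W K (scale (/ jumpP c d p t) (Qcoef c d p q)).
Proof.
  intros HK Ht HS. set (r := / jumpP c d p t) in *.
  pose proof (jump_walk t ltac:(lra)) as HW. fold r in HW.
  destruct (walk_W _ _ _ _ _ C K HW HS HK) as [Hat Hval].
  set (mu := tilted_mu c d p t r) in *.
  assert (Hv : 0 <= / t < 1).
  { split; [left; apply Rinv_0_lt_compat; lra|]. rewrite <- Rinv_1. apply Rinv_lt_contravar; lra. }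
  assert (Hraw : forall n k, raw n k * r ^ n = mu n k * (/ t) ^ k).
  { intros n k. unfold mu. rewrite <- raw_tilted, pow_inv. field. apply pow_nonzero; lra. }
  set (sub := (fun n => sum_f_R0 (fun j => kept j (mu n (S j) * (/ t) ^ S j)) (c - 1)) : ser).
  assert (E : scale r (Qcoef c d p q) = (cst (r * q) * (var * (mu_value mu (/ t) - mu_at mu 0 - sub)))%ser).
  { apply functional_extensionality. intros [|n]; rewrite cst_mul.
    - rewrite var_mul_0. unfold scale. simpl. ring.
    - rewrite var_mul_S. unfold scale. rewrite Qcoef_S, !ssubE.
      replace (mu_value mu (/ t) n) with (ev (raw n) * r ^ n).
      + replace (mu_at mu 0 n) with (raw n 0%nat * r ^ n) by (rewrite Hraw; unfold mu_at; simpl; ring).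
        replace (sub n) with (sum_f_R0 (fun j => kept j (raw n (S j))) (c - 1) * r ^ n); [simpl pow; ring|].
        unfold sub. rewrite <- sum_mul_r. apply sum_eq. intros j _. rewrite <- Hraw. unfold kept.
        destruct (Req_EM_T _ _); ring.
      + rewrite Rmult_comm, <- sev_cst_mul by apply raw_summable. unfold mu_value. f_equal.
        apply functional_extensionality. intros k. rewrite cst_mul. unfold scale. rewrite <- Hraw. ring. }
  rewrite E. apply W_mul; [assumption|apply W_cst|]. apply W_mul; [assumption|apply W_V, V_var|].
  apply W_sub; [assumption| |].
  - apply W_sub; [assumption|now apply Hval|apply Hat].
  - unfold sub. generalize (c - 1)%nat as m. induction m as [|m IH].
    + simpl sum_f_R0. replace (fun n => kept 0 (mu n 1%nat * (/ t * 1))) with (cst (kept 0 (/ t)) * mu_at mu 1)%ser.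
      * apply W_mul; [assumption|apply W_cst|apply Hat].
      * apply functional_extensionality. intros n. rewrite cst_mul. unfold kept, mu_at. destruct (Req_EM_T _ _); ring.
    + replace (fun n => sum_f_R0 (fun j => kept j (mu n (S j) * (/ t) ^ S j)) (S m))
        with (sadd (fun n => sum_f_R0 (fun j => kept j (mu n (S j) * (/ t) ^ S j)) m)
          (cst (kept (S m) ((/ t) ^ S (S m))) * mu_at mu (S (S m)))).
      * apply W_add; [assumption|]. apply W_mul; [assumption|apply W_cst|apply Hat].
      * apply functional_extensionality. intros n. rewrite saddE, cst_mul. cbn [sum_f_R0]. f_equal.
        unfold kept, mu_at. destruct (Req_EM_T _ _); ring.
Qed.

(* If the singular coefficient vanished, the exit probabilities of the tilted walk would decay too fast
   for a centred walk. *)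
Lemma singular_coefficient_neg t A B : 0 < t ->
  jump_derivative c d p t = 0 -> V 4 A -> V 4 B ->
  scale (/ jumpP c d p t) (Qcoef c d p q) = (A + B * sq)%ser -> ev B < 0.
Proof.
  intros Ht Hmean HA HB E. destruct (Rlt_le_dec (ev B) 0) as [|Hge]; [assumption|exfalso].
  pose proof (jumpP_pos c d p t Hp Hpc Ht) as HP. set (r := / jumpP c d p t) in *.
  assert (Hr : 0 < r) by now apply Rinv_0_lt_compat.
  pose proof (jump_walk t Ht) as HW. fold r in HW.
  set (P := tilted_step c p t r) in *. set (mu := tilted_mu c d p t r) in *.
  destruct (W_coefs A B HA HB) as [C HC]. rewrite <- E in HC.
  (* Coefficients of sqrt(1-z) are negative from index 1 on; if [ev B] >= 0 the main term only
     lowers the coefficients, and the remainder alone bounds them. *)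
  assert (HQ : forall n, scale r (Qcoef c d p q) (S n) <= C * (h (S n) * wt (S n) ^ 2)).
  { intros n. specialize (HC (S n)). rewrite ssubE, cst_mul, sq_S in HC. apply Rabs_le_between in HC.
    pose proof (h_pos n). pose proof (wt_pos n). assert (0 <= ev B * (h n * wt n / 2)) by (apply Rmult_le_pos; nra). lra. }
  assert (HC0 : 0 <= C).
  { specialize (HC O). pose proof (h_wt_pos 0 2).
    pose proof (Rabs_pos ((scale r (Qcoef c d p q) - cst (ev B) * sq)%ser 0%nat)). nra. }
  set (s := S c).
  (* raise the final altitude above c by s up-steps *)
  assert (Hmu : forall k, (k < c)%nat -> exists L, forall n, mu n k <= L * (h n * wt n ^ 2)).
  { intros k Hk. set (k' := (d * s + k)%nat). set (a := P (c + d)%nat ^ s).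
    assert (Ha : 0 < a) by (apply pow_lt, HW).
    assert (Htk : 0 < t ^ k') by now apply pow_lt.
    exists (/ a * (t ^ k' / (r * q)) * C). intros n.
    assert (Hup : a * mu n k <= mu (s + n)%nat k') by apply (mu_up _ _ _ _ _ HW).
    pose proof (Qcoef_ge_raw (s + n) k' ltac:(unfold k', s; nia)) as Hlow.
    assert (Hq1 : r * q * mu (s + n)%nat k' <= t ^ k' * scale r (Qcoef c d p q) (S (s + n))).
    { unfold scale, mu. rewrite <- raw_tilted. change (r ^ S (s + n)) with (r * r ^ (s + n)).
      replace (r * q * (raw (s + n) k' * t ^ k' * r ^ (s + n))) with (t ^ k' * (q * raw (s + n) k' * (r * r ^ (s + n)))) by ring.
      apply Rmult_le_compat_l; [lra|]. apply Rmult_le_compat_r; [|assumption].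
      apply Rmult_le_pos; [lra|apply pow_le; lra]. }
    specialize (HQ (s + n)%nat).
    assert (Hmon : h (S (s + n)) * wt (S (s + n)) ^ 2 <= h n * wt n ^ 2).
    { apply Rmult_le_compat; [left; apply h_pos|left; apply wt_pow_pos|apply h_decr; lia|].
      apply pow_incr. split; [left; apply wt_pos|apply wt_mono; lia]. }
    assert (Hrq : 0 < r * q) by nra.
    apply Rmult_le_reg_l with (a * (r * q)); [nra|].
    replace (a * (r * q) * (/ a * (t ^ k' / (r * q)) * C * (h n * wt n ^ 2)))
      with (t ^ k' * (C * (h n * wt n ^ 2))) by (field; split; [lra|split; lra]).
    apply Rle_trans with (r * q * mu (s + n)%nat k').
    - replace (a * (r * q) * mu n k) with (r * q * (a * mu n k)) by ring. apply Rmult_le_compat_l; lra.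
    - eapply Rle_trans; [exact Hq1|]. apply Rmult_le_compat_l; [lra|]. eapply Rle_trans; [exact HQ|].
      apply Rmult_le_compat_l; assumption. }
  assert (Hsum : forall m, (m < c)%nat -> exists L, forall n, sum_f_R0 (mu n) m <= L * (h n * wt n ^ 2)).
  { induction m as [|m IH]; intros Hm; [exact (Hmu O Hm)|].
    destruct (IH ltac:(lia)) as [L HL]. destruct (Hmu (S m) Hm) as [L' HL']. exists (L + L').
    intros n. cbn [sum_f_R0]. specialize (HL n). specialize (HL' n). lra. }
  destruct (Hsum (c - 1)%nat ltac:(lia)) as [L HL].
  apply (exits_not_small _ _ _ _ _ HW L).
  - unfold P. rewrite (tilted_step_mean c d p Hsupp) by assumption. rewrite Hmean. unfold r. rewrite Rinv_r by lra. ring.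
  - intros n. eapply Rle_trans; [|apply HL]. unfold exits. rewrite (ev_finite _ (c - 1)).
    + rewrite (sum_eq _ (P * mu n)%ser) by (intros k Hk; apply (walk_exit _ _ _ _ _ HW); lia).
      rewrite <- (Rmult_1_l (sum_f_R0 (mu n) (c - 1))). apply smul_sum_le.
      * apply HW.
      * apply (mu_pos _ _ _ _ _ HW).
      * rewrite <- (wk_mass _ _ _ _ _ HW). apply ev_ge_partial; [apply (P_summable _ _ _ _ _ HW)|apply HW].
      * lra.
    + intros k Hk. apply HW. lia.
Qed.

End QSeries.

(** * Asymptotics *)

(** The square is 1 - x, so only the sign is in question. All coefficients after the first are
    negative, so partial sums at x dominate those at 1, which are h n > 0. *)
Lemma ev_scale_sq x : 0 < x < 1 -> ev (scale x sq) = sqrt (1 - x).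
Proof.
  intros Hx. assert (Hsm : forall a, summable a -> summable (scale x a)).
  { intros a Ha. apply (scale_smaller_summable 1 x); [lra|]. now rewrite scale_1. }
  assert (H2 : ev (scale x sq) * ev (scale x sq) = 1 - x).
  { rewrite <- sev_mul by apply Hsm, sq_summable. rewrite <- scale_mul, sq_mul_sq.
    rewrite (ev_finite _ 1).
    - unfold scale, omu. cbn [sum_f_R0]. rewrite !ssubE. unfold var. simpl. ring.
    - intros [|[|n]] Hn; [lia|lia|]. unfold scale, omu. rewrite ssubE. unfold var. simpl. ring. }
  assert (H0 : 0 <= ev (scale x sq)).
  { destruct (Hsm sq sq_summable) as [N HN].
    apply (is_lim_seq_le (fun _ => 0) (sum_n (scale x sq)) 0 (ev (scale x sq))).
    - intros n. rewrite sum_n_sum_f. apply Rle_trans with (sum_f_R0 sq n).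
      + rewrite <- geom_mul. unfold sq. replace (geom * (omu * hs))%ser with ((omu * geom) * hs)%ser by ring.
        rewrite omu_geom, cst_mul. unfold hs. pose proof (h_pos n). lra.
      + apply sum_Rle. intros [|k] _; unfold scale; [simpl; lra|]. rewrite sq_S.
        pose proof (h_pos k). pose proof (wt_pos k). assert (0 < h k * wt k) by nra.
        assert (x ^ S k <= 1) by (rewrite <- (pow1 (S k)); apply pow_incr; lra). nra.
    - apply is_lim_seq_const.
    - eapply ev_is_series; eauto. }
  symmetry. apply sqrt_lem_1; lra.
Qed.

Lemma ev_scale_lipschitz a x N : 0 < x < 1 -> summable a -> l1 (tails a) N ->
  Rabs (ev (scale x a) - ev a) <= N * (1 - x).
Proof.
  intros Hx Ha HN.
  assert (Hsm : forall a, summable a -> summable (scale x a)).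
  { intros b Hb. apply (scale_smaller_summable 1 x); [lra|]. now rewrite scale_1. }
  assert (Hl : l1 (scale x (tails a)) N).
  { apply l1_dom with (2 := HN). intros n. unfold scale. rewrite Rabs_mult, (Rabs_pos_eq (x ^ n)) by (apply pow_le; lra).
    pose proof (Rabs_pos (tails a n)). assert (x ^ n <= 1) by (rewrite <- (pow1 n); apply pow_incr; lra).
    pose proof (pow_le x n ltac:(lra)). nra. }
  assert (E : ev (scale x a) = ev a - (1 - x) * ev (scale x (tails a))).
  { rewrite (omu_tails a) at 1. rewrite scale_sub, scale_mul, scale_cst.
    assert (Hst : summable (scale x (tails a))) by (eexists; eauto).
    rewrite sev_sub, sev_mul, ev_cst; auto using summable_cst, summable_mul, summable_omu.
    f_equal. f_equal. unfold omu. rewrite scale_sub, sev_sub, scale_cst, ev_cst by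
      (apply Hsm; auto using summable_cst, summable_var).
    rewrite (ev_finite (scale x var) 1); [unfold scale, var; simpl; ring|].
    intros [|[|n]] Hn; [lia|lia|]. unfold scale, var. ring. }
  rewrite E. replace (ev a - (1 - x) * ev (scale x (tails a)) - ev a) with (- ((1 - x) * ev (scale x (tails a)))) by ring.
  rewrite Rabs_Ropp, Rabs_mult, (Rabs_pos_eq (1 - x)), Rmult_comm by lra.
  apply Rmult_le_compat_r; [lra|]. now apply ev_bound.
Qed.

Lemma W_puiseux a b : V 4 a -> V 4 b -> exists C, forall x, 0 < x < 1 ->
  Rabs (ev (scale x (a + b * sq)) - (ev a + ev b * sqrt (1 - x))) <= C * (1 - x).
Proof.
  intros Ha Hb.
  assert (Hsa : summable a) by (now apply (V_summable 4); [lia|]).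
  assert (Hsb : summable b) by (now apply (V_summable 4); [lia|]).
  destruct (V_summable 3 (tails a) ltac:(lia) (V_tails 3 a ltac:(lia) Ha)) as [N HN].
  destruct (V_summable 3 (tails b) ltac:(lia) (V_tails 3 b ltac:(lia) Hb)) as [M HM].
  exists (N + M). intros x Hx.
  assert (Hsm : forall a, summable a -> summable (scale x a)).
  { intros u Hu. apply (scale_smaller_summable 1 x); [lra|]. now rewrite scale_1. }
  rewrite scale_add, scale_mul, sev_add, sev_mul, ev_scale_sq; auto using summable_mul, sq_summable.
  pose proof (ev_scale_lipschitz a x N Hx Hsa HN) as H1. pose proof (ev_scale_lipschitz b x M Hx Hsb HM) as H2.
  replace (ev (scale x a) + ev (scale x b) * sqrt (1 - x) - (ev a + ev b * sqrt (1 - x)))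
    with ((ev (scale x a) - ev a) + (ev (scale x b) - ev b) * sqrt (1 - x)) by ring.
  eapply Rle_trans; [apply Rabs_triang|]. rewrite Rabs_mult, Rmult_plus_distr_r.
  apply Rplus_le_compat; [assumption|].
  rewrite (Rabs_pos_eq (sqrt _)) by apply sqrt_pos.
  assert (sqrt (1 - x) <= 1) by (apply Rle_trans with (sqrt 1); [apply sqrt_le_1_alt; lra|rewrite sqrt_1; lra]).
  rewrite <- (Rmult_1_r (M * (1 - x))). apply Rmult_le_compat; auto using Rabs_pos, sqrt_pos.
Qed.

Lemma h_asymptotic_scaled n : (1 <= n)%nat ->
  Rabs (h n - / sqrt (PI * INR n)) <= / sqrt (PI * INR n) / INR n.
Proof.
  intros Hn. pose proof (h_asymptotic n Hn) as H. pose proof PI_RGT_0.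
  assert (HnR : 1 <= INR n) by (apply le_INR in Hn; simpl in Hn; lra).
  assert (Hs : 0 < sqrt (PI * INR n)) by (apply sqrt_lt_R0; nra).
  replace (h n - / sqrt (PI * INR n)) with ((h n * sqrt (PI * INR n) - 1) * / sqrt (PI * INR n)) by (field; lra).
  rewrite Rabs_mult, (Rabs_pos_eq (/ sqrt _)) by (left; now apply Rinv_0_lt_compat).
  unfold Rdiv. rewrite (Rmult_comm (/ sqrt _) (/ INR n)).
  apply Rmult_le_compat_r; [left; now apply Rinv_0_lt_compat|assumption].
Qed.

Lemma wt_le_inv n : (1 <= n)%nat -> wt n <= / INR n.
Proof.
  intros Hn. apply le_INR in Hn. simpl in Hn. apply Rinv_le_contravar; lra.
Qed.

Lemma h_le_asymptotic n : (1 <= n)%nat -> h n <= 2 * / sqrt (PI * INR n).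
Proof.
  intros Hn. pose proof (h_asymptotic_scaled n Hn) as H. apply Rabs_le_between in H.
  assert (HnR : 1 <= INR n) by (apply le_INR in Hn; simpl in Hn; lra). pose proof PI_RGT_0.
  assert (Hs : 0 < / sqrt (PI * INR n)) by (apply Rinv_0_lt_compat, sqrt_lt_R0; nra).
  assert (/ sqrt (PI * INR n) / INR n <= / sqrt (PI * INR n)); [|lra].
  apply Rle_div_l; [lra|]. nra.
Qed.

Lemma Ob1_asymptotic (x : ser) L : 0 < L -> Ob 1 (x - cst L * hs) ->
  asymp_rel_O1n x (fun n => L / sqrt (PI * INR n)).
Proof.
  intros HL [C HC]. exists (2 * Rabs C / L + 1), 1%nat. intros n Hn.
  specialize (HC n). rewrite ssubE, cst_mul in HC. unfold hs in HC. simpl pow in HC. rewrite Rmult_1_r in HC.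
  assert (HnR : 1 <= INR n) by (apply le_INR in Hn; simpl in Hn; lra). pose proof PI_RGT_0.
  set (y := / sqrt (PI * INR n)).
  assert (Hs : 0 < sqrt (PI * INR n)) by (apply sqrt_lt_R0; nra).
  assert (Hy : 0 < y) by now apply Rinv_0_lt_compat.
  assert (Hin : 0 < / INR n) by (apply Rinv_0_lt_compat; lra).
  pose proof (h_asymptotic_scaled n Hn) as H1. fold y in H1.
  pose proof (h_le_asymptotic n Hn) as H2. fold y in H2. pose proof (wt_le_inv n Hn). pose proof (h_pos n). pose proof (wt_pos n).
  cbv beta. replace (L / sqrt (PI * INR n)) with (L * y) by reflexivity. rewrite (Rabs_pos_eq (L * y)) by nra.
  replace (x n - L * y) with ((x n - L * h n) + L * (h n - y)) by ring.
  eapply Rle_trans; [apply Rabs_triang|]. rewrite (Rabs_mult L), (Rabs_pos_eq L) by lra.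
  apply Rle_trans with (Rabs C * (2 * y * / INR n) + L * (y / INR n)).
  - apply Rplus_le_compat; [|apply Rmult_le_compat_l; lra].
    eapply Rle_trans; [exact HC|]. apply Rle_trans with (Rabs C * (h n * wt n)).
    + apply Rmult_le_compat_r; [nra|apply RRle_abs].
    + apply Rmult_le_compat_l; [apply Rabs_pos|]. apply Rmult_le_compat; lra.
  - right. field. lra.
Qed.

Lemma Ob2_asymptotic (x : ser) L : 0 < L -> Ob 2 (x - cst (- L) * sq) ->
  asymp_rel_O1n x (fun n => L / (2 * sqrt (PI * INR n ^ 3))).
Proof.
  intros HL [C HC]. exists (4 * Rabs C / L + 3), 1%nat. intros n Hn.
  specialize (HC n). rewrite ssubE, cst_mul in HC.
  assert (HnR : 1 <= INR n) by (apply le_INR in Hn; simpl in Hn; lra). pose proof PI_RGT_0.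
  set (y := / sqrt (PI * INR n)).
  assert (Hs : 0 < sqrt (PI * INR n)) by (apply sqrt_lt_R0; nra).
  assert (Hy : 0 < y) by now apply Rinv_0_lt_compat.
  assert (Hin : 0 < / INR n) by (apply Rinv_0_lt_compat; lra).
  assert (Esq : sqrt (PI * INR n ^ 3) = INR n * sqrt (PI * INR n)).
  { replace (PI * INR n ^ 3) with (INR n ^ 2 * (PI * INR n)) by ring.
    rewrite sqrt_mult by nra. rewrite sqrt_pow2 by lra. reflexivity. }
  assert (EA : L / (2 * sqrt (PI * INR n ^ 3)) = L * (y * / INR n / 2)).
  { rewrite Esq. unfold y. field. lra. }
  rewrite EA.
  (* An exact relation, so that the asymptotics of [h] is the only input; 2n - 1 and 2n differ by a
     relative O(1/n). *)
  assert (Ehn : - sq n = h n / (2 * INR n - 1)).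
  { destruct n as [|m]; [lia|]. rewrite sq_S, h_S, S_INR. unfold wt. pose proof (pos_INR m). field. lra. }
  pose proof (h_asymptotic_scaled n Hn) as H1. fold y in H1.
  pose proof (h_le_asymptotic n Hn) as H2. fold y in H2. pose proof (wt_le_inv n Hn). pose proof (h_pos n). pose proof (wt_pos n).
  assert (Hyn : 0 < y * / INR n) by nra.
  rewrite (Rabs_pos_eq (L * (y * / INR n / 2))) by nra.
  replace (x n - L * (y * / INR n / 2)) with ((x n - - L * sq n) + L * (- sq n - y * / INR n / 2)) by ring.
  eapply Rle_trans; [apply Rabs_triang|]. rewrite (Rabs_mult L), (Rabs_pos_eq L) by lra.
  assert (K1 : Rabs (x n - - L * sq n) <= Rabs C * (2 * y * (/ INR n * / INR n))).
  { eapply Rle_trans; [exact HC|]. apply Rle_trans with (Rabs C * (h n * wt n ^ 2)).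
    - apply Rmult_le_compat_r; [left; apply h_wt_pos|apply RRle_abs].
    - apply Rmult_le_compat_l; [apply Rabs_pos|]. simpl. rewrite Rmult_1_r.
      apply Rmult_le_compat; try nra. }
  assert (K2 : Rabs (- sq n - y * / INR n / 2) <= 3 * (y * / INR n / 2) * / INR n).
  { rewrite Ehn.
    replace (h n / (2 * INR n - 1) - y * / INR n / 2)
      with ((h n - y) * (/ INR n / 2) + h n * (/ INR n / 2) * (/ (2 * INR n - 1))) by (field; lra).
    eapply Rle_trans; [apply Rabs_triang|].
    assert (Hi : 0 < / (2 * INR n - 1) <= / INR n).
    { split; [apply Rinv_0_lt_compat; lra|apply Rinv_le_contravar; lra]. }
    assert (Hh2 : 0 <= h n * (/ INR n / 2)) by nra.
    rewrite (Rabs_pos_eq (h n * (/ INR n / 2) * / (2 * INR n - 1))) by nra.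
    rewrite Rabs_mult, (Rabs_pos_eq (/ INR n / 2)) by lra.
    apply Rle_trans with (y / INR n * (/ INR n / 2) + 2 * y * (/ INR n / 2) * / INR n).
    - apply Rplus_le_compat; [apply Rmult_le_compat_r; lra|]. apply Rmult_le_compat; try lra.
      apply Rmult_le_compat_r; lra.
    - right. unfold Rdiv. field. lra. }
  apply Rle_trans with (Rabs C * (2 * y * (/ INR n * / INR n)) + L * (3 * (y * / INR n / 2) * / INR n)).
  - apply Rplus_le_compat; [assumption|]. apply Rmult_le_compat_l; lra.
  - right. field. lra.
Qed.

Lemma asymp_scale (x : nat -> R) A r : 0 < r ->
  asymp_rel_O1n (scale r x) A -> asymp_rel_O1n x (fun n => A n * / r ^ n).
Proof.
  intros Hr (C & N & H). exists C, N. intros n Hn. specialize (H n Hn). unfold scale in H.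
  pose proof (pow_lt r n Hr) as Hp. assert (Hi : 0 < / r ^ n) by now apply Rinv_0_lt_compat.
  replace (x n - A n * / r ^ n) with ((x n * r ^ n - A n) * / r ^ n) by (field; lra).
  rewrite !Rabs_mult, (Rabs_pos_eq (/ r ^ n)) by lra.
  replace (C * (Rabs (A n) * / r ^ n) / INR n) with (C * Rabs (A n) / INR n * / r ^ n) by (unfold Rdiv; ring).
  apply Rmult_le_compat_r; lra.
Qed.

Lemma asymp_ext (x : nat -> R) A B : (forall n, (1 <= n)%nat -> A n = B n) -> asymp_rel_O1n x A -> asymp_rel_O1n x B.
Proof.
  intros E (C & N & H). exists C, (S N). intros n Hn. rewrite <- E by lia. apply H. lia.
Qed.

(** Values at 1 are compared first, then the coefficients of the root; [W_zero_ev] makes the second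
    comparison legitimate. *)
Lemma inverse_sq_coef x y a b : V 4 x -> V 4 y -> V 4 a -> V 4 b ->
  ((x + y * sq) * (a + b * sq) = cst 1)%ser -> ev x * ev a = 1 /\ ev x * ev b + ev y * ev a = 0.
Proof.
  intros Hx Hy Ha Hb E.
  assert (Hs : forall u, V 4 u -> summable u) by (intros; now apply (V_summable 4); [lia|]).
  split.
  - rewrite <- (ev_W 4 x y), <- (ev_W 4 a b) by (lia || assumption).
    rewrite <- sev_mul, E; [apply ev_cst|..]; apply (W_summable 4); try lia; eexists _, _; repeat split; assumption.
  - rewrite <- (sev_mul x b), <- (sev_mul y a), <- sev_add; auto using summable_mul.
    apply (W_zero_ev (x * a + y * b * omu - cst 1)).
    + apply V_sub; [|apply V_cst]. apply V_add; repeat apply V_mul; auto using V_omu.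
    + apply V_add; apply V_mul; auto.
    + transitivity ((x + y * sq) * (a + b * sq) - cst 1)%ser; [rewrite <- sq_mul_sq; ring|]. rewrite E. ring.
Qed.

Lemma subexponential_limit (x : nat -> R) L N r rho0 : 0 < rho0 -> 1 < r -> 0 <= N ->
  (forall n, Rabs (x n * rho0 ^ n - L) <= N * (/ r) ^ n) ->
  exists K, 0 < K < 1 / rho0 /\ is_lim_seq (fun n => (x n - / rho0 ^ n * L) / K ^ n) 0.
Proof.
  intros H0 Hr HN H. set (r' := (1 + r) / 2). assert (Hr' : 1 < r' < r) by (unfold r'; lra).
  (* The error has order (rho0 r)^(-n); r' strictly between 1 and r leaves the ratio (r' / r)^n,
     which tends to 0. *)
  exists (/ (rho0 * r')). split.
  - split; [apply Rinv_0_lt_compat; nra|]. unfold Rdiv. rewrite Rmult_1_l. apply Rinv_lt_contravar; nra.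
  - apply is_lim_seq_abs_0.
    apply is_lim_seq_le_le with (fun _ => 0) (fun n => N * (r' / r) ^ n).
    + intros n. split; [apply Rabs_pos|].
      pose proof (pow_lt rho0 n H0) as P0. pose proof (pow_lt r' n ltac:(lra)) as P1.
      replace ((x n - / rho0 ^ n * L) / (/ (rho0 * r')) ^ n) with ((x n * rho0 ^ n - L) * r' ^ n).
      * rewrite Rabs_mult, (Rabs_pos_eq (r' ^ n)) by lra. unfold Rdiv. rewrite Rpow_mult_distr.
        replace (N * (r' ^ n * (/ r) ^ n)) with (N * (/ r) ^ n * r' ^ n) by ring.
        apply Rmult_le_compat_r; [lra|apply H].
      * rewrite pow_inv, Rpow_mult_distr. field. lra.
    + apply is_lim_seq_const.
    + replace (Finite 0) with (Rbar_mult N 0) by (simpl; f_equal; ring).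
      apply is_lim_seq_scal_l, is_lim_seq_geom. rewrite Rabs_pos_eq; [apply Rlt_div_l; lra|].
      left; apply Rdiv_lt_0_compat; lra.
Qed.

Lemma ev_theta_scale_derive (a : ser) R M x : 0 < x < R -> (forall n, Rabs (a n * R ^ n) <= M) ->
  ev (theta (scale x a)) = x * Derive (PSeries a) x.
Proof.
  intros Hx HM. rewrite Derive_PSeries.
  2:{ eapply Rbar_lt_le_trans; [|apply (CV_radius_ge a R M ltac:(lra) HM)]. simpl. rewrite Rabs_pos_eq; lra. }
  unfold ev. rewrite Series_incr_1.
  - unfold PSeries. rewrite <- Series_scal_l. unfold theta at 1. simpl INR. rewrite Rmult_0_l, Rplus_0_l.
    apply Series_ext. intros n. unfold theta, scale, PS_derive. simpl pow. ring.
  - destruct (expd_summable _ (expd_theta _ (bounded_expd a R M x Hx HM))) as [N HN]. now apply l1_ex_series with N.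
Qed.

Theorem theorem4p3
  (c d : nat) (p : Z -> R) (q tau : R) (dn : nat -> R)
  (Hc : (1 <= c)%nat) (Hd : (1 <= d)%nat)
  (Hpos : forall i : Z, 0 <= p i)
  (Hsupp : forall i : Z, (i < - Z.of_nat c)%Z \/ (Z.of_nat d < i)%Z -> p i = 0)
  (Hpc : p (- Z.of_nat c)%Z <> 0) (Hpd : p (Z.of_nat d) <> 0)
  (Haper : aperiodic p)
  (Hq : 0 < q)
  (Htau : 0 < tau /\ Derive (jumpP c d p) tau = 0 /\
          forall u, 0 < u < tau -> Derive (jumpP c d p) u <> 0)
  (Hdn : D_coeffs c d p q dn) :
  let rho := 1 / jumpP c d p tau in
  let delta := Derive (jumpP c d p) 1 in
  (* (i) *)
  (forall rho0, is_rho0 c d p q rho rho0 -> rho0 < rho ->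
     exists K, 0 < K < 1 / rho0 /\
       is_lim_seq (fun n => (dn n - (/ rho0 ^ n) / (rho0 * Derive (Qfun c d p q) rho0))
                            / K ^ n) 0) /\
  (* (ii) *)
  (is_rho0 c d p q rho rho ->
     exists eta, puiseux_eta c d p q rho eta /\
       asymp_rel_O1n dn (fun n => (/ rho ^ n) / (eta * sqrt (PI * INR n)))) /\
  (* (iii) *)
  (no_rho0 c d p q rho ->
     exists eta, puiseux_eta c d p q rho eta /\
       asymp_rel_O1n dn (fun n => (/ (1 - Qfun c d p q rho)) ^ 2 * eta * / rho ^ n
                                  / (2 * sqrt (PI * INR n ^ 3)))) /\
  (* the last two cases occur only when delta < 0 *)
  (is_rho0 c d p q rho rho \/ no_rho0 c d p q rho -> delta < 0).
Proof.
  destruct Htau as (Ht0 & Htd & _). intros rho delta.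
  pose proof (jumpP_pos c d p tau Hpos Hpc Ht0) as HPt.
  pose proof (jumpP_pos c d p 1 Hpos Hpc ltac:(lra)) as HP1.
  rewrite (Derive_jumpP c d p tau Ht0) in Htd.
  assert (Edel : delta = jump_derivative c d p 1) by (apply Derive_jumpP; lra).
  assert (Erho : rho = / jumpP c d p tau) by (unfold rho, Rdiv; ring).
  assert (Hrho : 0 < rho) by (rewrite Erho; now apply Rinv_0_lt_compat).
  set (Q := Qcoef c d p q : ser).
  assert (HQpos : forall n, 0 <= Q n) by (intros; apply Qcoef_pos; auto).
  assert (Htan : forall u, 0 < u -> jumpP c d p tau <= jumpP c d p u).
  { intros u Hu. pose proof (jumpP_tangent c d p tau u Hpos Ht0 Hu). rewrite Htd in H. lra. }
  assert (Htau1 : delta < 0 -> 1 < tau).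
  { intros Hneg. rewrite Edel in Hneg. pose proof (jumpP_tangent c d p 1 tau Hpos ltac:(lra) Ht0) as Hta.
    pose proof (Htan 1 ltac:(lra)). destruct (Rtotal_order tau 1) as [Hlt|[Heq|Hgt]]; [|rewrite Heq in Htd; lra|assumption].
    assert (0 < jump_derivative c d p 1 * (tau - 1)) by nra. lra. }
  assert (HR1 : / jumpP c d p 1 <= rho).
  { rewrite Erho. apply Rinv_le_contravar; [assumption|apply Htan; lra]. }
  assert (HR10 : 0 < / jumpP c d p 1) by now apply Rinv_0_lt_compat.
  assert (Hb1 := fun n => Qcoef_bounded c d p q Hc Hd Hpos Hsupp Hpc Hpd Hq 1 n (Rle_refl 1)).
  assert (Hdiv : 0 <= delta -> exists N, 1 < sum_f_R0 (scale (/ jumpP c d p 1) Q) N).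
  { intros H. apply Q_series_diverges; auto. now rewrite <- Edel. }
  (* For [delta] >= 0 the value 1 is attained strictly before 1 / P(1) <= [rho], against both the
     minimality of [rho] and the absence of a root. *)
  assert (Hlast : is_rho0 c d p q rho rho \/ no_rho0 c d p q rho -> delta < 0).
  { intros H. destruct (Rlt_le_dec delta 0) as [|Hge]; [assumption|exfalso].
    destruct (Hdiv Hge) as [N HN].
    destruct (series_reaches_one Q (/ jumpP c d p 1) _ N HR10 HQpos eq_refl Hb1 HN) as (r & Hr & Hser).
    destruct H as [(_ & _ & _ & Hmin)|Hno].
    - apply (Hmin r); [lra|exact Hser].
    - apply Hno. exists r. repeat split; [lra|lra|exact Hser]. }
  assert (HQge : forall r, 0 < r -> forall n, 0 <= scale r Q n).
  { intros r Hr n. apply Rmult_le_pos; [apply HQpos|apply pow_le; lra]. }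
  assert (HQadj : forall r, 0 < r -> forall n, (c < n)%nat -> 0 < scale r Q (S n)).
  { intros r Hr n Hn. apply Rmult_lt_0_compat; [apply Qcoef_positive; auto|now apply pow_lt]. }
  assert (HQ0 : forall r, scale r Q O = 0) by (intros r; unfold scale, Q; simpl; ring).
  (* Order 6 because [tempered 4] is drawn from [W 6], and because [W_inverse] wants order 5 after
     case (ii) has spent one on [tails A]. The witness for eta is minus the singular coefficient,
     hence positive. *)
  assert (Hsing : delta < 0 -> exists A B, V 6 A /\ V 6 B /\ scale rho Q = (A + B * sq)%ser /\ ev B < 0 /\
     ev (scale rho Q) = ev A /\ Qfun c d p q rho = ev A /\ puiseux_eta c d p q rho (- ev B)).
  { intros Hneg. specialize (Htau1 Hneg).
    destruct (aperiodic_step_law c d p tau rho Hc Hd Hpos Hsupp Hpc Hpd Haper Ht0 Hrho) as [C HS].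
    { rewrite Erho. apply Rinv_r. lra. }
    { assumption. }
    rewrite Erho in HS.
    pose proof (W_scale_Q c d p q Hc Hd Hpos Hsupp Hpc Hpd 6 tau C ltac:(lia) Htau1 HS) as HW.
    fold Q in HW. rewrite <- Erho in HW. destruct HW as (A & B & HA & HB & E).
    assert (HA4 : V 4 A) by (apply V_mono with (2 := HA); lia).
    assert (HB4 : V 4 B) by (apply V_mono with (2 := HB); lia).
    assert (EvQ : ev (scale rho Q) = ev A) by (rewrite E; apply (ev_W 4); auto; lia).
    exists A, B. repeat split; auto.
    - apply (singular_coefficient_neg c d p q Hc Hd Hpos Hsupp Hpc Hpd Hq tau A B); auto. rewrite <- Erho. exact E.
    - destruct (W_summable 4 (scale rho Q) ltac:(lia)) as [N HN].
      + rewrite E. eexists _, _. repeat split; eassumption.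
      + now apply l1_ex_series with N.
    - destruct (W_puiseux A B HA4 HB4) as [C' HC']. exists C', rho. split; [assumption|]. intros z Hz.
      assert (Hx : 0 < z / rho < 1) by (split; [apply Rdiv_lt_0_compat; lra|apply Rlt_div_l; lra]).
      specialize (HC' (z / rho) Hx). rewrite <- E, scale_scale in HC'.
      replace (z / rho * rho) with z in HC' by (field; lra).
      change (Qfun c d p q rho) with (ev (scale rho Q)). rewrite EvQ.
      change (Qfun c d p q z) with (ev (scale z Q)).
      replace (ev A - - ev B * sqrt (1 - z / rho)) with (ev A + ev B * sqrt (1 - z / rho)) by ring. exact HC'. }
  split; [|split; [|split; [|exact Hlast]]].
  - intros rho0 (H0 & _ & Hone & _) Hlt.
    (* Room beyond [rho0]: [rho] itself when [delta] < 0. Otherwise 1 / P(1), where partial sums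
       exceed 1, which they could not do if [rho0] were at least that large. *)
    assert (HR : exists R M, rho0 < R /\ forall n, Rabs (Q n * R ^ n) <= M).
    { destruct (Rlt_le_dec delta 0) as [Hneg|Hge].
      - exists rho. eexists. split; [assumption|]. intros n. rewrite Erho. apply Qcoef_bounded; auto.
        left. now apply Htau1.
      - exists (/ jumpP c d p 1). eexists. split; [|exact Hb1].
        destruct (Rlt_le_dec rho0 (/ jumpP c d p 1)) as [|Hle]; [assumption|exfalso].
        destruct (Hdiv Hge) as [N HN].
        assert (Hpart : sum_f_R0 (fun n => Q n * rho0 ^ n) N <= 1).
        { apply series_partial_le; [|exact Hone]. intros k. now apply HQge. }
        assert (Hcmp : sum_f_R0 (scale (/ jumpP c d p 1) Q) N <= sum_f_R0 (fun n => Q n * rho0 ^ n) N).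
        { apply sum_Rle. intros k _. unfold scale. apply Rmult_le_compat_l; [apply HQpos|].
          apply pow_incr. lra. }
        lra. }
    destruct HR as (R & M & HR & HM).
    destruct (geometric_renewal (scale rho0 Q) (scale rho0 dn) (S (S c))) as (r & N & Hr & HN & Hlim); auto.
    { apply bounded_expd with R M; [lra|assumption]. }
    { apply is_series_unique. exact Hone. }
    { now apply D_inverse_scale. }
    rewrite (ev_theta_scale_derive Q R M rho0 ltac:(lra) HM) in Hlim.
    exact (subexponential_limit dn _ N r rho0 H0 Hr HN Hlim).
  - intros Hrr. destruct (Hsing (Hlast (or_introl Hrr))) as (A & B & HA & HB & E & HBneg & EvQ & EQ & Hpui).
    destruct Hrr as (_ & _ & Hone & _).
    assert (EvA : ev A = 1) by (rewrite <- EvQ; apply is_series_unique; exact Hone).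
    exists (- ev B). split; [assumption|].
    pose proof (D_inverse_scale c d p q dn rho Hdn) as HD. fold Q in HD.
    set (Dh := scale rho dn) in *. set (G := (sq * Dh)%ser).
    assert (HQl1 : l1 (scale rho Q) 1).
    { intros n. rewrite (sum_eq _ (scale rho Q)) by (intros; now apply Rabs_pos_eq, HQge).
      apply series_partial_le; [now apply HQge|exact Hone]. }
    assert (HWQ : W 6 (scale rho Q)) by (exists A, B; auto).
    (* Since A(1) = 1, the difference 1 - A is (1-z) [tails A], so 1 - Q contains a factor
       sqrt(1-z). Moving it to D makes the cofactor invertible at 1, with value eta there. *)
    assert (HF : ((- B + tails A * sq) * G = cst 1)%ser).
    { rewrite <- HD, E. rewrite (omu_tails A) at 2. rewrite EvA. unfold G. rewrite <- sq_mul_sq. ring. }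
    assert (Ht : tempered 4 G).
    { apply tempered_mul; [apply tempered_sq|]. apply tempered_inverse with (scale rho Q); [assumption|now apply tempered_W|].
      exists 4%nat. apply renewal_tempered with (scale rho Q) (S (S c)); auto. }
    assert (HB5 : V 5 (- B)) by (apply V_opp, V_mono with (2 := HB); lia).
    assert (HA5 : V 5 (tails A)) by (apply V_tails; [lia|assumption]).
    assert (EvB : ev (- B) = - ev B).
    { replace (- B)%ser with (cst 0 - B)%ser by ring. rewrite sev_sub, ev_cst; [ring|apply summable_cst|].
      now apply (V_summable 6); [lia|]. }
    destruct (W_inverse (- B) (tails A) G HB5 HA5) as (a & b & Ha & Hb & EG); auto; [rewrite EvB; lra|].
    assert (Eab := HF). rewrite EG in Eab.
    apply inverse_sq_coef in Eab; auto; try (eapply V_mono; [|eassumption]; lia).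
    destruct Eab as [Ea _]. rewrite EvB in Ea.
    assert (EDh : Dh = (hs * (a + b * sq))%ser).
    { rewrite <- EG. unfold G. transitivity ((sq * hs) * Dh)%ser; [rewrite sq_mul_h; ring|ring]. }
    pose proof (h_mul_W_coefs a b Ha Hb) as Has. rewrite <- EDh in Has.
    assert (Eva : ev a = / - ev B) by (apply Rmult_eq_reg_l with (- ev B); [rewrite Ea; field; lra|lra]).
    rewrite Eva in Has.
    apply Ob1_asymptotic in Has; [|apply Rinv_0_lt_compat; lra].
    apply asymp_scale in Has; [|assumption].
    eapply asymp_ext; [|exact Has]. intros n Hn. cbv beta.
    apply le_INR in Hn. simpl in Hn. pose proof PI_RGT_0. 
    assert (0 < sqrt (PI * INR n)) by (apply sqrt_lt_R0; nra). pose proof (pow_lt rho n Hrho).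
    field. lra.
  - intros Hno. destruct (Hsing (Hlast (or_intror Hno))) as (A & B & HA & HB & E & HBneg & EvQ & EQ & Hpui).
    pose proof (D_inverse_scale c d p q dn rho Hdn) as HD. fold Q in HD.
    assert (HWQ : W 6 (scale rho Q)) by (exists A, B; auto).
    destruct (W_summable 6 _ ltac:(lia) HWQ) as [N HN].
    (* A partial sum above 1 would force a root before [rho]; the value 1 at [rho] itself would also
       be a root, whence Q(rho) < 1 below. *)
    assert (Hpart : forall n, sum_f_R0 (scale rho Q) n <= 1).
    { intros n. apply Rnot_lt_le. intros Hgt.
      destruct (series_reaches_one Q rho N n Hrho HQpos eq_refl (fun k => l1_coef (scale rho Q) N k HN) Hgt) as (r & Hr & Hser).
      apply Hno. exists r. repeat split; [lra|lra|exact Hser]. }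
    assert (HQl1 : l1 (scale rho Q) 1).
    { intros n. rewrite (sum_eq _ (scale rho Q)) by (intros; now apply Rabs_pos_eq, HQge). apply Hpart. }
    assert (EvA : ev A < 1).
    { rewrite <- EvQ. destruct (Rle_lt_or_eq_dec (ev (scale rho Q)) 1) as [|Heq]; [|assumption|exfalso].
      - pose proof (ev_bound _ _ HQl1) as Hb. apply Rabs_le_between in Hb. lra.
      - apply Hno. exists rho. repeat split; [assumption|lra|].
        unfold Q_eq_one. rewrite <- Heq. exact (ev_is_series _ _ HN). }
    exists (- ev B). split; [assumption|].
    set (Dh := scale rho dn) in *.
    assert (HF : (((cst 1 - A) + (- B) * sq) * Dh = cst 1)%ser).
    { rewrite <- HD at 2. rewrite E. ring. }
    assert (Ht : tempered 4 Dh).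
    { apply tempered_inverse with (scale rho Q); [assumption|now apply tempered_W|].
      exists 4%nat. apply renewal_tempered with (scale rho Q) (S (S c)); auto. }
    assert (HB5 : V 5 (- B)) by (apply V_opp, V_mono with (2 := HB); lia).
    assert (HA5 : V 5 (cst 1 - A)) by (apply V_sub; [apply V_cst|apply V_mono with (2 := HA); lia]).
    assert (HsA : summable A) by (now apply (V_summable 6); [lia|]).
    assert (EvB : ev (- B) = - ev B).
    { replace (- B)%ser with (cst 0 - B)%ser by ring. rewrite sev_sub, ev_cst; [ring|apply summable_cst|].
      now apply (V_summable 6); [lia|]. }
    assert (Ev1A : ev (cst 1 - A) = 1 - ev A) by (rewrite sev_sub, ev_cst; auto using summable_cst).
    destruct (W_inverse (cst 1 - A) (- B) Dh HA5 HB5) as (a & b & Ha & Hb & EG); auto; [rewrite Ev1A; lra|].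
    assert (Eab := HF). rewrite EG in Eab.
    apply inverse_sq_coef in Eab; auto; try (eapply V_mono; [|eassumption]; lia).
    destruct Eab as [Ea Eb]. rewrite Ev1A in Ea, Eb. rewrite EvB in Eb.
    assert (Eva : ev a = / (1 - ev A)) by (apply Rmult_eq_reg_l with (1 - ev A); [rewrite Ea; field; lra|lra]).
    (* The root enters D with coefficient -eta D(rho)^2; the coefficients of sqrt(1-z) being
       equivalent to -1 / (2 sqrt(pi n^3)), this is the constant of case (iii). *)
    assert (Evb : ev b = - ((/ (1 - ev A)) ^ 2 * - ev B)).
    { apply Rmult_eq_reg_l with (1 - ev A); [|lra]. rewrite Eva in Eb.
      transitivity (ev B * / (1 - ev A)); [lra|field; lra]. }
    pose proof (W_coefs a b Ha Hb) as Has. rewrite <- EG, Evb in Has.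
    apply Ob2_asymptotic in Has.
    2:{ apply Rmult_lt_0_compat; [apply pow_lt, Rinv_0_lt_compat; lra|lra]. }
    apply asymp_scale in Has; [|assumption].
    eapply asymp_ext; [|exact Has]. intros n Hn. cbv beta. rewrite EQ.
    unfold Rdiv. ring.
Qed.
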